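(* Let $E$ be a Drinfeld module over $S=\mathrm{Spf}\,R$ which splits at $m$. Then the $R$-module $\mathbf X_m(E)$ is free of rank $1$, and the canonical map $$R\{\phi^*\}\otimes_R \mathbf X_m(E)\longrightarrow \mathbf X_\infty(E),\qquad P\otimes\Theta\mapsto P\cdot\Theta,$$ is an isomorphism.
   Context: Let $p$ be a prime, $q=p^h$ ($h\ge1$), $X$ a projective, geometrically connected, smooth curve over $\mathbb F_q$, $\infty\in X(\mathbb F_q)$, $A=\mathcal O(X\setminus\{\infty\})$, $\mathfrak p\subset A$ a maximal ideal, $\hat A$ the $\mathfrak p$-adic completion, $\hat q=|A/\mathfrak p|$, $t\in\mathfrak p\setminus\mathfrak p^2$ and $\pi$ its image in $\hat A$. Let $R$ be an $\hat A$-algebra which is a complete discrete valuation ring with maximal ideal $\pi R$, with structure map $\theta:A\to R$, and fix an $\hat A$-algebra endomorphism $\phi:R\to R$ with $\phi(x)\equiv x^{\hat q}\pmod{\pi R}$. Let $S=\mathrm{Spf}R$ and $\hat{\mathbb G}_a=\mathrm{Spf}R\langle x\rangle$ the $\pi$-adic formal additive group. Let $R\{\tau\}^\wedge$ be the set of sums $\sum_{i\ge0}b_i\tau^i$, $b_i\in R$, $b_i\to0$ $\pi$-adically, acting on $\hat{\mathbb G}_a$ by $x\mapsto\sum b_ix^{q^i}$, with composition $b\tau^i\circ c\tau^j=bc^{q^i}\tau^{i+j}$. An admissible $A$-module scheme is $\hat{\mathbb G}_a$ with a ring homomorphism $\varphi_E:A\to R\{\tau\}^\wedge$ such that the $\tau^0$-coefficient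 of $\varphi_E(a)$ is $\theta(a)$. A Drinfeld module of rank $r$ is an admissible $A$-module scheme $E$ such that for every nonzero $a\in A$ the group scheme $\ker\varphi_E(a)$ is finite of degree $q^{-r\,\mathrm{ord}_\infty(a)}$ over $S$. The target $\hat{\mathbb G}_a$ of characters carries the $A$-action $a\mapsto\theta(a)\tau^0$. Witt vectors: for an $R$-algebra $B$, $B^{\phi^i}$ is $B$ with structure map $R\xrightarrow{\phi^i}R\to B$; $W_n(B)$ is the set $B^{n+1}$ with the unique functorial $R$-algebra structure making the ghost map $w:W_n(B)\to B\times B^\phi\times\cdots\times B^{\phi^n}$, $w_i(x_0,\dots,x_n)=\sum_{k=0}^{i}\pi^kx_k^{\hat q^{i-k}}$, an $R$-algebra homomorphism. The Frobenius $F:W_{n}(B)\to W_{n-1}(B)$ is the functorial ring map with $w_i(F(x))=w_{i+1}(x)$; it is given by polynomials with coefficients in $\hat A$. The jet space $J^nE$ is the formal scheme $\mathrm{Spf}R\langle x_0,\dots,x_n\rangle$ with $J^nE(B)=E(W_n(B))=W_n(B)$, with group and $A$-module structure induced from $E$ (an element $a$ acts on $W_n(B)$ by evaluating $\varphi_E(a)$ in the ring $W_n(B)$). Let $\mathbf X_n(E)=\mathrm{Hom}_A(J^nE,\hat{\mathbb G}_a)$ (homomorphisms of $A$-module formal schemes over $S$), an $R$-module; pull-back along the truncations $J^{n}E\to J^{n-1}E$ gives injections $\mathbf X_{n-1}(E)\to\mathbf X_n(E)$, and $\mathbf X_\infty(E)=\varinjlim_n\mathbf X_n(E)$. For $\Theta\in\mathbf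 X_n(E)$ (a restricted power series in $x_0,\dots,x_n$), let $\Theta^\phi$ be obtained by applying $\phi$ to its coefficients and set $\phi^*\Theta(x_0,\dots,x_{n+1})=\Theta^\phi(F(x_0,\dots,x_{n+1}))\in\mathbf X_{n+1}(E)$; this makes $\mathbf X_\infty(E)$ a left module over the twisted polynomial ring $R\{\phi^*\}$ with $\phi^*r=\phi(r)\phi^*$. $E$ splits at $m$ if $\mathbf X_m(E)\neq0$ and $\mathbf X_i(E)=0$ for $0\le i\le m-1$. *)

(* Defs.v *)
From HB Require Import structures.
From mathcomp Require Import all_boot all_order all_algebra.
From mathcomp Require Import finmap mpoly.
From Stdlib Require Import ClassicalEpsilon.

Set Implicit Arguments.
Unset Strict Implicit.
Unset Printing Implicit Defensive.

Import Order.TTheory GRing.Theory Num.Theory.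

Local Open Scope ring_scope.

(* The projective, smooth, geometrically connected curve X over the finite    *)
(* field Fq is given by its function field K: its closed points are the       *)
(* normalized discrete valuations of K which are trivial on Fq, the local     *)
(* ring at v being {f | 0 <= v f}.  The valuations take the value 0 at 0      *)
(* (by convention, instead of +oo), so that they are determined by their      *)
(* restriction to K \ {0} and 0 <= v f holds for f = 0.                       *)
Section Curve.

Variables (Fq : finFieldType) (K : fieldType) (iK : {rmorphism Fq -> K}).

Definition algebraic_over (f : K) : Prop :=
  exists2 P : {poly Fq}, P != 0 & (map_poly iK P).[f] = 0.

Definition rational_function_of (x f : K) : Prop :=
  exists P Q : {poly Fq},
    (map_poly iK Q).[x] != 0 /\ f = (map_poly iK P).[x] / (map_poly iK Q).[x].

(* Geometric connectedness says that Fq is algebraically closed in K, since   *)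
(* X is smooth and connected, and Fq is perfect.                              *)
Definition curve_function_field : Prop :=
  (exists2 x : K, ~ algebraic_over x &
     exists (d : nat) (e : 'I_d -> K), forall f : K, exists2 c : 'I_d -> K,
       forall i, rational_function_of x (c i) & f = \sum_i c i * e i)
  /\ (forall f : K, algebraic_over f -> exists c : Fq, f = iK c).

Definition closed_point (v : K -> int) : Prop :=
  [/\ v 0 = 0,
      forall f g, f != 0 -> g != 0 -> v (f * g) = v f + v g,
      forall f g, f != 0 -> g != 0 -> f + g != 0 ->
        Num.min (v f) (v g) <= v (f + g),
      forall c : Fq, v (iK c) = 0
    & exists2 f, f != 0 & v f = 1].

(* The residue field is Fq: each f regular at v is constant modulo the        *)
(* maximal ideal.                                                             *)
Definition rational_point (v : K -> int) : Prop :=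
  closed_point v /\
  forall f, 0 <= v f -> exists c : Fq, f = iK c \/ 0 < v (f - iK c).

(* A is O(X \ {infty}), identified by iA with a subring of K. *)
Definition ring_of_affine_curve (ord_infty : K -> int)
    (A : comNzRingType) (iA : {rmorphism A -> K}) : Prop :=
  injective iA /\
  forall f : K, (exists a, iA a = f) <->
    (forall v, closed_point v -> ~ (v =1 ord_infty) -> 0 <= v f).

End Curve.

Section Completion.

Variable A : comNzRingType.

Definition ideal (J : A -> Prop) : Prop :=
  [/\ J 0, forall a b, J a -> J b -> J (a + b) & forall a b, J b -> J (a * b)].

Definition maximal_ideal (J : A -> Prop) : Prop :=
  [/\ ideal J, ~ J 1 &
      forall I : A -> Prop, ideal I -> (forall a, J a -> I a) -> ~ I 1 ->
        forall a, I a -> J a].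

(* k is A / J, with quotient map res. *)
Definition residue_field (J : A -> Prop) (k : finFieldType)
    (res : {rmorphism A -> k}) : Prop :=
  (forall z, exists a, res a = z) /\ (forall a, res a = 0 <-> J a).

Fixpoint ideal_pow (J : A -> Prop) (n : nat) : A -> Prop :=
  if n is n'.+1 then fun a =>
    exists (d : nat) (b c : 'I_d -> A),
      (forall i, J (b i) /\ ideal_pow J n' (c i)) /\ a = \sum_i b i * c i
  else fun _ => True.

Variables (Ahat : comNzRingType) (jA : {rmorphism A -> Ahat}).

Definition extended_ideal (J : A -> Prop) (x : Ahat) : Prop :=
  exists (d : nat) (b : 'I_d -> A) (y : 'I_d -> Ahat),
    (forall i, J (b i)) /\ x = \sum_i jA (b i) * y i.

(* Ahat is the limit of the A / J^n = Ahat / J^n Ahat. *)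
Definition adic_completion (J : A -> Prop) : Prop :=
  [/\ forall n a, extended_ideal (ideal_pow J n) (jA a) -> ideal_pow J n a,
      forall n x, exists a, extended_ideal (ideal_pow J n) (x - jA a),
      forall x, (forall n, extended_ideal (ideal_pow J n) x) -> x = 0
    & forall u : nat -> A, (forall n, ideal_pow J n (u n.+1 - u n)) ->
        exists x, forall n, extended_ideal (ideal_pow J n) (x - jA (u n))].

End Completion.

Section Base.

Variable R : idomainType.

Definition divides (d x : R) : Prop := exists y, x = d * y.

Definition complete_dvr (pi : R) : Prop :=
  [/\ pi != 0, pi \isn't a GRing.unit,
      forall x, x != 0 ->
        exists (n : nat) (u : R), u \is a GRing.unit /\ x = u * pi ^+ n
    & forall u : nat -> R, (forall n, divides (pi ^+ n) (u n.+1 - u n)) ->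
        exists x, forall n, divides (pi ^+ n) (x - u n)].

Definition frobenius_lift (pi : R) (Q : nat) (phi : R -> R) : Prop :=
  forall x, divides pi (phi x - x ^+ Q).

End Base.

(* The value at which u is eventually constant. *)
Definition eventual_value (T : Type) (u : nat -> T) : T :=
  epsilon (inhabits (u 0%N))
    (fun v => exists N, forall M, (N <= M)%N -> u M = v).

(* W_n(B) is {ffun 'I_n.+1 -> B}.  By functoriality its operations are given  *)
(* by polynomials, and these are determined by the ghost map since            *)
(* polynomial rings over R have no pi-torsion.                                *)
Section Witt.

Variables (R : idomainType) (pi : R) (Q : nat) (phi : {rmorphism R -> R}).

Definition ghost (B : comAlgType R) (n : nat) (x : 'I_n.+1 -> B) (i : nat) : B :=
  \sum_(k < n.+1 | (k <= i)%N) pi ^+ k *: x k ^+ (Q ^ (i - k)).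

(* The Witt vector over {mpoly R[N]} with ghost components g_0, ..., g_n; see *)
(* unghostP and unghost_unique below.                                         *)
Definition unghost (n N : nat) (g : nat -> {mpoly R[N]}) :
    {ffun 'I_n.+1 -> {mpoly R[N]}} :=
  epsilon (inhabits [ffun=> 0])
    (fun S : {ffun 'I_n.+1 -> {mpoly R[N]}} =>
       forall i, (i <= n)%N -> ghost S i = g i).

Definition wvar (n : nat) (i : 'I_n.+1) : {mpoly R[n.+1]} := 'X_i.
Definition wvarl (n : nat) (i : 'I_n.+1) : {mpoly R[n.+1 + n.+1]} :=
  'X_(lshift n.+1 i).
Definition wvarr (n : nat) (i : 'I_n.+1) : {mpoly R[n.+1 + n.+1]} :=
  'X_(rshift n.+1 i).

Definition wadd_poly n := unghost n (fun i => ghost (@wvarl n) i + ghost (@wvarr n) i).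
Definition wmul_poly n := unghost n (fun i => ghost (@wvarl n) i * ghost (@wvarr n) i).
Definition wscale_poly n (r : R) :=
  unghost n (fun i => iter i phi r *: ghost (@wvar n) i).
(* The components of F : W_(n+1)(B) -> W_n(B). *)
Definition frob_poly n := unghost n (fun i => ghost (@wvar n.+1) i.+1).

Section Operations.

Variables (B : comAlgType R) (n : nat).
Implicit Types x y : {ffun 'I_n.+1 -> B}.

Definition peval (N : nat) (x : 'I_N -> B) (P : {mpoly R[N]}) : B :=
  mmap (in_alg B) x P.

Definition pair_vars x y (i : 'I_(n.+1 + n.+1)) : B :=
  match split i with inl j => x j | inr j => y j end.

Definition wadd x y : {ffun 'I_n.+1 -> B} :=
  [ffun j => peval (pair_vars x y) (wadd_poly n j)].
Definition wmul x y : {ffun 'I_n.+1 -> B} :=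
  [ffun j => peval (pair_vars x y) (wmul_poly n j)].
Definition wscale (r : R) x : {ffun 'I_n.+1 -> B} :=
  [ffun j => peval x (wscale_poly n r j)].
(* Only meant for d > 0. *)
Definition wexp x (d : nat) : {ffun 'I_n.+1 -> B} := iterop d wmul x [ffun=> 0].

End Operations.

End Witt.

(* unghost is meaningful for each of the four Witt operations above. *)
Section WittExistence.

Variables (R : idomainType) (pi : R) (p e : nat) (phi : {rmorphism R -> R}).
Hypotheses (pi_neq0 : pi != 0) (pchar_p : p \in [pchar R]) (e_gt0 : (0 < e)%N).
Hypotheses (phi_pi : phi pi = pi).
Hypothesis (phiP : frobenius_lift pi (p ^ e) phi).

Let Q := (p ^ e)%N.

Let Q_gt1 : (1 < Q)%N.
Proof. by rewrite -(exp1n e) ltn_exp2r // prime_gt1 // (pcharf_prime pchar_p). Qed.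

Let Q_gt0 : (0 < Q)%N. Proof. exact: ltnW Q_gt1. Qed.

Section Fixed.

Variable N : nat.
Local Notation P := {mpoly R[N]}.

Local Notation Phi := (@mmap N R P (@mpolyC N R \o phi) (fun i => 'X_i ^+ Q)).

Let scalepI k (f g : P) : pi ^+ k *: f = pi ^+ k *: g -> f = g.
Proof.
move=> eqfg; apply/mpolyP => m; apply: (mulfI (expf_neq0 k pi_neq0)).
by rewrite -!mcoeffZ eqfg.
Qed.

Let PhiZ c f : Phi (c *: f) = phi c *: Phi f.
Proof. by rewrite mmapZ /= mul_mpolyC. Qed.

Let PhiX i : Phi 'X_i = 'X_i ^+ Q.
Proof. by rewrite mmapX mmap1U. Qed.

Let exprDQ j (f g : P) : (f + g) ^+ (Q ^ j) = f ^+ (Q ^ j) + g ^+ (Q ^ j).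
Proof.
have pP : p \in [pchar P].
  rewrite inE (pcharf_prime pchar_p) -mpolyC_nat.
  by rewrite (pcharf0 pchar_p) mpolyC0 eqxx.
rewrite exprDn_pchar // -expnM; apply/pnatP.
  by rewrite expn_gt0 prime_gt0 // (pcharf_prime pchar_p).
move=> l l_pr; rewrite Euclid_dvdX // => /andP[+ _].
by rewrite dvdn_prime2 ?(pcharf_prime pchar_p) // => /eqP->.
Qed.

Let Phi_lift f : exists g, Phi f = f ^+ Q + pi *: g.
Proof.
have := exprDQ 1; rewrite expn1 => exprDQ1.
elim/mpolyind: f => [|c m f _ _ [g Phif]].
  by exists 0; rewrite mmap0 expr0n (gtn_eqF Q_gt0) scaler0 addr0.
have [d phic] := phiP c.
exists (d *: ('X_[m] ^+ Q) + g); rewrite rmorphD /= exprDQ1 PhiZ Phif.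
rewrite [Phi 'X_[m]]mmapX; have -> : mmap1 (fun i => 'X_i ^+ Q) m = 'X_[m] ^+ Q :> P.
  rewrite /mmap1 mpolyXE_id -prodrXl; apply: eq_bigr => i _.
  by rewrite exprAC.
have -> : phi c = c ^+ Q + pi * d by rewrite -phic addrC subrK.
by rewrite exprZn scalerDl scalerDr scalerA addrACA.
Qed.

Let Phi_ghost n (S : 'I_n.+1 -> P) i : (i <= n)%N -> exists h,
  Phi (ghost pi Q S i) =
  \sum_(k < n.+1 | (k <= i)%N) pi ^+ k *: S k ^+ (Q ^ (i.+1 - k))
    + pi ^+ i.+1 *: h.
Proof.
move=> le_in.
have H (k : 'I_n.+1) : (k <= i)%N -> exists h,
    Phi (pi ^+ k *: S k ^+ (Q ^ (i - k))) =
    pi ^+ k *: S k ^+ (Q ^ (i.+1 - k)) + pi ^+ i.+1 *: h.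
  move=> le_ki; have [g PhiS] := Phi_lift (S k).
  exists (pi ^+ (k + Q ^ (i - k) - i.+1) *: g ^+ (Q ^ (i - k))).
  rewrite PhiZ !rmorphXn /= phi_pi PhiS exprDQ scalerDr -exprM -expnS -subSn //.
  congr (_ + _); rewrite exprZn !scalerA -!exprD subnKC //.
  by rewrite -{1}(subnKC le_ki) ltn_add2l ltn_expl.
rewrite /ghost rmorph_sum.
elim/big_rec2: _ => [|k f g le_ki [h gE]]; first by exists 0; rewrite scaler0 addr0.
have [h' kE] := H k le_ki; exists (h' + h).
by rewrite /= kE gE scalerDr addrACA.
Qed.

Lemma unghostP n (g : nat -> P) :
    (forall i, (i < n)%N -> exists h, g i.+1 = Phi (g i) + pi ^+ i.+1 *: h) ->
  forall i, (i <= n)%N -> ghost pi Q (unghost pi Q n g) i = g i.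
Proof.
move=> gP; rewrite /unghost; apply: (epsilon_spec (inhabits _)
  (fun S : {ffun 'I_n.+1 -> P} => forall i, (i <= n)%N -> ghost pi Q S i = g i)).
suff [S SP] : exists S : nat -> P, forall i, (i <= n)%N ->
    \sum_(k < i.+1) pi ^+ k *: S k ^+ (Q ^ (i - k)) = g i.
  exists [ffun k : 'I_n.+1 => S k] => i le_in; rewrite -(SP i le_in) /ghost.
  rewrite (big_ord_widen_cond n.+1 predT
    (fun k => pi ^+ k *: S k ^+ (Q ^ (i - k)))) //.
  by apply: eq_bigr => k _; rewrite ffunE.
elim: n => [|n IHn] in gP *.
  exists (fun=> g 0%N) => i; rewrite leqn0 => /eqP->.
  by rewrite big_ord1 expr0 scale1r expn0 expr1.
have [|S SP] := IHn; first by move=> i lt_in; apply: gP; apply: ltnW.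
have [h gh] := gP n (ltnSn n).
have [h'] := Phi_ghost (fun k : 'I_n.+1 => S k) (leqnn n).
have -> : ghost pi Q (fun k : 'I_n.+1 => S k) n = g n.
  by rewrite -SP // /ghost; apply: eq_bigl => k; rewrite -ltnS ltn_ord.
move=> Phig.
exists (fun k => if (k <= n)%N then S k else h' + h) => i.
rewrite leq_eqVlt => /predU1P[-> | lt_in]; last first.
  rewrite -SP //; apply: eq_bigr => k _.
  by rewrite (leq_trans (ltn_ord k : (k <= i)%N) lt_in).
rewrite big_ord_recr /= ltnn subnn expn0 expr1 scalerDr addrA gh Phig.
congr (_ + _ + _); apply: eq_big => k; first by rewrite -ltnS ltn_ord.
by rewrite -ltnS ltn_ord.
Qed.

Lemma unghost_unique n (S T : {ffun 'I_n.+1 -> P}) :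
  (forall i, (i <= n)%N -> ghost pi Q S i = ghost pi Q T i) -> S = T.
Proof.
move=> eqST; apply/ffunP => j; case: j => i; elim/ltn_ind: i => i IHi lt_in.
have := eqST i lt_in; rewrite /ghost (bigD1 (Ordinal lt_in)) //=.
rewrite [X in _ = X](bigD1 (Ordinal lt_in)) //= subnn expn0 !expr1.
suff -> : \sum_(k < n.+1 | (k <= i)%N && (k != Ordinal lt_in))
            pi ^+ k *: S k ^+ (Q ^ (i - k)) =
          \sum_(k < n.+1 | (k <= i)%N && (k != Ordinal lt_in))
            pi ^+ k *: T k ^+ (Q ^ (i - k)) by move/addIr/scalepI.
apply: eq_bigr => -[k lt_kn] /= /andP[le_ki ne_ki]; congr (_ *: _ ^+ _).
by apply: IHi; rewrite ltn_neqAle le_ki andbT.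
Qed.

Let Phi_ghostX n (v : 'I_n.+1 -> 'I_N) i : (i < n)%N -> exists h,
  ghost pi Q (fun j => 'X_(v j) : P) i.+1 =
  Phi (ghost pi Q (fun j => 'X_(v j) : P) i) + pi ^+ i.+1 *: h.
Proof.
move=> lt_in; have lt_in1 : (i.+1 < n.+1)%N by [].
exists ('X_(v (Ordinal lt_in1))).
rewrite {1}/ghost (bigD1 (Ordinal lt_in1)) //= subnn expn0 expr1 addrC.
congr (_ + _); rewrite /ghost rmorph_sum; apply: eq_big => k.
  by rewrite -[RHS]ltnS ltn_neqAle andbC -val_eqE.
rewrite -val_eqE /= => /andP[le_ki ne_ki].
have le_ki' : (k <= i)%N by rewrite -ltnS ltn_neqAle ne_ki.
by rewrite PhiZ !rmorphXn /= phi_pi PhiX -exprM -expnS -subSn.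
Qed.

Lemma ghost_unghostD n (v w : 'I_n.+1 -> 'I_N) i : (i <= n)%N ->
  let X := fun j => 'X_(v j) : P in let Y := fun j => 'X_(w j) : P in
  let g i := ghost pi Q X i + ghost pi Q Y i in
  ghost pi Q (unghost pi Q n g) i = g i.
Proof.
move=> le_in X Y g; apply: unghostP le_in => {}i lt_in.
have [h hE] := Phi_ghostX v lt_in; have [h' h'E] := Phi_ghostX w lt_in.
exists (h + h'); rewrite /g hE h'E rmorphD /= scalerDr.
exact: addrACA.
Qed.

Lemma ghost_unghostM n (v w : 'I_n.+1 -> 'I_N) i : (i <= n)%N ->
  let X := fun j => 'X_(v j) : P in let Y := fun j => 'X_(w j) : P in
  let g i := ghost pi Q X i * ghost pi Q Y i in
  ghost pi Q (unghost pi Q n g) i = g i.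
Proof.
move=> le_in X Y g; apply: unghostP le_in => {}i lt_in.
have [h hE] := Phi_ghostX v lt_in; have [h' h'E] := Phi_ghostX w lt_in.
exists (Phi (ghost pi Q X i) * h' + h * (ghost pi Q Y i.+1)).
rewrite /g hE [in LHS]h'E rmorphM /= mulrDl mulrDr -h'E scalerDr.
by rewrite -scalerAr -scalerAl addrA.
Qed.

Lemma ghost_unghostZ n (v : 'I_n.+1 -> 'I_N) (r : R) i : (i <= n)%N ->
  let X := fun j => 'X_(v j) : P in
  let g i := iter i phi r *: ghost pi Q X i in
  ghost pi Q (unghost pi Q n g) i = g i.
Proof.
move=> le_in X g; apply: unghostP le_in => {}i lt_in.
have [h hE] := Phi_ghostX v lt_in.
exists (iter i.+1 phi r *: h).
by rewrite /g hE PhiZ scalerDr !scalerA [_ * pi ^+ _]mulrC.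
Qed.

Lemma ghost_unghostF n (v : 'I_n.+2 -> 'I_N) i : (i <= n)%N ->
  let X := fun j => 'X_(v j) : P in
  let g i := ghost pi Q X i.+1 in
  ghost pi Q (unghost pi Q n g) i = g i.
Proof.
move=> le_in X g; apply: unghostP le_in => {}i lt_in.
have [//|h hE] := @Phi_ghostX _ v i.+1.
by exists (pi *: h); rewrite /g hE scalerA exprSr.
Qed.

End Fixed.

End WittExistence.

(* Formal power series in x_0, ..., x_n over R. *)
Definition pseries (R : Type) (n : nat) := 'X_{1..n.+1} -> R.

(* An element b of R{tau}^ is the sequence of its coefficients; an            *)
(* admissible A-module scheme is given by phi_E : A -> nat -> R.              *)
Section ModuleScheme.

Variables (R : idomainType) (pi : R) (q : nat).

Definition null_seq (b : nat -> R) : Prop :=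
  forall k, exists N, forall i, (N <= i)%N -> divides (pi ^+ k) (b i).

Definition tau_mul (b c : nat -> R) (n : nat) : R :=
  \sum_(i < n.+1) b i * c (n - i)%N ^+ (q ^ i).

Definition admissible (A : comNzRingType) (theta : A -> R) (E : A -> nat -> R) :
    Prop :=
  [/\ forall a, null_seq (E a),
      forall i, E 1 i = (i == 0%N)%:R,
      forall a b i, E (a + b) i = E a i + E b i,
      forall a b i, E (a * b) i = tau_mul (E a) (E b) i
    & forall a, E a 0%N = theta a].

(* The restricted power series \sum_i b_i x^(q^i) in R<x>. *)
Definition tau_series (b : nat -> R) (N : nat) : R :=
  \sum_(i < N.+1 | (q ^ i == N)%N) b i.

Definition cauchy_mul (f g : nat -> R) (N : nat) : R :=
  \sum_(i < N.+1) f i * g (N - i)%N.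

(* The closed subscheme f = 0 of Spf R<x> is finite of degree d over Spf R:   *)
(* the R-module R<x>/(f) is free of rank d (R being local, locally free       *)
(* modules of finite rank are free).                                          *)
Definition finite_zeros_of_degree (f : nat -> R) (d : nat) : Prop :=
  exists2 e : 'I_d -> nat -> R, forall j, null_seq (e j) &
    forall g, null_seq g -> exists! c : {ffun 'I_d -> R},
      exists2 h, null_seq h &
        forall N, g N = \sum_j c j * e j N + cauchy_mul f h N.

Definition drinfeld_module (A : comNzRingType) (theta : A -> R)
    (ord_infty : A -> int) (E : A -> nat -> R) (r : nat) : Prop :=
  admissible theta E /\
  forall a, a != 0 -> exists2 d : nat,
    d%:R = q%:R ^ (- (r%:Z * ord_infty a)) :> rat &
    finite_zeros_of_degree (tau_series (E a)) d.

End ModuleScheme.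

Section Characters.

Variables (R : idomainType) (pi : R) (q Q : nat) (phi : {rmorphism R -> R}).
Variables (A : comNzRingType) (theta : A -> R) (E : A -> nat -> R).

Definition restricted n (Th : pseries R n) : Prop :=
  forall k, exists d, forall m, (d <= mdeg m)%N -> divides (pi ^+ k) (Th m).

(* The test objects for formal schemes over Spf R. *)
Definition pi_nilpotent (B : comAlgType R) : Prop :=
  exists k : nat, pi ^+ k *: (1 : B) = 0.

(* When pi is nilpotent in B, it is nilpotent in W_n(B) too, and the infinite *)
(* sums below have finitely many nonzero terms.                               *)
Section Points.

Variables (B : comAlgType R) (n : nat).

Definition series_eval (Th : pseries R n) (x : {ffun 'I_n.+1 -> B}) : B :=
  eventual_value (fun M => \sum_(m : 'X_{1..n.+1 < M}) Th m *: mmap1 x m).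

(* The action of a on J^n E(B) = W_n(B), by \sum_i E(a)_i x^(q^i). *)
Definition jet_act (a : A) (x : {ffun 'I_n.+1 -> B}) : {ffun 'I_n.+1 -> B} :=
  eventual_value (fun M =>
    \big[wadd pi Q (n := n)/[ffun=> 0]]_(i < M)
       wscale pi Q phi (E a i) (wexp pi Q x (q ^ i))).

End Points.

(* Th belongs to X_n(E). *)
Definition character n (Th : pseries R n) : Prop :=
  restricted Th /\
  forall B : comAlgType R, pi_nilpotent B ->
    (forall x y : {ffun 'I_n.+1 -> B},
       series_eval Th (wadd pi Q x y) = series_eval Th x + series_eval Th y)
    /\ (forall a (x : {ffun 'I_n.+1 -> B}),
       series_eval Th (jet_act a x) = theta a *: series_eval Th x).

Definition splits_at (m : nat) : Prop :=
  (exists2 Th : pseries R m, character Th & exists mu, Th mu <> 0)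
  /\ (forall i, (i < m)%N ->
        forall Th : pseries R i, character Th -> forall mu, Th mu = 0).

(* Coefficientwise, Th^phi(F(x_0, ..., x_(n+1))); the polynomials F_j have no *)
(* constant term, so terms of degree > mdeg mu do not contribute at mu.       *)
Definition phi_star n (Th : pseries R n) : pseries R n.+1 := fun mu =>
  \sum_(nu : 'X_{1..n.+1 < (mdeg mu).+1})
     phi (Th nu) * (\prod_(j < n.+1) frob_poly pi Q n j ^+ nu j)@_mu.

Fixpoint phi_star_iter n (i : nat) : pseries R n -> pseries R (i + n) :=
  match i return pseries R n -> pseries R (i + n) with
  | 0 => fun Th => Th
  | i'.+1 => fun Th => phi_star (@phi_star_iter n i' Th)
  end.

(* Formal power series in x_0, x_1, ....  Pull-back along the truncations     *)
(* being the inclusion of series in fewer variables, X_oo(E) is the union of  *)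
(* the X_n(E) herein.                                                         *)
Definition pseries_oo := {fsfun nat -> nat with 0%N} -> R.

Definition pull_back n (Th : pseries R n) : pseries_oo := fun mu =>
  if all (fun i => (i <= n)%N) (finsupp mu)
  then Th [multinom mu i | i < n.+1] else 0.

Definition character_oo (Psi : pseries_oo) : Prop :=
  exists n (Th : pseries R n), character Th /\ Psi =1 pull_back Th.

(* The element \sum_i r_i phi*^i of R{phi*} is represented by the polynomial  *)
(* with coefficients r_i; only its additive group is that of {poly R}.        *)
Definition twisted_rscale (P : {poly R}) (r : R) : {poly R} :=
  \poly_(i < size P) (P`_i * iter i phi r).

Definition phi_star_lmul (P : {poly R}) : {poly R} := map_poly phi P * 'X.

Definition twisted_act n (P : {poly R}) (Th : pseries R n) : pseries_oo :=
  fun mu => \sum_(i < size P) P`_i * pull_back (@phi_star_iter n i Th) mu.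

(* R{phi*} (x)_R X_n(E): the formal sums of pure tensors P (x) Th, modulo the *)
(* congruence tensor_eq.                                                      *)
Section Tensor.

Variable n : nat.

Definition tensor := seq ({poly R} * pseries R n).

Definition tensor_wf (s : tensor) : Prop :=
  forall j, (j < size s)%N -> character (nth (0, fun=> 0) s j).2.

Inductive tensor_eq : tensor -> tensor -> Prop :=
| tensor_refl s : tensor_eq s s
| tensor_sym s s' : tensor_eq s s' -> tensor_eq s' s
| tensor_trans s s' s'' : tensor_eq s s' -> tensor_eq s' s'' -> tensor_eq s s''
| tensor_catC s s' : tensor_eq (s ++ s') (s' ++ s)
| tensor_cat s1 s2 s1' s2' : tensor_eq s1 s1' -> tensor_eq s2 s2' ->
    tensor_eq (s1 ++ s2) (s1' ++ s2')
| tensor_0l Th : character Th -> tensor_eq [:: (0, Th)] [::]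
| tensor_Dl P P' Th : character Th ->
    tensor_eq [:: (P + P', Th)] [:: (P, Th); (P', Th)]
| tensor_Dr P Th Th' : character Th -> character Th' ->
    tensor_eq [:: (P, fun mu => Th mu + Th' mu)] [:: (P, Th); (P, Th')]
| tensor_balanced P r Th : character Th ->
    tensor_eq [:: (twisted_rscale P r, Th)] [:: (P, fun mu => r * Th mu)].

Definition canonical_map (s : tensor) : pseries_oo := fun mu =>
  \sum_(x <- s) twisted_act x.1 x.2 mu.

Definition tensor_scale (r : R) (s : tensor) : tensor :=
  [seq (r *: x.1, x.2) | x <- s].
Definition tensor_phi_star (s : tensor) : tensor :=
  [seq (phi_star_lmul x.1, x.2) | x <- s].

End Tensor.

Definition free_rank_one n : Prop :=
  exists2 Th0 : pseries R n, character Th0 &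
    forall Th : pseries R n, character Th ->
      exists! c : R, forall mu, Th mu = c * Th0 mu.

(* The map is well defined, injective, surjective and R{phi*}-linear. *)
Definition canonical_map_iso n : Prop :=
  [/\ forall s : tensor n, tensor_wf s -> character_oo (canonical_map s),
      forall s s' : tensor n, tensor_wf s -> tensor_wf s' ->
        (canonical_map s =1 canonical_map s' <-> tensor_eq s s'),
      forall Psi, character_oo Psi ->
        exists2 s : tensor n, tensor_wf s & canonical_map s =1 Psi
    & forall s : tensor n, tensor_wf s ->
        (forall r mu,
           canonical_map (tensor_scale r s) mu = r * canonical_map s mu)
        /\ (forall l (Th : pseries R l), character Th ->
              canonical_map s =1 pull_back Th ->
              canonical_map (tensor_phi_star s) =1 pull_back (phi_star Th))].

End Characters.

(* Main.v *)
Require Import Defs.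
From HB Require Import structures.
From mathcomp Require Import all_boot all_order all_algebra.
From mathcomp Require Import finmap mpoly.
From mathcomp Require Import boolp finfield zify ring.
From Stdlib Require ClassicalEpsilon.

Set Implicit Arguments.
Unset Strict Implicit.
Unset Printing Implicit Defensive.

Import Order.TTheory GRing.Theory Num.Theory.

Local Open Scope ring_scope.

(* In characteristic p the addition of Witt vectors is componentwise, so that *)
(* a character is an additive series, i.e. a row vector over the twisted      *)
(* power series ring K{{tau}}, K being the fraction field of R. In ghost      *)
(* coordinates, linearity under t alone forces it to be                       *)
(* \sum_i a_i log^(phi^i)(w_i), log being the logarithm of E, and phi* acts   *)
(* by \sum_i a_i X^i |-> (\sum_i phi(a_i) X^i) X. Looking at the coefficients *)
(* of x_1 gives a_i in pi^-1 R for i >= 1; conversely, this implies that the  *)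
(* series in x_1, x_2, ... are restricted, and that D = (the series in x_0)   *)
(* satisfies D phi_E(t) - pi D in R{tau}^. As phi_E(t) is nonzero modulo pi,  *)
(* the characters are then saturated among such polynomials a, and R[X]       *)
(* modulo the characters is pi-adically separated. For a character b of       *)
(* minimal order m the leading coefficient has minimal valuation: otherwise,  *)
(* Euclidean division by b modulo pi yields by completeness a character of    *)
(* order < m. So there is a character of order m with leading coefficient     *)
(* 1/pi, and it generates all characters by induction on the order.           *)

(** Everything is linear algebra over one ring. Since q and qhat are both powers of the
    characteristic [p], additive series, the powers x^q of the module action and the powers x^qhat
    of the ghost map all live in K{{tau}}, K being Frac R and tau the map x |-> x^p. An additive
    series in x_0, ..., x_n is a row over K{{tau}} ([additive_add_series]), and the ghost map is a
    triangular matrix, [ghost_mx], invertible over K. In ghost coordinates t acts diagonally,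
    through the phi^i-twists of Phi = phi_E(t) ([jet_mxP]). So the i-th entry g of a t-linear row
    satisfies g Phi^(phi^i) = pi g, and g = a_i log^(phi^i) by [log_unique]. Hence X_n(E) consists
    of the polynomials a over K of degree at most n whose series are restricted, [in_chars]
    ([row_series_log], [log_character]), and [phi_star] becomes the shift a |-> phi(a) X
    ([phi_star_rep]).

    The theorem now says that [in_chars] is free over R{phi*} on an element of the minimal degree m.
    The coefficients a_i with i > 0 have at most a simple pole ([in_chars_near_integral]), and phi
    fixes pi. So if a has degree m and leading coefficient 1/pi, its j-th shift has leading
    coefficient 1/pi in degree m + j, and subtracting R-multiples of the shifts reduces every
    character to 0 ([char_generator]), in a unique way ([twisted_comb_inj]). It remains to find such
    an a.

    Finiteness of the kernel of phi_E(t) makes Phi nonzero modulo pi ([finite_zeros_nonzero]), so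
    that u Phi - pi u can be divisible by pi^k only if u is ([vge_right_mul_Phi]). Because phi lifts
    Frobenius, the series D in x_0 has a restricted defect D(a) Phi - pi D(a) as soon as the a_i
    with i > 0 have at most simple poles ([char_series0_defect]). Therefore the characters are
    saturated ([in_chars_saturated]) and contain their integral pi-adic limits ([in_chars_closed]).
    A nonzero character of degree m can then be rescaled so that the minimal valuation of its
    coefficients is -1. If this minimum were attained for the last time at I < m, Euclidean division
    by the character ([division]) would reduce X^I to degree less than I modulo characters,
    producing a character of degree I < m ([lead_coef_min]). So the leading coefficient has
    valuation -1. *)

(** * Twisted power series *)

Section Frobenius.

Variables (R : comNzRingType) (p : nat) (pcharRp : p \in [pchar R]).

(** The characteristic hypothesis is an argument so that the ring morphism structure can be attached
    to the map itself. *)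
Definition frobn of p \in [pchar R] := fun (i : nat) (x : R) => x ^+ (p ^ i).

Lemma frobn_zmod_morphism i : zmod_morphism (frobn pcharRp i).
Proof.
elim: i => [|i IHi] x y; first by rewrite /frobn expn0 !expr1.
rewrite /frobn expnSr !exprM -/(frobn pcharRp i (x - y)) IHi.
by rewrite -!(pFrobenius_autE pcharRp) rmorphB.
Qed.

Lemma frobn_monoid_morphism i : monoid_morphism (frobn pcharRp i).
Proof. by split=> [|x y]; rewrite /frobn ?expr1n ?exprMn. Qed.

HB.instance Definition _ i :=
  GRing.isZmodMorphism.Build R R (frobn pcharRp i) (frobn_zmod_morphism i).
HB.instance Definition _ i :=
  GRing.isMonoidMorphism.Build R R (frobn pcharRp i) (frobn_monoid_morphism i).

Lemma frobnE i x : frobn pcharRp i x = x ^+ (p ^ i). Proof. by []. Qed.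

Lemma frobnD i j x : frobn pcharRp i (frobn pcharRp j x) = frobn pcharRp (i + j) x.
Proof. by rewrite /frobn -exprM expnD mulnC. Qed.

Lemma frobn0 x : frobn pcharRp 0 x = x. Proof. exact: expr1. Qed.

End Frobenius.

Lemma sum_triangle (V : nmodType) n (F : nat -> nat -> V) :
  \sum_(i < n.+1) \sum_(j < i.+1) F i j =
  \sum_(j < n.+1) \sum_(l < (n - j).+1) F (j + l)%N j.
Proof.
transitivity (\sum_(i < n.+1) \sum_(j < n.+1 | (j <= i)%N) F i j).
  apply: eq_bigr => i _.
  rewrite (big_ord_widen_cond n.+1 predT (fun j => F i j)) ?ltn_ord //.
rewrite (exchange_big_dep predT) //=; apply: eq_bigr => j _.
rewrite -(big_mkord predT (fun l => F (j + l)%N j)).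
rewrite -(big_mkord (fun i => (j <= i)%N) (fun i => F i j)).
rewrite (big_cat_nat (n := j)) ?leq0n 1?ltnW ?ltn_ord //=.
rewrite big_nat_cond big_pred0 ?add0r; last first.
  by move=> i; rewrite leq0n ltnNge; case: (j <= i)%N; rewrite ?andbF.
rewrite -{1}[val j]add0n big_addn -subSn -1?ltnS ?ltn_ord //.
by apply: eq_big => i; rewrite ?leq_addl // addnC.
Qed.

(* K{{tau}}: the power series \sum_i b_i tau^i over a field of characteristic *)
(* p, with tau c = c^p tau.                                                   *)
Definition tps (K : fieldType) (p : nat) of p \in [pchar K] := nat -> K.

Section TwistedSeries.

Variables (K : fieldType) (p : nat) (pcharKp : p \in [pchar K]).
Local Notation S := (tps pcharKp).
Local Notation fr := (frobn pcharKp).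

HB.instance Definition _ := gen_eqMixin S.
HB.instance Definition _ := gen_choiceMixin S.

Definition tps_add (a b : S) : S := fun n => a n + b n.
Definition tps_opp (a : S) : S := fun n => - a n.
Definition tps_mul (a b : S) : S := fun n => \sum_(i < n.+1) a i * fr i (b (n - i)%N).
Definition tpsC (c : K) : S := fun n => if n == 0%N then c else 0.
Definition tau (i : nat) : S := fun n => (n == i)%:R.

Fact tps_addA : associative tps_add.
Proof. by move=> a b c; apply/funext => n; apply: addrA. Qed.
Fact tps_addC : commutative tps_add.
Proof. by move=> a b; apply/funext => n; apply: addrC. Qed.
Fact tps_add0 : left_id (tpsC 0) tps_add.
Proof. by move=> a; apply/funext => n; rewrite /tps_add /tpsC if_same add0r. Qed.
Fact tps_addN : left_inverse (tpsC 0) tps_opp tps_add.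
Proof. by move=> a; apply/funext => n; rewrite /tps_add /tpsC if_same addNr. Qed.

HB.instance Definition _ :=
  GRing.isZmodule.Build S tps_addA tps_addC tps_add0 tps_addN.

Lemma tpsD (a b : S) n : (a + b) n = a n + b n. Proof. by []. Qed.
Lemma tpsB (a b : S) n : (a - b) n = a n - b n. Proof. by []. Qed.
Lemma tps0 n : (0 : S) n = 0. Proof. by rewrite /GRing.zero /= /tpsC if_same. Qed.
Lemma tps_sum I (r : seq I) (P : pred I) (F : I -> S) n :
  (\sum_(i <- r | P i) F i) n = \sum_(i <- r | P i) F i n.
Proof. by elim/big_rec2: _ => [|i x y _ <-]; rewrite ?tps0 ?tpsD. Qed.
Lemma tpsP (a b : S) : (forall n, a n = b n) <-> a = b.
Proof. by split=> [?|->//]; apply/funext. Qed.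

Lemma tps_mulCl c (b : S) n : tps_mul (tpsC c) b n = c * b n.
Proof.
rewrite /tps_mul big_ord_recl big1 ?addr0 => [|i _]; last by rewrite /tpsC mul0r.
by rewrite /tpsC frobn0 subn0.
Qed.

Lemma tps_mulCr c (a : S) n : tps_mul a (tpsC c) n = a n * fr n c.
Proof.
rewrite /tps_mul big_ord_recr /= subnn big1 ?add0r // => i _.
by rewrite /tpsC subn_eq0 leqNgt ltn_ord /= rmorph0 mulr0.
Qed.

Fact tps_mulA : associative tps_mul.
Proof.
move=> a b c; apply/esym/funext => n; rewrite /tps_mul.
transitivity (\sum_(i < n.+1) \sum_(j < i.+1)
   a j * fr j (b (i - j)%N) * fr i (c (n - i)%N)).
  by apply: eq_bigr => i _; rewrite mulr_suml.
rewrite (sum_triangle n (fun i j => a j * fr j (b (i - j)%N) * fr i (c (n - i)%N))).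
apply: eq_bigr => j _; rewrite rmorph_sum mulr_sumr; apply: eq_bigr => l _.
by rewrite rmorphM /= frobnD mulrA addKn subnDA.
Qed.
Fact tps_mul1 : left_id (tpsC 1) tps_mul.
Proof. by move=> a; apply/funext => n; rewrite tps_mulCl mul1r. Qed.
Fact tps_1mul : right_id (tpsC 1) tps_mul.
Proof. by move=> a; apply/funext => n; rewrite tps_mulCr rmorph1 mulr1. Qed.
Fact tps_mulDl : left_distributive tps_mul tps_add.
Proof.
move=> a b c; apply/funext => n; rewrite /tps_mul /tps_add -big_split.
by apply: eq_bigr => i _; rewrite mulrDl.
Qed.
Fact tps_mulDr : right_distributive tps_mul tps_add.
Proof.
move=> a b c; apply/funext => n; rewrite /tps_mul /tps_add -big_split.
by apply: eq_bigr => i _; rewrite rmorphD mulrDr.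
Qed.
Fact tps_1neq0 : tpsC 1 != 0.
Proof. by apply/eqP => /(congr1 (fun a : S => a 0%N)) /eqP; rewrite oner_eq0. Qed.

HB.instance Definition _ := GRing.Zmodule_isNzRing.Build S
  tps_mulA tps_mul1 tps_1mul tps_mulDl tps_mulDr tps_1neq0.

Lemma tpsM (a b : S) n : (a * b) n = \sum_(i < n.+1) a i * fr i (b (n - i)%N).
Proof. by []. Qed.
Lemma tps1 n : (1 : S) n = (n == 0%N)%:R.
Proof. by rewrite /GRing.one /= /tpsC; case: (n == 0%N). Qed.
Lemma tpsCE c n : tpsC c n = if n == 0%N then c else 0. Proof. by []. Qed.

Fact tpsC_zmod_morphism : zmod_morphism tpsC.
Proof. by move=> x y; apply/tpsP => n; rewrite tpsB !tpsCE; case: eqP; rewrite ?subrr. Qed.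
Fact tpsC_monoid_morphism : monoid_morphism tpsC.
Proof.
split=> // x y; apply/tpsP => n; rewrite [RHS]tps_mulCl !tpsCE.
by case: eqP; rewrite ?mulr0.
Qed.
HB.instance Definition _ := GRing.isZmodMorphism.Build K S tpsC tpsC_zmod_morphism.
HB.instance Definition _ := GRing.isMonoidMorphism.Build K S tpsC tpsC_monoid_morphism.

Lemma tpsCM c (a : S) n : (tpsC c * a) n = c * a n. Proof. exact: tps_mulCl. Qed.
(** A scalar on the right is twisted: pi^k contributes pi^(k p^n) in degree n. This is what makes
    logarithms converge. *)
Lemma tpsMC c (a : S) n : (a * tpsC c) n = a n * fr n c. Proof. exact: tps_mulCr. Qed.

Lemma tps_mul_tau (a : S) i n : (a * tau i) n = if (i <= n)%N then a (n - i)%N else 0.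
Proof.
rewrite tpsM; case: leqP => [le_in | lt_ni].
  have lt_ni : (n - i < n.+1)%N by rewrite ltnS leq_subr.
  rewrite (bigD1 (Ordinal lt_ni)) //= big1 ?addr0 => [|j].
    by rewrite /tau subKn // eqxx rmorph1 mulr1.
  rewrite -val_eqE /= => ne_j; rewrite /tau; case: eqP => [ij|_]; last by rewrite rmorph0 mulr0.
  by rewrite -ij subKn ?eqxx // -ltnS in ne_j.
apply: big1 => j _; rewrite /tau; case: eqP => [ij|_]; last by rewrite rmorph0 mulr0.
by move: lt_ni; rewrite -ij ltnNge leq_subr.
Qed.

Lemma tau_mul_tps (a : S) i n :
  (tau i * a) n = if (i <= n)%N then fr i (a (n - i)%N) else 0.
Proof.
rewrite tpsM; case: leqP => [le_in | lt_ni].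
  rewrite (bigD1 (Ordinal (le_in : (i < n.+1)%N))) //= big1 ?addr0 => [|j].
    by rewrite /tau eqxx mul1r.
  by rewrite -val_eqE /= /tau => /negPf->; rewrite mul0r.
apply: big1 => j _; rewrite /tau; case: eqP => [ij|_]; last by rewrite mul0r.
by have := ltn_ord j; rewrite ij ltnS leqNgt lt_ni.
Qed.

Lemma tauE i n : tau i n = (n == i)%:R. Proof. by []. Qed.

Lemma tau0 : tau 0 = 1. Proof. by apply/tpsP => n; rewrite tps1. Qed.

Lemma tauD i j : tau (i + j) = tau i * tau j.
Proof.
apply/tpsP => n; rewrite tau_mul_tps /tau; case: leqP => [le_in | lt_ni].
  by rewrite -{1}(subnKC le_in) eqn_add2l; case: eqP; rewrite ?rmorph1 ?rmorph0.
by rewrite ltn_eqF // (leq_trans lt_ni) ?leq_addr.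
Qed.

Definition tps_map (f : K -> K) (a : S) : S := fun n => f (a n).

Lemma tau_comm i (a : S) : tau i * a = tps_map (fr i) a * tau i.
Proof. by apply/tpsP => n; rewrite tau_mul_tps tps_mul_tau. Qed.

Section Map.

Variable f : {rmorphism K -> K}.

Lemma tps_map_zmod_morphism : zmod_morphism (tps_map f).
Proof. by move=> a b; apply/tpsP => n; rewrite /tps_map !tpsB rmorphB. Qed.

Lemma tps_map_monoid_morphism : monoid_morphism (tps_map f).
Proof.
split=> [|a b]; apply/tpsP => n; first by rewrite /tps_map !tps1 rmorph_nat.
rewrite /tps_map !tpsM rmorph_sum; apply: eq_bigr => i _.
by rewrite rmorphM !frobnE rmorphXn.
Qed.

HB.instance Definition _ :=
  GRing.isZmodMorphism.Build S S (tps_map f) tps_map_zmod_morphism.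
HB.instance Definition _ :=
  GRing.isMonoidMorphism.Build S S (tps_map f) tps_map_monoid_morphism.

Lemma tps_mapC c : tps_map f (tpsC c) = tpsC (f c).
Proof. by apply/tpsP => n; rewrite /tps_map !tpsCE; case: eqP; rewrite ?rmorph0. Qed.

Lemma tps_map_tau i : tps_map f (tau i) = tau i.
Proof. by apply/tpsP => n; rewrite /tps_map /tau rmorph_nat. Qed.

End Map.

End TwistedSeries.

(** * Valuations *)

Lemma fracW (R : idomainType) (x : {fraction R}) :
  exists a b, b != 0 /\ x = tofrac a / tofrac b.
Proof.
elim/quotW: x => x /=; exists (frac x).1; exists (frac x).2; split; first exact: denom_ratioP.
have d0 : tofrac (frac x).2 != 0 by rewrite tofrac_eq0 denom_ratioP.
apply: (mulIf d0); rewrite divfK //; unlock FracField.tofrac.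
rewrite -[LHS]FracField.pi_mul; apply/eqmodP => /=.
rewrite /FracField.equivf /FracField.mulf !numden_Ratio ?mulr1 ?oner_eq0 ?denom_ratioP //.
by rewrite mulrC.
Qed.

Section FractionMap.

Variables (R : idomainType) (f : {rmorphism R -> R}).

(** Injectivity keeps the denominators nonzero, whence the ring morphism structure below. *)
Definition frac_map of injective f := fun x : {fraction R} =>
  tofrac (f (\n_(repr x))) / tofrac (f (\d_(repr x))).

Hypothesis f_inj : injective f.

Lemma frac_mapE (a b : R) : b != 0 ->
  frac_map f_inj (tofrac a / tofrac b) = tofrac (f a) / tofrac (f b).
Proof.
move=> b0; set x := tofrac a / tofrac b; rewrite /frac_map.
have fb0 (c : R) : c != 0 -> tofrac (f c) != 0.
  by move=> c0; rewrite tofrac_eq0 raddf_eq0.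
have d0 := denom_ratioP (repr x).
have xE : x = tofrac (\n_(repr x)) / tofrac (\d_(repr x)).
  apply: (mulIf (_ : tofrac (\d_(repr x)) != 0)); first by rewrite tofrac_eq0 d0.
  rewrite divfK ?tofrac_eq0 ?d0 //; rewrite -{1}[x]reprK; unlock FracField.tofrac.
  rewrite -[LHS]FracField.pi_mul; apply/eqmodP => /=.
  by rewrite /FracField.equivf /FracField.mulf !numden_Ratio ?mulr1 ?oner_eq0 ?d0 // mulrC.
have {}xE : \n_(repr x) * b = a * \d_(repr x).
  apply/eqP; rewrite -tofrac_eq !tofracM -eqr_div ?tofrac_eq0 ?d0 //.
  by apply/eqP; rewrite -xE.
apply/eqP; rewrite eqr_div ?fb0 // -!tofracM tofrac_eq -!rmorphM.
by rewrite xE.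
Qed.

Lemma frac_map_tofrac a : frac_map f_inj (tofrac a) = tofrac (f a).
Proof.
have := frac_mapE a (oner_neq0 R).
by rewrite !rmorph1 !divr1.
Qed.

Fact frac_map_zmod_morphism : zmod_morphism (frac_map f_inj).
Proof.
move=> x y; have [a [b [b0 ->]]] := fracW x; have [c [d [d0 ->]]] := fracW y.
have f0 (z : R) : z != 0 -> tofrac (f z) != 0 by rewrite tofrac_eq0 raddf_eq0.
have subE (s t u v : {fraction R}) : t != 0 -> v != 0 ->
    s / t - u / v = (s * v - u * t) / (t * v).
  by move=> t0 v0; rewrite -mulNr addf_div // mulNr.
rewrite subE ?tofrac_eq0 // -!tofracM -tofracB !frac_mapE ?mulf_neq0 //.
by rewrite subE ?f0 // rmorphB !rmorphM /= tofracB !tofracM.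
Qed.

Fact frac_map_monoid_morphism : monoid_morphism (frac_map f_inj).
Proof.
split=> [|x y]; first by rewrite -[1]tofrac1 frac_map_tofrac rmorph1.
have [a [b [b0 ->]]] := fracW x; have [c [d [d0 ->]]] := fracW y.
rewrite mulf_div -!tofracM !frac_mapE ?mulf_neq0 // mulf_div.
by rewrite !rmorphM.
Qed.

HB.instance Definition _ := GRing.isZmodMorphism.Build {fraction R} {fraction R}
  (frac_map f_inj) frac_map_zmod_morphism.
HB.instance Definition _ := GRing.isMonoidMorphism.Build {fraction R} {fraction R}
  (frac_map f_inj) frac_map_monoid_morphism.

End FractionMap.

(** The base and its hypotheses in one variable; [fd_p ^ fd_e] is going to be qhat. *)
Record frob_dvr := FrobDvr {
  fd_ring : idomainType;
  fd_pi : fd_ring;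
  fd_p : nat;
  fd_e : nat;
  fd_phi : {rmorphism fd_ring -> fd_ring};
  fd_dvr : complete_dvr fd_pi;
  fd_pchar : fd_p \in [pchar fd_ring];
  fd_e_gt0 : (0 < fd_e)%N;
  fd_phi_pi : fd_phi fd_pi = fd_pi;
  fd_lift : frobenius_lift fd_pi (fd_p ^ fd_e) fd_phi }.

(** * The valuation of the fraction field *)

Section Valuation.

Variable X : frob_dvr.
Local Notation R := (fd_ring X).
Local Notation K := {fraction R}.
Local Notation pi := (fd_pi X).
Local Notation p := (fd_p X).
Local Notation e := (fd_e X).
Local Notation phi := (fd_phi X).
Local Notation "x %:F" := (tofrac (x : R)).

Lemma pi_neq0 : pi != 0. Proof. by case: (fd_dvr X). Qed.

(** As phi fixes pi, it maps u pi^n to phi(u) pi^n, where phi(u) is again a unit. *)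
Lemma phi_inj : injective phi.
Proof.
apply: raddf_inj => x phix0; apply/eqP/contraT => x0.
have [_ _ /(_ x x0)[n [u [u_unit xE]]] _] := fd_dvr X.
have : phi x != 0.
  rewrite xE rmorphM rmorphXn fd_phi_pi mulf_neq0 ?expf_neq0 ?pi_neq0 //.
  by apply: contraTneq (rmorph_unit phi u_unit) => ->; rewrite unitr0.
by rewrite phix0 eqxx.
Qed.

Definition phiK : K -> K := frac_map phi_inj.
HB.instance Definition _ := GRing.RMorphism.on phiK.

Lemma phiK_tofrac (x : R) : phiK x%:F = (phi x)%:F.
Proof. exact: frac_map_tofrac. Qed.

Definition piK : K := pi%:F.

Lemma piK_neq0 : piK != 0. Proof. by rewrite tofrac_eq0 pi_neq0. Qed.
Lemma piK_unit : piK \is a GRing.unit. Proof. by rewrite unitfE piK_neq0. Qed.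
Lemma phiK_pi : phiK piK = piK. Proof. by rewrite phiK_tofrac fd_phi_pi. Qed.

(* [vge n x] says that the valuation of x is at least n. *)
Definition vge (n : int) (x : K) : Prop := exists y : R, x = piK ^ n * y%:F.

Lemma vge_tofrac x : vge 0 x%:F. Proof. by exists x; rewrite expr0z mul1r. Qed.
Lemma vge0P x : vge 0 x <-> exists y, x = y%:F.
Proof.
by split=> [[y ->]|[y ->]]; [exists y; rewrite expr0z mul1r | apply: vge_tofrac].
Qed.

Lemma vge_divides (k : nat) x : divides (pi ^+ k) x <-> vge k x%:F.
Proof.
split=> [[y ->] | [y]]; first by exists y; rewrite tofracM tofracXn.
rewrite -exprnP -tofracXn -tofracM => /eqP; rewrite tofrac_eq => /eqP ->.
by exists y.
Qed.

Lemma vge_0 n : vge n 0. Proof. by exists 0; rewrite tofrac0 mulr0. Qed.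
Lemma vge_1 : vge 0 1. Proof. by exists 1; rewrite tofrac1 mulr1. Qed.
Lemma vgeD n x y : vge n x -> vge n y -> vge n (x + y).
Proof. by move=> [a ->] [b ->]; exists (a + b); rewrite tofracD mulrDr. Qed.
Lemma vgeN n x : vge n x -> vge n (- x).
Proof. by move=> [a ->]; exists (- a); rewrite tofracN mulrN. Qed.
Lemma vgeB n x y : vge n x -> vge n y -> vge n (x - y).
Proof. by move=> x_n y_n; apply: vgeD x_n (vgeN y_n). Qed.
Lemma vgeM m n x y : vge m x -> vge n y -> vge (m + n) (x * y).
Proof.
move=> [a ->] [b ->]; exists (a * b).
by rewrite expfzDr ?piK_neq0 // tofracM mulrACA.
Qed.
Lemma vge_sum n I (r : seq I) (P : pred I) (F : I -> K) :
  (forall i, P i -> vge n (F i)) -> vge n (\sum_(i <- r | P i) F i).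
Proof.
by move=> F_n; elim/big_rec: _ => [|i x Pi]; [apply: vge_0 | apply: vgeD; apply: F_n].
Qed.
Lemma vgeX n x k : vge n x -> vge (n *+ k) (x ^+ k).
Proof.
move=> [a ->]; exists (a ^+ k).
by rewrite exprMn tofracXn exprnP exprz_exp -mulr_natr natz.
Qed.
Lemma vge_pi n : vge n (piK ^ n). Proof. by exists 1; rewrite tofrac1 mulr1. Qed.
Lemma vgeW m n x : n <= m -> vge m x -> vge n x.
Proof.
move=> le_nm [a ->]; exists (pi ^+ `|m - n|%N * a).
rewrite tofracM tofracXn mulrA; congr (_ * _).
rewrite -[_ ^+ _]/(piK ^ (`|m - n|%N : int)) -expfzDr ?piK_neq0 //.
by rewrite gez0_abs ?subr_ge0 // [n + _]addrC subrK.
Qed.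
Lemma vge_phi n x : vge n x -> vge n (phiK x).
Proof.
move=> [a ->]; exists (phi a); rewrite rmorphM /= phiK_tofrac; congr (_ * _).
by rewrite rmorphXz ?piK_unit //; congr (_ ^ _); apply: phiK_pi.
Qed.
Lemma vge_iter_phi n i x : vge n x -> vge n (iter i phiK x).
Proof. by move=> x_n; elim: i => //= i; apply: vge_phi. Qed.
Lemma vge_piM n m x : vge n (piK ^ m * x) <-> vge (n - m) x.
Proof.
split=> [|[a ->]]; last first.
  by exists a; rewrite mulrA -expfzDr ?piK_neq0 // addrCA subrr addr0.
move/(vgeM (vge_pi (- m))); rewrite mulrA -expfzDr ?piK_neq0 // addNr mul1r.
by rewrite addrC.
Qed.

Lemma vge_all x : (forall k : nat, vge k x) -> x = 0.
Proof.
move=> x_all; have [y xy] := x_all 0%N.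
rewrite expr0z mul1r in xy; subst x; apply/eqP; rewrite tofrac_eq0.
apply/contraT => y0; have [_ pi_nunit /(_ y y0)[n [u [u_unit yE]]] _] := fd_dvr X.
have /vge_divides[z] := x_all n.+1; rewrite yE exprSr mulrC -mulrA.
move/(mulfI (expf_neq0 n pi_neq0)) => uE; case/negP: pi_nunit.
by move: u_unit; rewrite uE unitrM => /andP[].
Qed.

Lemma fracE x : x != 0 -> exists (n : int) (u : R),
  u \is a GRing.unit /\ x = piK ^ n * u%:F.
Proof.
have [a [b [b0 ->]]] := fracW x; rewrite mulf_eq0 invr_eq0 !tofrac_eq0 negb_or.
case/andP=> a0 _; have [_ _ dvrP _] := fd_dvr X.
have [i [u [u_unit ->]]] := dvrP a a0; have [j [v [v_unit ->]]] := dvrP b b0.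
exists (i%:Z - j%:Z), (u / v); split; first by rewrite unitrM unitrV u_unit.
have vF : v%:F \is a GRing.unit by rewrite rmorph_unit.
rewrite expfzDr ?piK_neq0 // -invr_expz !tofracM !tofracXn rmorphV //= invfM.
by rewrite mulrAC [RHS]mulrC mulrA mulrAC mulrA.
Qed.

Lemma vge_ex x : exists n : nat, vge (- n%:Z) x.
Proof.
have [->|x0] := eqVneq x 0; first by exists 0%N; apply: vge_0.
have [n [u [_ ->]]] := fracE x0; exists `|n|%N.
apply: (@vgeW n); last by exists u.
by rewrite lerNl abszE -normrN ler_norm.
Qed.

Lemma vge_total x y : y != 0 -> vge 0 (x / y) \/ x != 0 /\ vge 1 (y / x).
Proof.
move=> y0; have [->|x0] := eqVneq x 0; first by left; rewrite mul0r; apply: vge_0.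
have [i [u [u_unit ->]]] := fracE x0; have [j [v [v_unit ->]]] := fracE y0.
have uF : u%:F \is a GRing.unit by rewrite rmorph_unit.
have vF : v%:F \is a GRing.unit by rewrite rmorph_unit.
have quotE a b (w z : R) : z \is a GRing.unit ->
    piK ^ a * w%:F / (piK ^ b * z%:F) = piK ^ (a - b) * (w / z)%:F.
  by move=> z_unit; rewrite invfM invr_expz mulrACA -expfzDr ?piK_neq0 // rmorphM rmorphV.
rewrite !quotE //; have [le_ji|lt_ij] := lerP j i; [left | right; split=> //].
  by apply: (@vgeW (i - j)); [rewrite subr_ge0 | exists (u / v)].
by apply: (@vgeW (j - i)); [rewrite -gtz0_ge1 subr_gt0 | exists (v / u)].
Qed.

Lemma pchar_K : p \in [pchar K].
Proof. rewrite inE (pcharf_prime (fd_pchar X)) -tofrac1 -tofracMn tofrac_eq0.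
by rewrite (pcharf0 (fd_pchar X)) eqxx. Qed.

(** The p^e-th power is additive in characteristic p, so it preserves the congruence of the previous
    step; the lifting property of phi then gives the next one. *)
Lemma phiK_frob x i : vge 0 x -> vge 1 (x ^+ (p ^ (e * i)) - iter i phiK x).
Proof.
move=> x0; elim: i => [|i IHi]; first by rewrite muln0 expr1 subrr; apply: vge_0.
set y := iter i phiK x; have /vge0P[z yz] : vge 0 y by apply: vge_iter_phi.
have -> : x ^+ (p ^ (e * i.+1)) - iter i.+1 phiK x =
    (x ^+ (p ^ (e * i)) - y) ^+ (p ^ e) - (phiK y - y ^+ (p ^ e)).
  rewrite -!(frobnE pchar_K) rmorphB /= frobnD -mulnS /y /=.
  by rewrite opprB addrA subrK.
apply: vgeB; last first.
  by rewrite yz phiK_tofrac -tofracXn -tofracB; apply/(vge_divides 1)/fd_lift.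
apply: vgeW (vgeX (p ^ e) IHi); rewrite -[_ *+ _]/((p ^ e)%:R : int) ler1n.
by rewrite expn_gt0 prime_gt0 // (pcharf_prime (fd_pchar X)).
Qed.

End Valuation.

(** * Integral and restricted twisted series *)

Section Integrality.

Variable X : frob_dvr.
Local Notation R := (fd_ring X).
Local Notation K := {fraction R}.
Local Notation p := (fd_p X).
Local Notation S := (tps (pchar_K X)).
Local Notation fr := (frobn (pchar_K X)).
Local Notation C := (@tpsC _ _ (pchar_K X)).
Local Notation tau := (tau (pchar_K X)).
Local Notation piK := (piK X).
Local Notation vge := (@vge X).
Local Notation phiS := (@tps_map K p (pchar_K X) (@phiK X)).

Lemma p_gt1 : (1 < p)%N.
Proof. exact: prime_gt1 (pcharf_prime (fd_pchar X)). Qed.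

Lemma p_gt0 : (0 < p)%N. Proof. exact: ltnW p_gt1. Qed.

Lemma nvge_1 : ~ vge 1 1.
Proof.
rewrite -[in vge _ _](tofrac1 R) => /(vge_divides 1)[y]; rewrite expr1 => piy.
have [_ /negP pi_nunit _ _] := fd_dvr X.
by apply/pi_nunit/unitrPr; exists y.
Qed.

Lemma vge_inv x : vge 0 x -> ~ vge 1 x -> vge 0 x^-1.
Proof.
move=> x0 nx1; have x_neq0 : x != 0 by apply/eqP => xE; apply: nx1; rewrite xE; apply: vge_0.
by have [|[_]] := vge_total 1 x_neq0; rewrite ?div1r // divr1.
Qed.

Lemma vge_inv1B x : vge 1 x -> vge 0 (1 - x)^-1.
Proof.
move=> x1; apply: vge_inv; first by apply: vgeB (vge_1 X) (vgeW _ x1).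
by move=> /(fun h => vgeD h x1); rewrite subrK; apply: nvge_1.
Qed.

Lemma vge_frob (n : nat) i x : vge n x -> vge n (fr i x).
Proof.
move=> /(vgeX (p ^ i)); apply: vgeW; rewrite -mulr_natr ler_peMr //.
by rewrite ler1n expn_gt0 p_gt0.
Qed.

Lemma complete_K (u : nat -> K) :
    (forall k, vge 0 (u k)) -> (forall k : nat, vge k (u k.+1 - u k)) ->
  exists2 x, vge 0 x & forall k : nat, vge k (x - u k).
Proof.
move=> u0 u_cauchy; have /choice[v vE] : forall k, exists y, u k = tofrac y.
  by move=> k; apply/vge0P.
have [_ _ _ /(_ v)[k|x xP]] := fd_dvr X.
  by apply/vge_divides; rewrite tofracB -!vE.
exists (tofrac x); first exact: vge_tofrac.
by move=> k; rewrite vE -tofracB; apply/vge_divides.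
Qed.

Definition svge (n : int) (s : S) := forall i, vge n (s i).
Definition snull (s : S) := forall k : nat, exists N, forall i, (N <= i)%N -> vge k (s i).
(* The image of R{tau_p}^ in K{{tau_p}}. *)
Definition restr (s : S) := svge 0 s /\ snull s.

Lemma svgeD n a b : svge n a -> svge n b -> svge n (a + b).
Proof. by move=> a_n b_n i; apply: vgeD. Qed.
Lemma svgeN n a : svge n a -> svge n (- a).
Proof. by move=> a_n i; apply: vgeN. Qed.
Lemma svgeB n a b : svge n a -> svge n b -> svge n (a - b).
Proof. by move=> a_n b_n i; apply: vgeB. Qed.
(** The bound [n] on the right factor is a natural number because Frobenius multiplies valuations by
    p^i, which only helps if they are nonnegative. *)
Lemma svgeM (m : int) (n : nat) a b : svge m a -> svge n b -> svge (m + n) (a * b).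
Proof.
by move=> a_m b_n i; rewrite tpsM; apply: vge_sum => j _; apply: vgeM => //; apply: vge_frob.
Qed.
Lemma svgeW m n a : n <= m -> svge m a -> svge n a.
Proof. by move=> le_nm a_m i; apply: vgeW (a_m i). Qed.
Lemma svge_scale m n a : svge n (C (piK ^ m) * a) <-> svge (n - m) a.
Proof.
by split=> h i; [apply/vge_piM; rewrite -tpsCM | rewrite tpsCM; apply/vge_piM].
Qed.

Lemma restrD a b : restr a -> restr b -> restr (a + b).
Proof.
move=> [a0 a_null] [b0 b_null]; split=> [|k]; first exact: svgeD.
have [N1 N1P] := a_null k; have [N2 N2P] := b_null k; exists (maxn N1 N2) => i.
by rewrite geq_max => /andP[i1 i2]; apply: vgeD; auto.
Qed.
Lemma restrN a : restr a -> restr (- a).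
Proof.
move=> [a0 a_null]; split=> [|k]; first exact: svgeN.
by have [N NP] := a_null k; exists N => i /NP; apply: vgeN.
Qed.
Lemma restrB a b : restr a -> restr b -> restr (a - b).
Proof. by move=> ra rb; apply: restrD ra (restrN rb). Qed.
Lemma restr0 : restr 0.
Proof. by split=> [|k]; [|exists 0%N] => i *; rewrite tps0; apply: vge_0. Qed.
Lemma restr_sum I (r : seq I) (P : pred I) (F : I -> S) :
  (forall i, P i -> restr (F i)) -> restr (\sum_(i <- r | P i) F i).
Proof.
by move=> F_r; elim/big_rec: _ => [|i x Pi]; [apply: restr0 | apply: restrD; apply: F_r].
Qed.
Lemma restrM a b : restr a -> restr b -> restr (a * b).
Proof.
move=> [a0 a_null] [b0 b_null]; split=> [|k].
  by rewrite -[0]addr0; apply: (@svgeM _ 0%N).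
have [N1 N1P] := a_null k; have [N2 N2P] := b_null k; exists (N1 + N2)%N => n le_n.
rewrite tpsM; apply: vge_sum => i _; have [le_i|lt_i] := leqP N1 i.
  by rewrite -[k%:Z]addr0; apply: vgeM; [apply: N1P | apply: (@vge_frob 0%N)].
rewrite -[k%:Z]add0r; apply: vgeM => //; apply/vge_frob/N2P.
rewrite leq_subRL; last by rewrite -ltnS.
by apply: leq_trans le_n; rewrite leq_add2r ltnW.
Qed.
Lemma restrC c : vge 0 c -> restr (C c).
Proof.
move=> c0; split=> [i|k]; first by rewrite tpsCE; case: ifP => // _; apply: vge_0.
by exists 1%N => -[|i] // _; rewrite tpsCE; apply: vge_0.
Qed.
Lemma restr_tau i : restr (tau i).
Proof.
split=> [j|k].
  by rewrite /tau; case: eqP => _; [apply: vge_1 | apply: vge_0].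
by exists i.+1 => j lt_ij; rewrite /tau gtn_eqF //; apply: vge_0.
Qed.
Lemma restr_phi s : restr s -> restr (phiS s).
Proof.
move=> [s0 s_null]; split=> [i|k]; first exact: vge_phi.
by have [N NP] := s_null k; exists N => i /NP; apply: vge_phi.
Qed.
Lemma restr_scale (n : nat) s : svge n s -> snull s -> restr (C (piK ^ (- n%:Z)) * s).
Proof.
move=> s_n s_null; split; first by apply/svge_scale; rewrite opprK add0r.
move=> k; have [N NP] := s_null (k + n)%N; exists N => i /NP si.
by rewrite tpsCM; apply/vge_piM; rewrite opprK -PoszD.
Qed.

End Integrality.

(** * The logarithm as a solution of L Phi = pi L *)

Section Logarithm.

Variable X : frob_dvr.
Local Notation R := (fd_ring X).
Local Notation K := {fraction R}.
Local Notation p := (fd_p X).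
Local Notation S := (tps (pchar_K X)).
Local Notation fr := (frobn (pchar_K X)).
Local Notation C := (@tpsC _ _ (pchar_K X)).
Local Notation piK := (piK X).

(** Equality would give pi^(p^n - 1) = 1. *)
Lemma pi_frob_neq0 n : (0 < n)%N -> piK - fr n piK != 0.
Proof.
move=> n0; rewrite subr_eq0 -[eqbLHS]mulr1 frobnE.
rewrite -(prednK (_ : 0 < p ^ n)%N) ?expn_gt0 ?p_gt0 // exprS.
apply/eqP => /(mulfI (piK_neq0 X)) pi1; apply: (@nvge_1 X); rewrite pi1.
apply: (@vgeW _ (p ^ n).-1); last exact: (@vge_pi _ (p ^ n).-1%:Z).
by rewrite lez_nat -ltnS prednK ?expn_gt0 ?p_gt0 // -(expn0 p) ltn_exp2l ?p_gt1.
Qed.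

(** In degree n the equation expresses (pi - pi^(p^n)) L_n through the earlier coefficients, and the
    factor is invertible in K. *)
Lemma log_exists (Phi : S) : Phi 0%N = piK ->
  exists2 L : S, L 0%N = 1 & L * Phi = C piK * L.
Proof.
move=> Phi0; pose step n (l : seq K) :=
  (piK - fr n piK)^-1 * \sum_(i < n) l`_i * fr i (Phi (n - i)%N).
(* [ls n] lists L_0, ..., L_n, which makes the course-of-values recursion structural. *)
pose fix ls n := if n is n'.+1 then rcons (ls n') (step n (ls n')) else [:: 1].
pose L : S := fun n => (ls n)`_n.
have size_ls n : size (ls n) = n.+1 by elim: n => //= n IHn; rewrite size_rcons IHn.
have nth_ls n i : (i <= n)%N -> (ls n)`_i = L i.
  elim: n => [|n IHn]; first by rewrite leqn0 => /eqP->.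
  rewrite leq_eqVlt => /predU1P[->|lt_in] //.
  by rewrite /= nth_rcons size_ls lt_in IHn.
exists L => //; apply/tpsP => n; rewrite tpsM tpsCM big_ord_recr /= subnn Phi0.
case: n => [|n]; first by rewrite big_ord0 add0r frobn0 mulrC.
apply: (canLR (subrK _)); rewrite [L n.+1 * _]mulrC -mulrBl.
rewrite {2}/L /= nth_rcons size_ls ltnn eqxx /step mulrA divff ?pi_frob_neq0 // mul1r.
by apply: eq_bigr => i _; rewrite nth_ls // -ltnS.
Qed.

Lemma log_unique0 (Phi d : S) :
  Phi 0%N = piK -> d 0%N = 0 -> d * Phi = C piK * d -> d = 0.
Proof.
move=> Phi0 d0 dP; apply/tpsP => n; rewrite tps0; elim/ltn_ind: n => -[|n] IHn //.
move/tpsP/(_ n.+1): dP; rewrite tpsM tpsCM big_ord_recr /= subnn Phi0 big1 => [|i _].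
  rewrite add0r mulrC => /eqP; rewrite eq_sym -subr_eq0 -mulrBl mulf_eq0.
  by rewrite (negPf (pi_frob_neq0 _)) // => /eqP.
by rewrite IHn ?mul0r.
Qed.

(** The equation is linear on the left, so g - g_0 L solves it too; having no constant term, it
    vanishes by the recursion. *)
Lemma log_unique (Phi L g : S) : Phi 0%N = piK -> L 0%N = 1 ->
  L * Phi = C piK * L -> g * Phi = C piK * g -> g = C (g 0%N) * L.
Proof.
move=> Phi0 L0 LP gP; apply/subr0_eq/(log_unique0 Phi0).
  by rewrite tpsB tpsCM L0 mulr1 subrr.
rewrite mulrBl mulrBr gP -mulrA LP !mulrA; congr (_ - _ * _).
by rewrite -!rmorphM mulrC.
Qed.

End Logarithm.

(** * The module of characters in terms of the logarithm *)

Section CharacterModule.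

Variable X : frob_dvr.
Local Notation R := (fd_ring X).
Local Notation K := {fraction R}.
Local Notation p := (fd_p X).
Local Notation e := (fd_e X).
Local Notation S := (tps (pchar_K X)).
Local Notation fr := (frobn (pchar_K X)).
Local Notation C := (@tpsC _ _ (pchar_K X)).
Local Notation tau := (tau (pchar_K X)).
Local Notation piK := (piK X).
Local Notation vge := (@vge X).
Local Notation svge := (@svge X).
Local Notation restr := (@restr X).
Local Notation phiK := (@phiK X).
Local Notation phiS := (@tps_map K p (pchar_K X) phiK).

Variables Phi L : S.
Hypotheses (Phi0 : Phi 0%N = piK) (Phi_restr : restr Phi).
Hypothesis Phi_unit : exists d, ~ vge 1 (Phi d).
Hypotheses (L0 : L 0%N = 1) (LP : L * Phi = C piK * L).

Implicit Types (a b : {poly K}).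

Definition log_twist i : S := iter i phiS L.

Lemma log_twist0 i : log_twist i 0%N = 1.
Proof. by elim: i => //= i IHi; rewrite /tps_map IHi rmorph1. Qed.

Lemma log_twistP i : log_twist i * iter i phiS Phi = C piK * log_twist i.
Proof.
elim: i => //= i IHi.
by rewrite -rmorphM IHi rmorphM /= tps_mapC; congr (C _ * _); apply: phiK_pi.
Qed.

(** Each step of the recursion divides by pi - pi^(p^n), which is pi times a unit. *)
Lemma log_vge n : vge (- n%:Z) (L n).
Proof.
elim/ltn_ind: n => -[_|n IHn]; first by rewrite L0; apply: vge_1.
have /tpsP/(_ n.+1) := LP; rewrite tpsM tpsCM big_ord_recr /= subnn Phi0.
set s := \sum_(i < _) _ => /(canRL (addrK _)).
have s_n : vge (- n%:Z) s.
  apply: vge_sum => i _; rewrite -[- _]addr0; apply: vgeM.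
    by apply: vgeW (IHn i _) => //; rewrite lerN2 lez_nat -ltnS.
  by apply: (@vge_frob _ 0%N); case: Phi_restr.
set f := fr n.+1 piK; have f1 : vge 1 (f / piK).
  rewrite mulrC -[piK^-1]/(piK ^ (-1)); apply/vge_piM; rewrite opprK.
  have := vgeX (p ^ n.+1) (vge_pi X 1); rewrite expr1z; apply: vgeW.
  by rewrite -[_ *+ _]/((p ^ n.+1)%:R : int) (ler_nat _ 2) (leq_trans (p_gt1 X)) // -{1}(expn1 p) leq_exp2l ?p_gt1.
move=> sE; suff -> : L n.+1 = piK^-1 * (s * (1 - f / piK)^-1).
  rewrite -[piK^-1]/(piK ^ (-1)); apply/vge_piM.
  by rewrite opprK -addn1 PoszD opprD subrK -[- _]addr0; apply: vgeM s_n (vge_inv1B f1).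
have den0 : piK - f != 0 by apply: pi_frob_neq0.
have -> : 1 - f / piK = (piK - f) / piK by rewrite mulrBl divff ?piK_neq0.
rewrite invf_div mulrCA mulKf ?piK_neq0 //; apply: (mulIf den0).
by rewrite divfK // sE mulrBr [piK * _]mulrC.
Qed.

Lemma log_twist_vge i n : vge (- n%:Z) (log_twist i n).
Proof.
rewrite /log_twist; elim: i => [|i IHi] /=; first exact: log_vge.
exact: vge_phi.
Qed.

(** The growth of p^n that beats the denominators pi^n of the logarithm. *)
Lemma ltn_expn k n : (k + 3 <= n)%N -> (n + k < p ^ n)%N.
Proof.
move=> le_kn; apply: (@leq_trans (2 ^ n)); last by rewrite leq_exp2r ?p_gt1 // (leq_trans _ le_kn) ?addn3.
have le3n : (3 <= n)%N by rewrite (leq_trans _ le_kn) ?leq_addl.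
have : (n * 2 < 2 ^ n)%N.
  elim: n le3n {le_kn} => // n IHn; rewrite leq_eqVlt => /predU1P[<- //|lt_3n].
  by have := IHn lt_3n; rewrite expnS; lia.
lia.
Qed.

(** In degree n the right factor becomes pi^((k + 1) p^n), against a pole of order at most n + 1 of
    the rest. *)
Lemma log_restr c i (k : nat) : vge (-1) c -> restr (C c * log_twist i * C (piK ^ k.+1%:Z)).
Proof.
move=> c1; have term_vge n (j : nat) : (n + j < p ^ n)%N ->
    vge j ((C c * log_twist i * C (piK ^ k.+1%:Z)) n).
  move=> lt_j; rewrite tpsMC tpsCM.
  apply: vgeW (vgeM (vgeM c1 (log_twist_vge i n)) (vgeX (p ^ n) (vge_pi X k.+1))).
  by rewrite -mulr_natr natz; move: (p ^ n)%N lt_j => P lt_j; nia.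
split=> [n|j]; last first.
  by exists (j + 3)%N => n /ltn_expn; apply: term_vge.
by apply: (term_vge n 0%N); rewrite addn0 ltn_expl ?p_gt1.
Qed.

(* The coefficient series of x_k in \sum_i a_i log^(phi^i)(w_i), w_i being   *)
(* the i-th ghost component.                                                  *)
Definition char_series (k : nat) (a : {poly K}) : S :=
  \sum_(i < size a | (k <= i)%N)
     C a`_i * log_twist i * C (piK ^ k) * tau (e * (i - k)).

Lemma char_series_widen n k a : (size a <= n)%N ->
  char_series k a = \sum_(i < n | (k <= i)%N)
     C a`_i * log_twist i * C (piK ^ k) * tau (e * (i - k)).
Proof.
move=> le_an; rewrite /char_series [LHS]big_mkcond [RHS]big_mkcond /=.
rewrite -(big_mkord predT (fun i => if (k <= i)%N then
  C a`_i * log_twist i * C (piK ^ k) * tau (e * (i - k)) else 0)).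
rewrite -(big_mkord predT (fun i => if (k <= i)%N then
  C a`_i * log_twist i * C (piK ^ k) * tau (e * (i - k)) else 0)).
rewrite [RHS](big_cat_nat (n := size a)) //= [X in _ = _ + X]big_nat_cond.
rewrite [X in _ = _ + X]big1 ?addr0 // => i; rewrite andbT => /andP[le_ai _].
by rewrite nth_default // rmorph0 !mul0r if_same.
Qed.

Lemma char_seriesD k a b : char_series k (a + b) = char_series k a + char_series k b.
Proof.
rewrite (char_series_widen _ (size_polyD a b)).
rewrite (char_series_widen _ (leq_maxl (size a) (size b))).
rewrite (char_series_widen _ (leq_maxr (size a) (size b))).
by rewrite -big_split; apply: eq_bigr => i _; rewrite coefD rmorphD !mulrDl.
Qed.

Lemma char_seriesZ k c a : char_series k (c *: a) = C c * char_series k a.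
Proof.
rewrite (char_series_widen _ (size_scale_leq c a)) mulr_sumr.
by apply: eq_bigr => i _; rewrite coefZ rmorphM !mulrA.
Qed.

Lemma char_seriesN k a : char_series k (- a) = - char_series k a.
Proof. by rewrite -scaleN1r char_seriesZ rmorphN rmorph1 mulN1r. Qed.

Lemma char_series_ge k a : (size a <= k)%N -> char_series k a = 0.
Proof.
by move=> le_ak; apply: big1 => i; rewrite leqNgt (leq_trans (ltn_ord i)).
Qed.

Local Notation D := (char_series 0).

Lemma char_series0_widen n a : (size a <= n)%N ->
  D a = \sum_(i < n) C a`_i * log_twist i * tau (e * i).
Proof.
move/(char_series_widen 0)->.
by apply: eq_bigr => i _; rewrite expr0z rmorph1 mulr1 subn0.
Qed.

Lemma char_series0_coef0 a : D a 0%N = a`_0.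
Proof.
rewrite (char_series0_widen (leqnn _)) tps_sum; case: (posnP (size a)) => [a0|a_gt0].
  by rewrite nth_default ?a0 // big_ord0.
rewrite (bigD1 (Ordinal a_gt0)) //= muln0 tau0 mulr1 tpsCM L0 mulr1.
rewrite big1 ?addr0 // => -[[|i] lti] // _.
by rewrite tps_mul_tau leqn0 muln_eq0 /= (gtn_eqF (fd_e_gt0 X)).
Qed.

(** * The polynomials with restricted series, and their saturation *)

Definition in_chars (a : {poly K}) := forall k, restr (char_series k a).
Definition near_integral (a : {poly K}) := forall i, (0 < i)%N -> vge (-1) a`_i.

(** For k > 0 the factor pi^k stands to the right of every logarithm, so [log_restr] applies. Only
    the series in x_0 can then fail to be restricted. *)
Lemma near_integralP a k : (0 < k)%N -> near_integral a -> restr (char_series k a).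
Proof.
move=> k0 a1; apply: restr_sum => i le_ki; apply: restrM (restr_tau X _).
by rewrite -(prednK k0); apply: log_restr; apply: a1; apply: leq_trans k0 le_ki.
Qed.

(** In the series of x_1, the coefficient in degree e (i - 1) is pi a_i plus contributions of the
    a_j with 0 < j < i, which are integral by induction and [log_restr]. *)
Lemma in_chars_near_integral a : in_chars a -> near_integral a.
Proof.
move=> aV; elim/ltn_ind => i IHi i0.
have [le_ai|lt_ia] := leqP (size a) i; first by rewrite nth_default //; apply: vge_0.
have [/(_ (e * (i - 1))%N) + _] := aV 1%N.
rewrite /char_series tps_sum (bigD1 (Ordinal lt_ia)) //= tps_mul_tau leqnn subnn tpsMC tpsCM.
rewrite log_twist0 mulr1 frobn0.
set s := \sum_(j < _ | _) _ => a_sum.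
suff: vge 0 (a`_i * piK) by rewrite mulrC -[X in X * _]expr1z => /vge_piM.
rewrite -(addrK s (_ * _)); apply: vgeB a_sum _.
apply: vge_sum => j /andP[j1]; rewrite -val_eqE /= => ne_ji.
rewrite tps_mul_tau; case: ifP => [le_ji|_]; last exact: vge_0.
have {}le_ji : (j < i)%N.
  by move: le_ji; rewrite leq_pmul2l ?fd_e_gt0 // leq_sub2rE // ltn_neqAle ne_ji.
by have [+ _] := @log_restr a`_j j 0 (IHi _ le_ji j1); apply.
Qed.

Lemma in_charsP a :
  in_chars a <-> near_integral a /\ restr (D a).
Proof.
split=> [aV|[a1 Da] [|k]]; [split; [exact: in_chars_near_integral | exact: aV] | by [] |].
exact: near_integralP.
Qed.

Lemma in_charsD a b : in_chars a -> in_chars b -> in_chars (a + b).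
Proof. by move=> aV bV k; rewrite char_seriesD; apply: restrD. Qed.
Lemma in_charsZ c a : vge 0 c -> in_chars a -> in_chars (c *: a).
Proof. by move=> c0 aV k; rewrite char_seriesZ; apply: restrM (restrC c0) _. Qed.
Lemma in_chars0 : in_chars 0.
Proof. by move=> k; rewrite char_series_ge ?size_poly0 //; apply: restr0. Qed.
Lemma in_charsB a b : in_chars a -> in_chars b -> in_chars (a - b).
Proof. by move=> aV bV k; rewrite char_seriesD char_seriesN; apply: restrB. Qed.
Lemma in_chars_sum I (r : seq I) (P : pred I) (F : I -> {poly K}) :
  (forall i, P i -> in_chars (F i)) -> in_chars (\sum_(i <- r | P i) F i).
Proof.
by move=> FV; elim/big_rec: _ => [|i x Pi]; [apply: in_chars0 | apply: in_charsD; apply: FV].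
Qed.

Definition phi_poly (a : {poly K}) : {poly K} := map_poly phiK a * 'X.

Lemma coef_phi_poly a i : (phi_poly a)`_i = if i == 0%N then 0 else phiK a`_i.-1.
Proof. by rewrite coefMX coef_map. Qed.

Lemma size_phi_poly a n : (size a <= n)%N -> (size (phi_poly a) <= n.+1)%N.
Proof.
move=> le_an; apply/leq_sizeP => -[|j] //; rewrite ltnS => le_nj.
by rewrite coef_phi_poly /= nth_default ?rmorph0 // (leq_trans le_an).
Qed.

Lemma char_series0_phi_poly a : D (phi_poly a) = phiS (D a) * tau e.
Proof.
rewrite (char_series0_widen (size_phi_poly (leqnn _))).
rewrite (char_series0_widen (leqnn _)) rmorph_sum mulr_suml big_ord_recl.
rewrite coef_phi_poly rmorph0 !mul0r add0r; apply: eq_bigr => i _.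
rewrite coef_phi_poly [in RHS]rmorphM [in RHS]rmorphM /= tps_map_tau tps_mapC.
by rewrite -[RHS]mulrA -tauD mulnS [(e + _)%N]addnC.
Qed.

(** The shift moves a_0 to degree 1, where poles are bounded; a_0 is integral, being the constant
    coefficient of D(a). *)
Lemma in_chars_phi a : in_chars a -> in_chars (phi_poly a).
Proof.
move=> aV; apply/in_charsP; split=> [[//|i _]|].
  rewrite coef_phi_poly /=; apply: vge_phi; case: i => [|i].
    by rewrite -char_series0_coef0; apply: (@vgeW _ 0) => //; case: (aV 0%N).
  by apply: in_chars_near_integral.
by rewrite char_series0_phi_poly; apply: restrM (restr_tau X e); apply: restr_phi.
Qed.

Lemma iter_phiS i (s : S) n : iter i phiS s n = iter i phiK (s n).
Proof. by elim: i => //= i <-. Qed.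

Lemma Phi_frob_restr i : restr (C (piK ^ (- 1%:Z)) * (tps_map (fr (e * i)) Phi - iter i phiS Phi)).
Proof.
have [Phi_0 Phi_null] := Phi_restr; apply: (@restr_scale _ 1%N).
  by move=> n; rewrite tpsB iter_phiS; apply: phiK_frob.
move=> k; have [N NP] := Phi_null k; exists N => n le_n.
rewrite tpsB iter_phiS; apply: vgeB; last exact/vge_iter_phi/NP.
exact/vge_frob/NP.
Qed.

(** Moving Phi across tau^(e i) gives its Frobenius twist, while the logarithm of index i absorbs
    its phi^i-twist. The two differ by a multiple of pi, which stands to the right of the logarithm
    and makes the error restricted. For i = 0 there is no error, so a_0 is not constrained. *)
Lemma char_series0_defect (k : nat) a :
  (forall i, (0 < i)%N -> vge (k%:Z - 1) a`_i) ->
  restr (C (piK ^ (- k%:Z)) * (D a * Phi - C piK * D a)).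
Proof.
move=> a1; rewrite (char_series0_widen (leqnn _)) mulr_suml [C piK * _]mulr_sumr -sumrB mulr_sumr.
apply: restr_sum => i _; set l := C _ * log_twist i.
have -> : C piK * (l * tau (e * i)) = l * iter i phiS Phi * tau (e * i).
  rewrite /l -(mulrA (C a`_i) _ (iter _ _ _)) log_twistP !mulrA.
  by congr (_ * _ * _); rewrite -!rmorphM mulrC.
rewrite -(mulrA l) tau_comm mulrA -mulrBl -mulrBr.
case: (posnP i) => [i0|i0].
  have -> : tps_map (fr (e * i)) Phi = iter i phiS Phi.
    by rewrite i0 muln0; apply/tpsP => n; rewrite /tps_map frobn0.
  by rewrite subrr mulr0 mul0r mulr0; apply: restr0.
have Cpi : C piK * C (piK ^ (- 1%:Z)) = 1.
  by rewrite -rmorphM divff ?piK_neq0 // rmorph1.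
set Z := tps_map _ _ - _.
have -> : C (piK ^ (- k%:Z)) * (l * Z * tau (e * i)) =
    C (piK ^ (- k%:Z)) * l * C piK * (C (piK ^ (- 1%:Z)) * Z) * tau (e * i).
  by rewrite -!mulrA (mulrA (C piK)) Cpi mul1r.
apply: restrM (restr_tau X _); apply: restrM (Phi_frob_restr i).
rewrite /l [C _ * (C _ * _)]mulrA -rmorphM -[C piK]/(C (piK ^ 1%:Z)).
by apply: log_restr; apply/vge_piM; rewrite opprK addrC; apply: a1.
Qed.

(* Phi is nonzero modulo pi, and R/pi is a domain. *)
Lemma vge_right_mul_Phi (k : nat) (u : S) :
  svge 0 u -> svge k (u * Phi - C piK * u) -> svge k u.
Proof.
have [d [d_unit d_min]] : exists d, ~ vge 1 (Phi d) /\ forall j, (j < d)%N -> vge 1 (Phi j).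
  have [d0 d0P] := Phi_unit; apply: contrapT => no_d; apply: d0P.
  elim/ltn_ind: d0 => d IHd; apply: contrapT => d_unit.
  by apply: no_d; exists d.
have [Phi_int _] := Phi_restr.
(* Modulo pi the coefficient i + d of v Phi is v_i Phi_d^(p^i): the terms with j < i vanish by
   induction on i, those with j > i by minimality of d. *)
have step (v : S) : svge 0 v -> svge 1 (v * Phi - C piK * v) -> svge 1 v.
  move=> v0 v1 i; elim/ltn_ind: i => i IHi.
  have {v1} : vge 1 ((v * Phi) (i + d)%N).
    have := v1 (i + d)%N; rewrite tpsB => /vgeD h; rewrite -[X in vge 1 X](subrK ((C piK * v) (i + d)%N)).
    apply: h; rewrite tpsCM -[piK]expr1z; apply/vge_piM; rewrite subrr; exact: v0.
  have lt_i : (i < (i + d).+1)%N by rewrite ltnS leq_addr.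
  rewrite tpsM (bigD1 (Ordinal lt_i)) //= addKn; set s := \sum_(j < _ | _) _ => v1.
  have s1 : vge 1 s.
    apply: vge_sum => j; rewrite -val_eqE /= neq_ltn => /orP[lt_ji|lt_ij].
      rewrite -[1]addr0; apply: vgeM (IHi _ lt_ji) _.
      exact: (@vge_frob _ 0%N).
    rewrite -[1]add0r; apply: vgeM => //; apply: (@vge_frob _ 1%N); apply: d_min.
    by have := ltn_ord j; lia.
  have d_neq0 : Phi d != 0 by apply/eqP => d0; apply: d_unit; rewrite d0; apply: vge_0.
  rewrite -(mulfK (_ : fr i (Phi d) != 0) (v i)) ?expf_neq0 //.
  rewrite -[1]addr0; apply: vgeM.
    by rewrite -(addrK s (_ * _)); apply: vgeB.
  rewrite -fmorphV; apply: (@vge_frob _ 0%N).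
  exact: vge_inv.
elim: k u => // k IHk u u0 uk.
have u1 : svge 1 u by apply: step => //; apply: svgeW uk; rewrite lez_nat.
(* With u = pi v, the condition on u modulo pi^(k+1) is the condition on v modulo pi^k. *)
set v := C (piK ^ (-1)) * u.
have v0 : svge 0 v by apply/svge_scale; rewrite opprK.
have uv : u = C (piK ^ 1) * v.
  by rewrite mulrA -rmorphM -expfzDr ?piK_neq0 // subrr expr0z rmorph1 mul1r.
have : svge k.+1 (C (piK ^ 1) * (v * Phi - C piK * v)).
  by rewrite expr1z in uv *; rewrite mulrBr mulrA -uv.
move/svge_scale; rewrite -addn1 PoszD addrK => /(IHk v v0) vk.
by rewrite uv; apply/svge_scale; rewrite -addn1 PoszD addrK.
Qed.

(** Put u = pi^N D(a). The defect of a is integral, so u Phi - pi u is divisible by pi^N, and hence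
    so is u. *)
Lemma in_chars_saturated (N : nat) a :
  near_integral a -> in_chars (piK ^ N *: a) -> in_chars a.
Proof.
move=> a1 aV; apply/in_charsP; split=> //.
have [u0 u_null] := aV 0%N; rewrite char_seriesZ in u0 u_null.
have uN : svge N (C (piK ^ N) * D a).
  apply: vge_right_mul_Phi => //.
  have -> : C (piK ^ N) * D a * Phi - C piK * (C (piK ^ N) * D a) =
      C (piK ^ N) * (D a * Phi - C piK * D a).
    by rewrite mulrBr !mulrA -!rmorphM [piK * _]mulrC.
  apply/svge_scale; rewrite subrr.
  have [|+ _] := @char_series0_defect 0 a; first by move=> i /a1.
  by rewrite oppr0 expr0z rmorph1 mul1r.
have := restr_scale uN u_null.
by rewrite mulrA -rmorphM -expfzDr ?piK_neq0 // addNr expr0z rmorph1 mul1r.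
Qed.

(** Here D(a) = a_0 L has defect 0, so D(a) is divisible by all powers of pi. This forces m > 0. *)
Lemma in_chars_constant a : (size a <= 1)%N -> in_chars a -> a = 0.
Proof.
move=> a1 aV; have [u0 _] := aV 0%N.
have uP : D a * Phi - C piK * D a = 0.
  rewrite (char_series0_widen a1) big_ord1 muln0 tau0 mulr1 -mulrA LP !mulrA.
  by rewrite -!rmorphM mulrC subrr.
rewrite (size1_polyC a1) -char_series0_coef0 (_ : D a 0%N = 0) ?polyC0 //.
apply: vge_all => k; apply: vge_right_mul_Phi => //.
by rewrite uP => i; rewrite tps0; apply: vge_0.
Qed.

(** * Euclidean division by a character *)

Definition integral (a : {poly K}) := forall i, vge 0 a`_i.

Lemma integralD a b : integral a -> integral b -> integral (a + b).
Proof. by move=> a0 b0 i; rewrite coefD; apply: vgeD. Qed.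
Lemma integralZ c a : vge 0 c -> integral a -> integral (c *: a).
Proof. by move=> c0 a0 i; rewrite coefZ -[0]addr0; apply: vgeM. Qed.
Lemma integralN a : integral a -> integral (- a).
Proof. by move=> a0 i; rewrite coefN; apply: vgeN. Qed.
Lemma integral_near a : integral a -> near_integral a.
Proof. by move=> a0 i _; apply: vgeW (a0 i). Qed.
Lemma integral_phi a : integral a -> integral (phi_poly a).
Proof.
move=> a0 i; rewrite coef_phi_poly; case: eqP => _; first exact: vge_0.
exact: vge_phi.
Qed.

Lemma char_series0_vge a n : integral a -> vge (- n%:Z) (D a n).
Proof.
move=> a0; rewrite (char_series0_widen (leqnn _)) tps_sum; apply: vge_sum => i _.
rewrite tps_mul_tau; case: ifP => _; last exact: vge_0.
rewrite tpsCM -[- _]add0r; apply: vgeM => //.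
by apply: vgeW (log_twist_vge _ _); rewrite lerN2 lez_nat leq_subr.
Qed.

(* R[x] modulo the characters is pi-adically separated. *)
Lemma in_chars_closed a : integral a ->
    (forall k : nat, exists b g, [/\ in_chars b, integral g & a = b + piK ^ k *: g]) ->
  in_chars a.
Proof.
move=> a0 aP; apply/in_charsP; split; first exact: integral_near.
have D0 : svge 0 (D a).
  (* The coefficient j of D(g) has a pole of order at most j, so the modulus pi^j is enough for
     it. *)
  move=> j; have [b [g [bV g0 ->]]] := aP j.
  rewrite char_seriesD tpsD; apply: vgeD; first by case: (bV 0%N).
  rewrite char_seriesZ tpsCM; apply/vge_piM; rewrite add0r.
  exact: char_series0_vge.
split=> // k; have [b [g [bV g0 ab]]] := aP k.
have [Db0 /(_ k)[N NP]] := bV 0%N.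
(* With this, D(a) and D(b) agree modulo pi^k, and D(a) inherits the convergence to 0 from D(b). *)
have : svge k (C (piK ^ k) * D g).
  have DaE : C (piK ^ k) * D g = D a - D b.
    by rewrite ab char_seriesD char_seriesZ addrAC subrr add0r.
  apply: vge_right_mul_Phi; first by rewrite DaE; apply: svgeB.
  have -> : C (piK ^ k) * D g * Phi - C piK * (C (piK ^ k) * D g) =
      C (piK ^ k) * (D g * Phi - C piK * D g).
    by rewrite mulrBr !mulrA -!rmorphM [piK * _]mulrC.
  apply/svge_scale; rewrite subrr.
  have [|+ _] := @char_series0_defect 0 g; first by move=> i _; apply: vgeW (g0 i).
  by rewrite oppr0 expr0z rmorph1 mul1r.
move=> Dgk; exists N => i /NP Dbi.
by rewrite ab char_seriesD char_seriesZ tpsD; apply: vgeD.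
Qed.

Lemma coef_iter_phi_poly j a i :
  (iter j phi_poly a)`_(i + j) = iter j phiK a`_i.
Proof.
by elim: j => [|j IHj]; rewrite ?addn0 // addnS /= coef_phi_poly /= IHj.
Qed.

Lemma size_iter_phi_poly j a n :
  (size a <= n)%N -> (size (iter j phi_poly a) <= n + j)%N.
Proof.
move=> le_an; elim: j => [|j IHj]; first by rewrite addn0.
by rewrite addnS /=; apply: size_phi_poly.
Qed.

Lemma in_chars_iter_phi j a : in_chars a -> in_chars (iter j phi_poly a).
Proof. by move=> aV; elim: j => //= j; apply: in_chars_phi. Qed.

(** Dividing by c_I makes all entries integral, with 1 at I and multiples of pi after it: modulo pi,
    a monic polynomial of degree I. *)
Lemma last_min_valuation n (c : nat -> K) :
    (exists2 i, (i < n)%N & c i != 0) ->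
  exists I, [/\ (I < n)%N, c I != 0,
    forall i, (i < n)%N -> vge 0 (c i / c I) &
    forall i, (I < i < n)%N -> vge 1 (c i / c I)].
Proof.
elim: n => [[]//|n IHn [i0 lt_i0 ci0]].
have [c_zero|] := pselect (forall i, (i < n)%N -> c i = 0).
  have n_i0 : i0 = n.
    move: lt_i0; rewrite ltnS leq_eqVlt => /predU1P[//|/c_zero c0].
    by rewrite c0 eqxx in ci0.
  subst i0; exists n; split=> // i; last by rewrite ltnS; case: ltngtP.
  rewrite ltnS leq_eqVlt => /predU1P[->|/c_zero->]; first by rewrite divff //; apply: vge_1.
  by rewrite mul0r; apply: vge_0.
move=> c_nz; have [|I [lt_I cI0 c0 c1]] := IHn.
  apply: contrapT => no_i; apply: c_nz => i lt_in; apply/eqP/contraT => ci.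
  by case: no_i; exists i.
have [cn1|[cn0 cIn]] : vge 1 (c n / c I) \/ c n != 0 /\ vge 0 (c I / c n).
- have [->|cn0] := eqVneq (c n) 0; first by left; rewrite mul0r; apply: vge_0.
  by have [|[]] := vge_total (c I) cn0; [right | left].
- exists I; split=> // [|i|i]; first exact: ltnW.
    by rewrite ltnS leq_eqVlt => /predU1P[->|/c0] //; apply: vgeW cn1.
  rewrite ltnS [(i <= n)%N]leq_eqVlt => /andP[lt_Ii /predU1P[->//|lt_in]].
  by apply: c1; rewrite lt_Ii.
exists n; split=> // [i|i]; last by rewrite ltnS; case: ltngtP.
rewrite ltnS leq_eqVlt => /predU1P[->|/c0 ci]; first by rewrite divff //; apply: vge_1.
have -> : c i / c n = c i / c I * (c I / c n) by rewrite mulrA divfK.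
by rewrite -[0]addr0; apply: vgeM.
Qed.

Lemma integral_split n a :
    integral a -> (forall i, (n <= i)%N -> vge 1 a`_i) ->
  exists b g, [/\ (size b <= n)%N, integral b, integral g & a = b + piK *: g].
Proof.
move=> a0 a1; exists (take_poly n a), (piK^-1 *: (drop_poly n a * 'X^n)); split.
- exact: size_take_poly.
- by move=> i; rewrite coef_take_poly; case: ifP => _ //; apply: vge_0.
- move=> i; rewrite coefZ -[piK^-1]/(piK ^ (-1)); apply/vge_piM; rewrite opprK add0r.
  rewrite coefMXn coef_drop_poly; case: ltnP => [_|le_ni]; first exact: vge_0.
  by apply: a1; rewrite leq_addl.
- by rewrite scalerA divff ?piK_neq0 // scale1r poly_take_drop.
Qed.

Section EuclideanDivision.

Variables (I : nat) (c : {poly K}).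
Hypotheses (c_char : in_chars c) (c_int : integral c) (c_I : c`_I = 1).
Hypothesis c_gtI : forall i, (I < i)%N -> vge 1 c`_i.

(* phi*^j c has the coefficient 1 at I + j and is 0 modulo pi above it.      *)
Lemma division_mod_pi a : integral a -> exists n b g : {poly K},
  [/\ (size n <= I)%N, integral n, in_chars b, integral g & a = n + b + piK *: g].
Proof.
have [s] := ubnP (size a); elim: s a => // s IHs a; rewrite ltnS => le_as a0.
have [le_aI|lt_Ia] := leqP (size a) I.
  exists a, 0, 0; split=> //; [exact: in_chars0 | | by rewrite scaler0 !addr0].
  by move=> i; rewrite coef0; apply: vge_0.
pose j := ((size a).-1 - I)%N; pose x := a`_(I + j).
have Ij : (I + j = (size a).-1)%N by rewrite subnKC // -ltnS (ltn_predK lt_Ia).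
have cj_int : integral (iter j phi_poly c) by elim: {Ij x} j => //= j; apply: integral_phi.
have [||b [g [b_size b0 g0 abg]]] := @integral_split (I + j) (a - x *: iter j phi_poly c).
- by apply: integralD => //; apply/integralN/integralZ => //; apply: a0.
- move=> i; rewrite leq_eqVlt => /predU1P[<-|lt_i].
    rewrite coefB coefZ coef_iter_phi_poly c_I; set y := iter _ _ 1.
    have -> : y = 1 by rewrite /y; elim: {+}j => //= l ->; rewrite rmorph1.
    by rewrite mulr1 subrr; apply: vge_0.
  rewrite coefB [a`_i]nth_default; last by rewrite -(ltn_predK lt_Ia) -Ij.
  rewrite sub0r; apply: vgeN; rewrite coefZ -[1]add0r; apply: vgeM; first exact: a0.
  have le_ji : (j <= i)%N by rewrite (leq_trans _ (ltnW lt_i)) ?leq_addl.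
  rewrite -(subnK le_ji) coef_iter_phi_poly; apply/vge_iter_phi/c_gtI.
  by rewrite ltn_subRL addnC.
have lt_bs : (size b < s)%N.
  by apply: leq_ltn_trans b_size _; apply: leq_trans le_as; rewrite Ij (ltn_predK lt_Ia).
have [n [v [h [n_size n0 vV h0 bE]]]] := IHs b lt_bs b0.
exists n, (v + x *: iter j phi_poly c), (h + g); split=> //.
- by apply: in_charsD vV (in_charsZ (a0 _) (in_chars_iter_phi _ _)).
- exact: integralD.
- rewrite -[LHS](subrK (x *: iter j phi_poly c)) abg bE scalerDr.
  by rewrite -!addrA; congr (_ + (_ + _)); rewrite addrA addrC.
Qed.

(** Iterating [division_mod_pi] on the quotients g_k writes a as \sum_(j < k) pi^j n_j + \sum_(j <
    k) pi^j v_j + pi^k g_k, with n_j of size at most I and v_j a character. The first sum converges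
    by completeness of R to the remainder, and [in_chars_closed] handles the difference. *)
Lemma division a : integral a -> exists2 n : {poly K}, (size n <= I)%N & in_chars (a - n).
Proof.
move=> a_int; have /choice[f fP] : forall g : {poly K}, exists nbh : {poly K} * {poly K} * {poly K},
    integral g -> [/\ (size nbh.1.1 <= I)%N, integral nbh.1.1, in_chars nbh.1.2,
                      integral nbh.2 & g = nbh.1.1 + nbh.1.2 + piK *: nbh.2].
  (* A default value where g is not integral, as [choice] needs a total function. *)
  move=> g; have [g0|ng0] := pselect (integral g); last by exists (0, 0, 0).
  by have [n [b [h]]] := division_mod_pi g0; exists (n, b, h).
pose g k := iter k (fun g => (f g).2) a.
have g0 k : integral (g k) by elim: k => //= k /fP[].
pose n k := (f (g k)).1.1; pose v k := (f (g k)).1.2.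
have gE k : g k = n k + v k + piK *: g k.+1 by case: (fP _ (g0 k)).
pose u k := \sum_(j < k) piK ^+ j *: n j.
have u0 k : integral (u k).
  rewrite /u; elim/big_ind: _ => [i|x y|j _]; [by rewrite coef0; apply: vge_0 | exact: integralD |].
  apply: integralZ; last by case: (fP _ (g0 j)).
  by apply: (@vgeW _ j) => //; apply: (@vge_pi _ j%:Z).
have /choice[y yP] : forall i, exists y, vge 0 y /\ forall k : nat, vge k (y - (u k)`_i).
  move=> i; have [|k|y y0 yP] := @complete_K X (fun k => (u k)`_i).
  - by move=> k; apply: u0.
  - rewrite /u big_ord_recr /= coefD addrC addKr coefZ -[k%:Z]addr0.
    apply: vgeM; first exact: (@vge_pi _ k%:Z).
    by case: (fP _ (g0 k)).
  by exists y.
pose N := \poly_(i < I) y i.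
have u_size k : (size (u k) <= I)%N.
  rewrite /u; apply: (big_ind (fun x : {poly K} => size x <= I)%N).
  - by rewrite size_poly0.
  - by move=> a1 a2 a1I a2I; rewrite (leq_trans (size_polyD _ _)) // geq_max a1I.
  - move=> j _; apply: leq_trans (size_scale_leq _ _) _.
    by case: (fP _ (g0 j)).
exists N; first exact: size_poly.
have N0 : integral N.
  by move=> i; rewrite coef_poly; case: ifP => _; [case: (yP i) | apply: vge_0].
apply: in_chars_closed; first by apply: integralD a_int (integralN N0).
(* The tail N - u_k of the remainder is divisible by pi^k and is absorbed in the integral part. *)
move=> k; exists (\sum_(j < k) piK ^+ j *: v j), (g k - piK ^ (- k%:Z) *: (N - u k)); split.
- apply: in_chars_sum => j _; apply: in_charsZ; last by case: (fP _ (g0 j)).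
  by apply: (@vgeW _ j) => //; apply: (@vge_pi _ j%:Z).
- apply: integralD => //; apply: integralN => i; rewrite coefZ; apply/vge_piM.
  rewrite opprK add0r coefB coef_poly; case: ifP => [_|le_Ii]; first by case: (yP i).
  by rewrite nth_default ?subrr ?(leq_trans (u_size k)) // 1?leqNgt ?le_Ii //; apply: vge_0.
rewrite scalerBr scalerA -expfzDr ?piK_neq0 // subrr expr0z scale1r opprB.
suff -> : a = u k + \sum_(j < k) piK ^+ j *: v j + piK ^ k *: g k.
  by rewrite [u k + _]addrC -!addrA; congr (_ + _); rewrite addrCA.
elim: k => [|k IHk]; first by rewrite /u !big_ord0 !add0r expr0z scale1r.
rewrite {1}IHk /u !big_ord_recr /= {1}gE 2!scalerDr scalerA -exprSr.
by rewrite addrA addrACA.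
Qed.

End EuclideanDivision.

(* If the minimal valuation of the coefficients of b were attained for the   *)
(* last time at I < m, then X^I modulo the characters would be represented    *)
(* by a polynomial of degree < I, whence a character of order I < m.          *)
Lemma lead_coef_min m b :
    (forall a, in_chars a -> (size a <= m)%N -> a = 0) ->
    in_chars b -> b != 0 -> (size b <= m.+1)%N ->
  b`_m != 0 /\ forall i, vge 0 (b`_i / b`_m).
Proof.
move=> m_min bV b_neq0 b_size.
have [|I [lt_I bI0 b0 b1]] := @last_min_valuation m.+1 (fun i => b`_i).
  exists (size b).-1; last by rewrite -lead_coefE lead_coef_eq0.
  by rewrite ltnS; case: (size b) b_size.
have {}b0 i : vge 0 (b`_i / b`_I).
  have [/b0//|le_mi] := ltnP i m.+1.
  by rewrite nth_default ?(leq_trans b_size) // mul0r; apply: vge_0.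
have {}b1 i : (I < i)%N -> vge 1 (b`_i / b`_I).
  move=> lt_Ii; have [lt_im|le_mi] := ltnP i m.+1; first by apply: b1; rewrite lt_Ii.
  by rewrite nth_default ?(leq_trans b_size) // mul0r; apply: vge_0.
move: lt_I; rewrite ltnS leq_eqVlt => /predU1P[Im|lt_Im]; first by rewrite -Im.
pose c := (b`_I)^-1 *: b.
have cE i : c`_i = b`_i / b`_I by rewrite coefZ mulrC.
have c_int : integral c by move=> i; rewrite cE.
have c_char : in_chars c.
  (* pi^N clears the pole of the inverse of b_I, so pi^N c is a character; saturation removes
     pi^N. *)
  have [N NP] := vge_ex (b`_I)^-1; apply: (@in_chars_saturated N).
    exact: integral_near.
  by rewrite scalerA; apply: in_charsZ => //; apply/vge_piM; rewrite add0r.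
have cI1 : c`_I = 1 by rewrite cE divff.
have c_gtI i : (I < i)%N -> vge 1 c`_i by rewrite cE; apply: b1.
have XI_int : integral 'X^I.
  by move=> i; rewrite coefXn; case: eqP => _; [apply: vge_1 | apply: vge_0].
have [n n_size nV] := division c_char c_int cI1 c_gtI XI_int.
have /polyP/(_ I)/eqP : 'X^I - n = 0.
  apply: m_min nV _; rewrite (leq_trans (size_polyD _ _)) // geq_max size_polyXn lt_Im.
  by rewrite size_polyN (leq_trans n_size) // ltnW.
by rewrite coefB coefXn eqxx nth_default // subr0 coef0 oner_eq0.
Qed.

(** * The action of R{phi*} on polynomials and the generator *)

Definition twisted_comb (P : {poly R}) a : {poly K} :=
  \sum_(i < size P) tofrac P`_i *: iter i phi_poly a.

Lemma twisted_comb_widen n (P : {poly R}) a : (size P <= n)%N ->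
  twisted_comb P a = \sum_(i < n) tofrac P`_i *: iter i phi_poly a.
Proof.
move=> le_Pn; rewrite /twisted_comb.
rewrite -(big_mkord predT (fun i => tofrac P`_i *: iter i phi_poly a)).
rewrite -(big_mkord predT (fun i => tofrac P`_i *: iter i phi_poly a)).
rewrite [RHS](big_cat_nat (n := size P)) //= [X in _ = _ + X]big_nat_cond.
rewrite [X in _ = _ + X]big1 ?addr0 // => i; rewrite andbT => /andP[le_Pi _].
by rewrite nth_default // tofrac0 scale0r.
Qed.

Lemma twisted_combD (P P' : {poly R}) a :
  twisted_comb (P + P') a = twisted_comb P a + twisted_comb P' a.
Proof.
rewrite (twisted_comb_widen _ (size_polyD P P')).
rewrite (twisted_comb_widen _ (leq_maxl (size P) (size P'))).
rewrite (twisted_comb_widen _ (leq_maxr (size P) (size P'))).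
by rewrite -big_split; apply: eq_bigr => i _; rewrite coefD tofracD scalerDl.
Qed.

Lemma twisted_combXn c j a :
  twisted_comb (c *: 'X^j) a = tofrac c *: iter j phi_poly a.
Proof.
have le_j : (size (c *: 'X^j : {poly R})%R <= j.+1)%N.
  by rewrite (leq_trans (size_scale_leq _ _)) ?size_polyXn.
rewrite (twisted_comb_widen _ le_j) big_ord_recr /= big1 => [|i _].
  by rewrite add0r coefZ coefXn eqxx mulr1.
by rewrite coefZ coefXn (ltn_eqF (ltn_ord i)) mulr0 tofrac0 scale0r.
Qed.

(** All shifts of a have leading coefficient 1/pi, as phi fixes pi, and leading coefficients in
    positive degree lie in pi^-1 R. Hence an R-multiple of a shift cancels the leading term of any
    character of degree at least m. *)
Lemma char_generator m :
    (exists a, [/\ in_chars a, (size a <= m.+1)%N & a != 0]) ->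
    (forall a, in_chars a -> (size a <= m)%N -> a = 0) ->
  exists a, [/\ in_chars a, (size a <= m.+1)%N, a`_m = piK^-1 &
    forall b, in_chars b -> exists P, b = twisted_comb P a].
Proof.
move=> [b [bV b_size b_neq0]] m_min.
have m_gt0 : (0 < m)%N.
  rewrite lt0n; apply: contraNneq b_neq0 => m0; apply/eqP/in_chars_constant => //.
  by rewrite m0 in b_size.
have [bm0 b_min] := lead_coef_min m_min bV b_neq0 b_size.
(* By [lead_coef_min] this scaling, with a_m = 1/pi, leaves at most simple poles in the other
   coefficients, so saturation applies. *)
pose a := (piK * b`_m)^-1 *: b.
have aE i : a`_i = piK^-1 * (b`_i / b`_m) by rewrite coefZ invfM -mulrA [_ * b`_i]mulrC.
have aV : in_chars a.
  have [N NP] := vge_ex (piK * b`_m)^-1; apply: (@in_chars_saturated N).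
    move=> i _; rewrite aE -[piK^-1]/(piK ^ (-1)); apply/vge_piM.
    by rewrite opprK; apply: b_min.
  by rewrite scalerA; apply: in_charsZ => //; apply/vge_piM; rewrite add0r.
have am : a`_m = piK^-1 by rewrite aE divff // mulr1.
have a_size : (size a <= m.+1)%N by rewrite (leq_trans (size_scale_leq _ _)).
clearbody a.
exists a; split=> // {b bV b_size b_neq0 bm0 b_min aE} c cV.
have [s] := ubnP (size c); elim: s c cV => // s IHs c cV; rewrite ltnS => le_cs.
have [le_cm|lt_mc] := leqP (size c) m.
  by exists 0; rewrite (m_min c) // /twisted_comb size_poly0 big_ord0.
pose j := ((size c).-1 - m)%N.
have mj : (m + j = (size c).-1)%N by rewrite subnKC // -ltnS (ltn_predK lt_mc).
have /vge0P[x xE] : vge 0 (piK * c`_(m + j)).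
  rewrite -[X in X * _]expr1z; apply/vge_piM; rewrite sub0r.
  by apply: in_chars_near_integral => //; rewrite addn_gt0 m_gt0.
pose d := c - tofrac x *: iter j phi_poly a.
have dV : in_chars d.
  by apply: in_charsB cV (in_charsZ (vge_tofrac _) (in_chars_iter_phi _ _)).
have d_size : (size d <= m + j)%N.
  apply/leq_sizeP => i; rewrite leq_eqVlt => /predU1P[<-|lt_i]; rewrite coefB coefZ.
    rewrite coef_iter_phi_poly am; set y := iter _ _ _.
    have -> : y = piK^-1.
      rewrite /y; elim: {+}j => //= l ->.
      by rewrite fmorphV; congr (_^-1); apply: phiK_pi.
    by rewrite -xE mulrC mulKf ?piK_neq0 // subrr.
  rewrite !nth_default ?mulr0 ?subrr //; last by rewrite -(ltn_predK lt_mc) -mj.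
  by apply: leq_trans (size_iter_phi_poly j a_size) _; rewrite addSn.
have [P dE] : exists P, d = twisted_comb P a.
  apply: IHs dV _; apply: leq_ltn_trans d_size _; apply: leq_trans le_cs.
  by rewrite mj (ltn_predK lt_mc).
exists (P + x *: 'X^j); rewrite twisted_combD -dE twisted_combXn.
by rewrite subrK.
Qed.

(** The shifts of a have their leading terms in the distinct degrees m + i, so the leading
    coefficient of P survives. *)
Lemma twisted_comb_inj m a : (size a <= m.+1)%N -> a`_m != 0 ->
  injective (fun P : {poly R} => twisted_comb P a).
Proof.
move=> a_size am; suff inj0 P : twisted_comb P a = 0 -> P = 0.
  move=> P P' PP'; apply/eqP; rewrite -subr_eq0; apply/eqP/inj0.
  have := PP'; rewrite -{1}(subrK P' P) twisted_combD => /(congr1 (fun x => x - twisted_comb P' a)).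
  by rewrite addrK subrr.
move=> Pa0; apply/eqP/contraT => P0.
have P_size : size P = (size P).-1.+1 by rewrite prednK // lt0n size_poly_eq0.
have /polyP/(_ (m + (size P).-1)%N)/eqP := Pa0.
rewrite (twisted_comb_widen _ (eq_leq P_size)) big_ord_recr /= coefD coefZ coef0.
rewrite coef_sum big1 => [|i _]; last first.
  rewrite coefZ [X in _ * X]nth_default ?mulr0 // (leq_trans (size_iter_phi_poly _ a_size)) //.
  by rewrite addSn -addnS leq_add2l.
rewrite add0r coef_iter_phi_poly mulf_eq0 tofrac_eq0 -lead_coefE lead_coef_eq0 (negPf P0) /=.
suff -> : (iter (size P).-1 phiK a`_m == 0) = false by [].
elim: (_.-1) => [|j IHj]; first exact: negPf.
by rewrite /= fmorph_eq0.
Qed.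

End CharacterModule.

(** * Witt vectors and jets *)

Section AdditivePolynomials.

Variables (X : frob_dvr) (N : nat).
Local Notation R := (fd_ring X).
Local Notation p := (fd_p X).
Local Notation pi := (fd_pi X).
Local Notation P := {mpoly R[N]}.
Local Notation S := (tps (pchar_K X)).
Local Notation C := (@tpsC _ _ (pchar_K X)).
Local Notation tau := (tau (pchar_K X)).
Implicit Types f g : P.

Lemma pchar_alg (B : comAlgType R) : p \in [pchar B].
Proof.
rewrite inE (pcharf_prime (fd_pchar X)) -scaler_nat.
by rewrite (pcharf0 (fd_pchar X)) scale0r eqxx.
Qed.

Lemma pchar_mpoly : p \in [pchar P]. Proof. exact: pchar_alg. Qed.

Definition mono (k : 'I_N) s : 'X_{1..N} := (U_(k) *+ p ^ s)%MM.

Lemma monoE k s i : mono k s i = if k == i then (p ^ s)%N else 0%N.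
Proof. by rewrite /mono mulmnE mnm1E; case: eqP; rewrite ?mul1n. Qed.

Lemma mdeg_mono k s : mdeg (mono k s) = (p ^ s)%N.
Proof. by rewrite mdegMn mdeg1 mul1n. Qed.

Lemma mono_inj k s l t : mono k s = mono l t -> k = l /\ s = t.
Proof.
move=> eq_m; have st : s = t.
  by have := congr1 mdeg eq_m; rewrite !mdeg_mono => /eqP; rewrite eqn_exp2l ?p_gt1 // => /eqP.
split=> //; have /mnmP/(_ k) := eq_m; rewrite !monoE eqxx; case: eqP => // _ /eqP.
by rewrite expn_eq0 gtn_eqF ?p_gt0.
Qed.

Definition add_poly f := forall m, f@_m != 0 -> exists k s, m = mono k s.
(** The part of f in the variable x_k, with tau^s standing for x_k^(p^s). *)
Definition row f (k : 'I_N) : S := fun s => tofrac f@_(mono k s).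

Lemma rowD f g k : row (f + g) k = row f k + row g k.
Proof. by apply/tpsP => s; rewrite tpsD /row mcoeffD tofracD. Qed.
Lemma row0 k : row 0 k = 0.
Proof. by apply/tpsP => s; rewrite tps0 /row mcoeff0 tofrac0. Qed.
Lemma rowZ c f k : row (c *: f) k = C (tofrac c) * row f k.
Proof. by apply/tpsP => s; rewrite tpsCM /row mcoeffZ tofracM. Qed.
Lemma row_sum I (r : seq I) (Q : pred I) (F : I -> P) k :
  row (\sum_(i <- r | Q i) F i) k = \sum_(i <- r | Q i) row (F i) k.
Proof. by elim/big_rec2: _ => [|i x y _ <-]; rewrite ?row0 ?rowD. Qed.

Lemma mono_pS k s : mono k s.+1 = (mono k s *+ p)%MM.
Proof. by apply/mnmP => i; rewrite mulmnE !monoE expnSr; case: eqP. Qed.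

Lemma mulmn_pinj m m' : (m *+ p)%MM = (m' *+ p)%MM :> 'X_{1..N} -> m = m'.
Proof.
move=> /mnmP eq_m; apply/mnmP => i; have /eqP := eq_m i.
by rewrite !mulmnE eqn_pmul2r ?p_gt0 // => /eqP.
Qed.

Lemma mcoeff_frob f m : (f ^+ p)@_(m *+ p) = f@_m ^+ p.
Proof.
elim/mpolyind: f => [|c m' f _ _ IHf].
  by rewrite mcoeff0 !expr0n gtn_eqF ?p_gt0 //= mcoeff0.
have frobE (T : comNzRingType) (chT : p \in [pchar T]) (x y : T) : (x + y) ^+ p = x ^+ p + y ^+ p.
  by rewrite -!(pFrobenius_autE chT) rmorphD.
rewrite (frobE _ pchar_mpoly) !mcoeffD IHf (frobE _ (fd_pchar X)); congr (_ + _).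
rewrite exprZn !mcoeffZ mcoeffXn mcoeffX exprMn; congr (_ * _).
rewrite (inj_eq mulmn_pinj); case: eqP; rewrite ?expr1n //.
by rewrite expr0n gtn_eqF ?p_gt0.
Qed.

Lemma mcoeff_frob0 f m : ~ (exists m', m = (m' *+ p)%MM) -> (f ^+ p)@_m = 0.
Proof.
move=> m_np; elim/mpolyind: f => [|c m' f _ _ IHf].
  by rewrite expr0n gtn_eqF ?p_gt0 // mcoeff0.
rewrite -(pFrobenius_autE pchar_mpoly) rmorphD /= !pFrobenius_autE mcoeffD IHf addr0.
rewrite exprZn mcoeffZ mcoeffXn; case: eqP => [m'E|_]; last by rewrite mulr0.
by case: m_np; exists m'.
Qed.

Lemma row_frob f k : row (f ^+ p) k = tau 1 * row f k.
Proof.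
apply/tpsP => -[|s]; rewrite tau_mul_tps /row /=.
  rewrite mcoeff_frob0 ?tofrac0 // => -[m /mnmP/(_ k)].
  rewrite mulmnE monoE eqxx expn0 => /(congr1 (dvdn p)).
  by rewrite dvdn_mull // dvdn1 gtn_eqF ?p_gt1.
by rewrite mono_pS mcoeff_frob tofracXn subn1 frobnE expn1.
Qed.

Lemma row_exp f i k : row (f ^+ (p ^ i)) k = tau i * row f k.
Proof.
elim: i => [|i IHi]; first by rewrite tau0 mul1r expn0 expr1.
by rewrite expnSr exprM row_frob IHi mulrA -tauD.
Qed.

Lemma row_X k l : row 'X_k l = if k == l then 1 else 0.
Proof.
have -> : 'X_k = 'X_[mono k 0] :> P by rewrite /mono expn0 mulm1n.
apply/tpsP => s; rewrite /row mcoeffX; case: (eqVneq k l) => [->|ne_kl].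
  rewrite tps1 eq_sym; have [->|ne_s] := eqVneq s 0%N; first by rewrite eqxx tofrac1.
  case: eqP => [/mono_inj[_ s0]|_]; last by rewrite tofrac0.
  by rewrite s0 eqxx in ne_s.
rewrite tps0; case: eqP => [/mono_inj[kl]|_]; last by rewrite tofrac0.
by rewrite kl eqxx in ne_kl.
Qed.

Lemma add_polyD f g : add_poly f -> add_poly g -> add_poly (f + g).
Proof.
move=> fA gA m; rewrite mcoeffD; have [->|/fA//] := eqVneq f@_m 0.
by rewrite add0r => /gA.
Qed.
Lemma add_poly0 : add_poly 0. Proof. by move=> m; rewrite mcoeff0 eqxx. Qed.
Lemma add_polyZ c f : add_poly f -> add_poly (c *: f).
Proof. by move=> fA m; rewrite mcoeffZ mulf_eq0 negb_or => /andP[_ /fA]. Qed.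
Lemma add_polyB f g : add_poly f -> add_poly g -> add_poly (f - g).
Proof. by move=> fA gA; apply: add_polyD => //; rewrite -scaleN1r; apply: add_polyZ. Qed.
Lemma add_poly_sum I (r : seq I) (Q : pred I) (F : I -> P) :
  (forall i, Q i -> add_poly (F i)) -> add_poly (\sum_(i <- r | Q i) F i).
Proof.
by move=> FA; elim/big_rec: _ => [|i x Qi]; [apply: add_poly0 | apply: add_polyD; apply: FA].
Qed.
Lemma add_poly_unscale c f : c != 0 -> add_poly (c *: f) -> add_poly f.
Proof. by move=> c0 fA m fm; apply: fA; rewrite mcoeffZ mulf_neq0. Qed.
Lemma add_poly_X k : add_poly 'X_k.
Proof.
move=> m; rewrite mcoeffX; case: (_ =P m) => [<- _|_]; last by rewrite eqxx.
by exists k, 0%N; rewrite /mono expn0 mulm1n.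
Qed.
Lemma add_poly_exp f i : add_poly f -> add_poly (f ^+ (p ^ i)).
Proof.
move=> fA; elim: i => [|i IHi]; first by rewrite expn0 expr1.
rewrite expnSr exprM => m; have [[m' ->]|m_np] := pselect (exists m', m = (m' *+ p)%MM).
  rewrite mcoeff_frob expf_eq0 negb_and p_gt0 /= => /IHi[k [s ->]].
  by exists k, s.+1; rewrite mono_pS.
by rewrite mcoeff_frob0 ?eqxx.
Qed.

Definition pdvd (k : nat) f := exists g, f = pi ^+ k *: g.

Lemma pdvd_mcoeff k f : (forall m, divides (pi ^+ k) f@_m) -> pdvd k f.
Proof.
move=> /choice[y fE]; exists (\sum_(m <- msupp f) y m *: 'X_[m]).
rewrite {1}[f]mpolyE scaler_sumr; apply: eq_bigr => m _.
by rewrite scalerA -fE.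
Qed.

Lemma pdvd_coef k f m : pdvd k f -> divides (pi ^+ k) f@_m.
Proof. by move=> [g ->]; exists g@_m; rewrite mcoeffZ. Qed.

Lemma pdvd_add_poly (k : nat) f : add_poly f ->
  (forall l s, vge k (row f l s)) -> pdvd k f.
Proof.
move=> fA f_k; apply: pdvd_mcoeff => m; have [->|/fA[l [s ->]]] := eqVneq f@_m 0.
  by exists 0; rewrite mulr0.
by apply/vge_divides; apply: f_k.
Qed.

Lemma pdvdD k f g : pdvd k f -> pdvd k g -> pdvd k (f + g).
Proof. by move=> [a ->] [b ->]; exists (a + b); rewrite scalerDr. Qed.
Lemma pdvd0 k : pdvd k 0. Proof. by exists 0; rewrite scaler0. Qed.
Lemma pdvdZ k c f : pdvd k f -> pdvd k (c *: f).
Proof. by move=> [a ->]; exists (c *: a); rewrite !scalerA mulrC. Qed.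
Lemma pdvdB k f g : pdvd k f -> pdvd k g -> pdvd k (f - g).
Proof. by move=> fk gk; apply: pdvdD => //; rewrite -scaleN1r; apply: pdvdZ. Qed.
Lemma pdvd_sum k I (r : seq I) (Q : pred I) (F : I -> P) :
  (forall i, Q i -> pdvd k (F i)) -> pdvd k (\sum_(i <- r | Q i) F i).
Proof.
by move=> Fk; elim/big_rec: _ => [|i x Qi]; [apply: pdvd0 | apply: pdvdD; apply: Fk].
Qed.
Lemma pdvdM k f g : pdvd k f -> pdvd k (f * g).
Proof. by move=> [a ->]; exists (a * g); rewrite scalerAl. Qed.
Lemma pdvdW j k f : (j <= k)%N -> pdvd k f -> pdvd j f.
Proof. by move=> le_jk [a ->]; exists (pi ^+ (k - j) *: a); rewrite scalerA -exprD subnKC. Qed.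
Lemma pdvd_exp k f i : pdvd k f -> pdvd (k * i) (f ^+ i).
Proof. by move=> [a ->]; exists (a ^+ i); rewrite exprZn -exprM. Qed.
Lemma pdvd_scale i k f : pdvd k f -> pdvd (i + k) (pi ^+ i *: f).
Proof. by move=> [a ->]; exists a; rewrite scalerA -exprD. Qed.
Lemma pdvd_unscale i k f : pdvd (i + k) (pi ^+ i *: f) -> pdvd k f.
Proof.
move=> [a fE]; exists a; apply/mpolyP => m; apply: (mulfI (expf_neq0 i (pi_neq0 X))).
by rewrite -!mcoeffZ fE scalerA -exprD.
Qed.

End AdditivePolynomials.

(** * Witt operations in characteristic p *)

Section WittOperations.

Variable X : frob_dvr.
Local Notation R := (fd_ring X).
Local Notation K := {fraction R}.
Local Notation p := (fd_p X).
Local Notation e := (fd_e X).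
Local Notation pi := (fd_pi X).
Local Notation phi := (fd_phi X).
Local Notation Q := (p ^ e)%N.

Lemma expQ k : (Q ^ k = p ^ (e * k))%N. Proof. by rewrite expnM. Qed.

Lemma exprQD (B : comAlgType R) k (x y : B) :
  (x + y) ^+ (Q ^ k) = x ^+ (Q ^ k) + y ^+ (Q ^ k).
Proof. by rewrite expQ -!(frobnE (pchar_alg B)) rmorphD. Qed.

Lemma ghostD (B : comAlgType R) n (x y : 'I_n.+1 -> B) i :
  ghost pi Q (fun j => x j + y j) i = ghost pi Q x i + ghost pi Q y i.
Proof.
by rewrite /ghost -big_split; apply: eq_bigr => k _; rewrite exprQD scalerDr.
Qed.

Lemma ghost0 (B : comAlgType R) n i : ghost pi Q (fun _ : 'I_n.+1 => 0 : B) i = 0.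
Proof.
rewrite /ghost big1 // => k _; rewrite expr0n.
by rewrite expQ gtn_eqF ?scaler0 // expn_gt0 p_gt0.
Qed.

Lemma eq_ghost (B : comAlgType R) n (x y : 'I_n.+1 -> B) i :
  x =1 y -> ghost pi Q x i = ghost pi Q y i.
Proof. by move=> xy; apply: eq_bigr => k _; rewrite xy. Qed.

Lemma ghost_sum (B : comAlgType R) n M (F : nat -> 'I_n.+1 -> B) i :
  ghost pi Q (fun j => \sum_(l < M) F l j) i = \sum_(l < M) ghost pi Q (F l) i.
Proof.
elim: M => [|M IHM].
  by rewrite big_ord0 -[RHS](ghost0 B n i); apply: eq_ghost => j; rewrite big_ord0.
rewrite big_ord_recr /= -IHM -ghostD; apply: eq_ghost => j.
by rewrite big_ord_recr.
Qed.

Section Functoriality.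

Variables (B : comAlgType R) (N : nat) (x : 'I_N -> B).

Lemma pevalZ c (f : {mpoly R[N]}) : peval x (c *: f) = c *: peval x f.
Proof. by rewrite /peval mmapZ /= mulr_algl. Qed.

Lemma peval_sum I (r : seq I) (Q : pred I) (F : I -> {mpoly R[N]}) :
  peval x (\sum_(i <- r | Q i) F i) = \sum_(i <- r | Q i) peval x (F i).
Proof. exact: rmorph_sum. Qed.

Lemma pevalXU i : peval x 'X_i = x i.
Proof. by rewrite /peval mmapX mmap1U. Qed.

Lemma pevalX f k : peval x (f ^+ k) = peval x f ^+ k.
Proof. exact: rmorphXn. Qed.

Lemma peval_ghost n (S : 'I_n.+1 -> {mpoly R[N]}) i :
  peval x (ghost pi Q S i) = ghost pi Q (fun j => peval x (S j)) i.
Proof. by rewrite peval_sum; apply: eq_bigr => k _; rewrite pevalZ pevalX. Qed.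

Lemma pevalXm m : peval x 'X_[m] = \prod_i x i ^+ m i.
Proof. by rewrite /peval mmapX. Qed.

Lemma pevalD f g : peval x (f + g) = peval x f + peval x g.
Proof. exact: rmorphD. Qed.

Lemma peval_prod I (r : seq I) (Q : pred I) (F : I -> {mpoly R[N]}) :
  peval x (\prod_(i <- r | Q i) F i) = \prod_(i <- r | Q i) peval x (F i).
Proof. exact: rmorph_prod. Qed.

Lemma pevalM f g : peval x (f * g) = peval x f * peval x g.
Proof. exact: rmorphM. Qed.

Lemma peval0 : peval x 0 = 0. Proof. exact: rmorph0. Qed.

End Functoriality.

Lemma peval_peval (B : comAlgType R) N M (x : 'I_N -> B) (y : 'I_M -> {mpoly R[N]}) f :
  peval x (peval y f) = peval (fun i => peval x (y i)) f.
Proof.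
elim/mpolyind: f => [|c m f _ _ IHf]; first by rewrite !peval0.
rewrite !pevalD !pevalZ IHf !pevalXm peval_prod; congr (_ *: _ + _).
by apply: eq_bigr => i _; rewrite pevalX.
Qed.

Lemma eq_peval (B : comAlgType R) N (x y : 'I_N -> B) f :
  x =1 y -> peval x f = peval y f.
Proof.
move=> xy; elim/mpolyind: f => [|c m f _ _ IHf]; first by rewrite !peval0.
rewrite !pevalD !pevalZ IHf !pevalXm; congr (_ *: _ + _).
by apply: eq_bigr => i _; rewrite xy.
Qed.

Lemma peval_id N (f : {mpoly R[N]}) : peval (fun i => 'X_i) f = f.
Proof.
elim/mpolyind: f => [|c m f _ _ IHf]; first by rewrite peval0.
rewrite pevalD pevalZ IHf pevalXm; congr (_ *: _ + _).
by rewrite mpolyXE_id.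
Qed.

Lemma pdvd_peval (B : comAlgType R) N (x : 'I_N -> B) k f :
  pi ^+ k *: (1 : B) = 0 -> pdvd k f -> peval x f = 0.
Proof. by move=> Bk [g ->]; rewrite pevalZ -[peval x g]mul1r scalerAl Bk mul0r. Qed.

Section Witt.

Variables (B : comAlgType R) (n : nat).
Implicit Types x y : {ffun 'I_n.+1 -> B}.

Let wadd_polyE : wadd_poly pi Q n =
  [ffun j => 'X_(lshift n.+1 j) + 'X_(rshift n.+1 j)].
Proof.
apply: (unghost_unique (p := p) (e := e) (pi_neq0 X)) => i le_in.
rewrite [LHS](ghost_unghostD (fd_pchar X) (fd_e_gt0 X) (fd_phi_pi X) (@fd_lift X)
  (fun j => lshift n.+1 j) (fun j => rshift n.+1 j) le_in).
by rewrite -ghostD; apply: eq_ghost => j; rewrite ffunE.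
Qed.

Lemma pair_varsl x y i : pair_vars x y (lshift n.+1 i) = x i.
Proof. by rewrite /pair_vars -[lshift _ _]/(unsplit (inl i)) unsplitK. Qed.

Lemma pair_varsr x y i : pair_vars x y (rshift n.+1 i) = y i.
Proof. by rewrite /pair_vars -[rshift _ _]/(unsplit (inr i)) unsplitK. Qed.

(* In characteristic p the ghost map is additive. *)
Lemma waddE x y : wadd pi Q x y = [ffun j => x j + y j].
Proof.
apply/ffunP => j; rewrite !ffunE wadd_polyE ffunE pevalD !pevalXU.
by rewrite pair_varsl pair_varsr.
Qed.

Lemma ghost_wmul x y i : (i <= n)%N ->
  ghost pi Q (wmul pi Q x y) i = ghost pi Q x i * ghost pi Q y i.
Proof.
move=> le_in; transitivity (peval (pair_vars x y) (ghost pi Q (wmul_poly pi Q n) i)).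
  by rewrite peval_ghost; apply: eq_ghost => j; rewrite ffunE.
rewrite [ghost _ _ _ _](ghost_unghostM (fd_pchar X) (fd_e_gt0 X) (fd_phi_pi X) (@fd_lift X)
  (fun j => lshift n.+1 j) (fun j => rshift n.+1 j) le_in) pevalM !peval_ghost.
by congr (_ * _); apply: eq_ghost => j; rewrite pevalXU ?pair_varsl ?pair_varsr.
Qed.

Lemma ghost_wscale r x i : (i <= n)%N ->
  ghost pi Q (wscale pi Q phi r x) i = iter i phi r *: ghost pi Q x i.
Proof.
move=> le_in; transitivity (peval x (ghost pi Q (wscale_poly pi Q phi n r) i)).
  by rewrite peval_ghost; apply: eq_ghost => j; rewrite ffunE.
rewrite [ghost _ _ _ _](ghost_unghostZ (fd_pchar X) (fd_e_gt0 X) (fd_phi_pi X) (@fd_lift X) id) //.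
by rewrite pevalZ peval_ghost; congr (_ *: _); apply: eq_ghost => j; rewrite pevalXU.
Qed.

Lemma ghost_wexp x d i : (0 < d)%N -> (i <= n)%N ->
  ghost pi Q (wexp pi Q x d) i = ghost pi Q x i ^+ d.
Proof.
move=> d_gt0 le_in; rewrite -(prednK d_gt0) /wexp iteropS.
elim: d.-1 => [|j IHj]; first by rewrite expr1.
by rewrite /= ghost_wmul // IHj -exprS.
Qed.

End Witt.

Section WittFunctoriality.

Variables (B : comAlgType R) (n N : nat) (x : 'I_N -> B).
Implicit Types y z : {ffun 'I_n.+1 -> {mpoly R[N]}}.

Definition wpeval y : {ffun 'I_n.+1 -> B} := [ffun j => peval x (y j)].

Lemma wpeval_mul y z :
  wpeval (wmul pi Q y z) = wmul pi Q (wpeval y) (wpeval z).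
Proof.
apply/ffunP => j; rewrite !ffunE peval_peval; apply: eq_peval => i.
by rewrite /pair_vars; case: split => l; rewrite ffunE.
Qed.

Lemma wpeval_scale r y :
  wpeval (wscale pi Q phi r y) = wscale pi Q phi r (wpeval y).
Proof.
apply/ffunP => j; rewrite !ffunE peval_peval; apply: eq_peval => i.
by rewrite ffunE.
Qed.

Lemma wpeval_exp y d : (0 < d)%N -> wpeval (wexp pi Q y d) = wexp pi Q (wpeval y) d.
Proof.
move=> d_gt0; rewrite -(prednK d_gt0) /wexp !iteropS.
by elim: d.-1 => //= j IHj; rewrite wpeval_mul IHj.
Qed.

End WittFunctoriality.

(** Induction on j in pi^j W_j = phi^j(r) w_j - \sum_(i < j) pi^i W_i^(qhat^(j-i)): each W_i is
    divisible by pi^(K-i), and so is its power, hence pi^K divides the right-hand side. The action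
    of E on jets converges by this. *)
Lemma wscale_poly_pdvd n (K : nat) r (j : 'I_n.+1) :
  (n <= K)%N -> divides (pi ^+ K) r -> pdvd (K - j) (wscale_poly pi Q phi n r j).
Proof.
move=> le_nK [r' rE]; case: j => j lt_j /=; elim/ltn_ind: j lt_j => j IHj lt_j.
set W := wscale_poly pi Q phi n r; have le_jn : (j <= n)%N by [].
have phi_r : iter j phi r = pi ^+ K * iter j phi r'.
  by rewrite rE; elim: {IHj lt_j le_jn} j => //= j ->; rewrite rmorphM rmorphXn fd_phi_pi.
have WE := ghost_unghostZ (fd_pchar X) (fd_e_gt0 X) (fd_phi_pi X) (@fd_lift X) id r le_jn.
have : ghost pi Q W j = iter j phi r *: ghost pi Q (@wvar R n) j := WE.
rewrite {1}/ghost (bigD1 (Ordinal lt_j)) //= subnn expn0 expr1; set s := \sum_(i < _ | _) _.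
move/(canRL (addrK _)) => Wj; apply: (@pdvd_unscale X _ j).
have le_jK : (j <= K)%N by rewrite (leq_trans le_jn).
rewrite subnKC // Wj; apply: pdvdB; first by rewrite phi_r -scalerA; exists (iter j phi r' *: ghost pi Q (@wvar R n) j).
apply: pdvd_sum => i; rewrite -val_eqE /= => /andP[le_ij ne_ij].
have lt_ij : (i < j)%N by rewrite ltn_neqAle ne_ij.
have Wi := pdvd_exp (Q ^ (j - i)) (IHj i lt_ij (ltn_ord i)).
have := pdvd_scale i Wi; rewrite (_ : Ordinal (ltn_ord i) = i); last exact: val_inj.
apply: pdvdW; rewrite -{1}(subnKC (leq_trans le_ij le_jK)) leq_add2l leq_pmulr //.
by rewrite expQ expn_gt0 p_gt0.
Qed.

End WittOperations.

(** * The ghost map as a matrix *)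

Section GhostMatrix.

Variable X : frob_dvr.
Local Notation R := (fd_ring X).
Local Notation p := (fd_p X).
Local Notation e := (fd_e X).
Local Notation pi := (fd_pi X).
Local Notation Q := (p ^ e)%N.
Local Notation S := (tps (pchar_K X)).
Local Notation C := (@tpsC _ _ (pchar_K X)).
Local Notation tau := (tau (pchar_K X)).
Local Notation piK := (piK X).

(** Row l is the ghost component w_l. An additive series given by the row g in ghost coordinates is
    [g *m ghost_mx n] in the coordinates x_k. *)
Definition ghost_mx n : 'M[S]_n.+1 :=
  \matrix_(l, i) if (i <= l)%N then C (piK ^ i) * tau (e * (l - i)) else 0.

Definition row_mx n N (F : 'I_n -> {mpoly R[N]}) : 'M[S]_(n, N) :=
  \matrix_(j, k) row (F j) k.

Lemma ghost_mxP n N (F : 'I_n.+1 -> {mpoly R[N]}) (l : 'I_n.+1) k :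
  (ghost_mx n *m row_mx F) l k = row (ghost pi Q F l) k.
Proof.
rewrite mxE row_sum [RHS]big_mkcond; apply: eq_bigr => i _; rewrite !mxE.
case: ifP => _; last by rewrite mul0r.
by rewrite rowZ expQ row_exp tofracXn mulrA.
Qed.

Lemma mul_row_mx_coef n N (u : 'rV[S]_n) (F : 'I_n -> {mpoly R[N]}) l s :
  (u *m row_mx F) 0 l s = \sum_j (u 0 j * row (F j) l) s.
Proof.
have uE : (u *m row_mx F) 0 l = \sum_j u 0 j * row (F j) l.
  by rewrite [LHS]mxE; apply: eq_bigr => j _; rewrite [X in _ * X]mxE.
exact: etrans (congr1 (fun z : S => z s) uE) (tps_sum _ _ _ _).
Qed.

Lemma row_mx_vars n : row_mx (@wvar R n) = 1%:M.
Proof.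
by apply/matrixP => j k; rewrite !mxE row_X; case: eqP.
Qed.

Lemma row_ghost_vars n (l k : 'I_n.+1) :
  row (ghost pi Q (@wvar R n) l) k = ghost_mx n l k.
Proof. by rewrite -ghost_mxP row_mx_vars mulmx1. Qed.

(** Triangularity: pi^j F_j is the ghost component minus multiples of p-power powers of earlier F_i,
    and cancelling pi^j does not change the monomials. *)
Lemma ghost_add_poly n N (F : 'I_n.+1 -> {mpoly R[N]}) :
  (forall l, (l <= n)%N -> add_poly (ghost pi Q F l)) -> forall j, add_poly (F j).
Proof.
move=> FA [j lt_j]; elim/ltn_ind: j lt_j => j IHj lt_j.
apply: (@add_poly_unscale _ _ (pi ^+ j)); first by rewrite expf_neq0 ?pi_neq0.
have := FA j lt_j; rewrite /ghost (bigD1 (Ordinal lt_j)) //= subnn expn0 expr1.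
set s := \sum_(i < _ | _) _ => gA; rewrite -(addrK s (_ *: _)); apply: add_polyB gA _.
apply: add_poly_sum => i; rewrite -val_eqE /= => /andP[le_ij ne_ij].
apply: add_polyZ; rewrite expQ; apply: add_poly_exp.
have := IHj i _ (ltn_ord i); rewrite (_ : Ordinal (ltn_ord i) = i); last exact: val_inj.
by apply; rewrite ltn_neqAle ne_ij.
Qed.

Lemma ghost_vars_add_poly n l : add_poly (ghost pi Q (@wvar R n) l).
Proof.
apply: add_poly_sum => i _; apply: add_polyZ; rewrite expQ.
exact/add_poly_exp/add_poly_X.
Qed.

Lemma tpsC_pi_unit (k : nat) : C (piK ^ k) * C (piK ^ (- k%:Z)) = 1.
Proof. by rewrite -rmorphM -expfzDr ?piK_neq0 // subrr expr0z rmorph1. Qed.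

Lemma ghost_mx_diag n k : ghost_mx n k k = C (piK ^ k).
Proof. by rewrite mxE leqnn subnn muln0 tau0 mulr1. Qed.

(** The matrix is triangular and its diagonal entries pi^k are invertible over K. Here and in
    [ghost_mx_solve] the columns are treated from the last to the first, [d] counting those done. *)
Lemma ghost_mx_inj n (g : 'rV[S]_n.+1) : g *m ghost_mx n = 0 -> g = 0.
Proof.
move=> gG0; suff g0 d : forall k : 'I_n.+1, (n - k < d)%N -> g 0 k = 0.
  by apply/rowP => k; rewrite mxE; apply: (g0 n.+1); rewrite ltnS leq_subr.
elim: d => // d IHd k le_kd; have /matrixP/(_ 0 k) := gG0; rewrite !mxE (bigD1 k) //=.
rewrite ghost_mx_diag big1 => [|l ne_lk]; last first.
  rewrite [ghost_mx _ _ _]mxE; case: ifP => [le_kl|_]; last by rewrite mulr0.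
  rewrite IHd ?mul0r //; have := ltn_ord l; have := ltn_ord k.
  by move: ne_lk; rewrite -val_eqE /=; lia.
by rewrite addr0 => gk; rewrite -[g 0 k]mulr1 -(tpsC_pi_unit k) mulrA gk mul0r.
Qed.

Lemma ghost_mx_solve n (T : 'rV[S]_n.+1) : exists g, T = g *m ghost_mx n.
Proof.
suff H d : exists g : 'rV_n.+1, forall k : 'I_n.+1, (n - k < d)%N ->
    (g *m ghost_mx n) 0 k = T 0 k.
  by have [g gP] := H n.+1; exists g; apply/rowP => k; rewrite gP // ltnS leq_subr.
elim: d => [|d [g gP]]; first by exists 0.
have [le_dn|lt_nd] := leqP d n; last first.
  exists g => k _; apply: gP; apply: leq_ltn_trans lt_nd; exact: leq_subr.
have lt_k0 : (n - d < n.+1)%N by rewrite ltnS leq_subr.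
pose k0 := Ordinal lt_k0; pose c := (T 0 k0 - (g *m ghost_mx n) 0 k0) * C (piK ^ (- k0%:Z)).
exists (g + c *: delta_mx 0 k0) => k; rewrite ltnS => le_kd.
rewrite mulmxDl -scalemxAl -rowE [LHS]mxE [X in _ + X]mxE [X in _ * X]mxE.
have [->|ne_k] := eqVneq k k0.
  rewrite ghost_mx_diag /c -mulrA; have := tpsC_pi_unit k0.
  by rewrite -rmorphM mulrC rmorphM => ->; rewrite mulr1 addrC subrK.
rewrite [ghost_mx n k0 k]mxE ifF; last first.
  by apply/negbTE; move: ne_k; rewrite -val_eqE /=; have := ltn_ord k; lia.
rewrite mulr0 addr0; apply: gP.
by move: ne_k; rewrite -val_eqE /=; have := ltn_ord k; lia.
Qed.

Definition scale_row n (g : 'rV[S]_n.+1) (F : nat -> S) : 'rV[S]_n.+1 :=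
  \row_l (g 0 l * F l).

Lemma scale_row_mul n (g : 'rV[S]_n.+1) F k :
  (scale_row g F *m ghost_mx n) 0 k = \sum_l g 0 l * F l * ghost_mx n l k.
Proof. by rewrite [LHS]mxE; apply: eq_bigr => l _; rewrite [X in X * _]mxE. Qed.

Lemma scale_row_coef n (g : 'rV[S]_n.+1) F k s :
  (scale_row g F *m ghost_mx n) 0 k s = \sum_l (g 0 l * F l * ghost_mx n l k) s.
Proof. exact: etrans (congr1 (fun z : S => z s) (scale_row_mul g F k)) (tps_sum _ _ _ _). Qed.

End GhostMatrix.

(** * The Frobenius of Witt vectors in ghost coordinates *)

Section FrobeniusPolynomials.

Variables (X : frob_dvr) (n : nat).
Local Notation p := (fd_p X).
Local Notation e := (fd_e X).
Local Notation F := (frob_poly (fd_pi X) (p ^ e) n).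

Let ghost_frob l : (l <= n)%N ->
  ghost (fd_pi X) (p ^ e) F l = ghost (fd_pi X) (p ^ e) (@wvar (fd_ring X) n.+1) l.+1.
Proof.
exact: (ghost_unghostF (fd_pchar X) (fd_e_gt0 X) (fd_phi_pi X) (@fd_lift X) id).
Qed.

Lemma frob_add_poly j : add_poly (F j).
Proof.
apply: ghost_add_poly j => l le_ln; rewrite ghost_frob //.
exact: ghost_vars_add_poly.
Qed.

(** As [lift ord0 l] is l + 1, this is the identity w_l(F) = w_(l+1). *)
Lemma frob_mxP (l : 'I_n.+1) k :
  (ghost_mx X n *m row_mx F) l k = ghost_mx X n.+1 (lift ord0 l) k.
Proof.
rewrite ghost_mxP ghost_frob; last by rewrite -ltnS.
by rewrite -row_ghost_vars.
Qed.

End FrobeniusPolynomials.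

(** * The action of E on jets *)

Section Jets.

Variables (X : frob_dvr) (n h : nat).
Hypothesis h_gt0 : (0 < h)%N.
Variable b : nat -> fd_ring X.
Local Notation R := (fd_ring X).
Local Notation K := {fraction R}.
Local Notation p := (fd_p X).
Local Notation e := (fd_e X).
Local Notation pi := (fd_pi X).
Local Notation phi := (fd_phi X).
Local Notation Q := (p ^ e)%N.
Local Notation q := (p ^ h)%N.
Local Notation S := (tps (pchar_K X)).
Local Notation C := (@tpsC _ _ (pchar_K X)).
Local Notation tau := (tau (pchar_K X)).
Local Notation phiS := (@tps_map K p (pchar_K X) (@phiK X)).

Lemma expq i : (q ^ i = p ^ (h * i))%N. Proof. by rewrite expnM. Qed.
Lemma expq_gt0 i : (0 < q ^ i)%N. Proof. by rewrite expq expn_gt0 p_gt0. Qed.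

(* The image of b in R{tau_q}^ in K{{tau_p}}, where q = p^h. *)
Definition tps_of_seq : S := fun s => if (h %| s)%N then tofrac (b (s %/ h)%N) else 0.
(** The partial sums are kept apart from their limit because only they act on Witt vectors over
    polynomial rings. *)
Definition tps_trunc M : S := \sum_(i < M) C (tofrac (b i)) * tau (h * i).

Lemma tps_truncE M s : (s < M)%N -> tps_trunc M s = tps_of_seq s.
Proof.
move=> lt_sM; rewrite /tps_trunc tps_sum /tps_of_seq.
under eq_bigr do rewrite tpsCM tauE.
case: ifP => [/dvdnP[i sE]|s_nh]; last first.
  rewrite big1 // => i _; case: eqP => [sE|_]; last by rewrite mulr0.
  by rewrite sE dvdn_mulr in s_nh.
have lt_iM : (i < M)%N by apply: leq_ltn_trans lt_sM; rewrite sE leq_pmulr.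
rewrite (bigD1 (Ordinal lt_iM)) //= sE mulnK // mulnC eqxx mulr1.
rewrite big1 ?addr0 // => j; rewrite -val_eqE /= eqn_pmul2l // eq_sym => /negPf->.
by rewrite mulr0.
Qed.

Definition jet_term i : {ffun 'I_n.+1 -> {mpoly R[n.+1]}} :=
  wscale pi Q phi (b i) (wexp pi Q [ffun j => @wvar R n j] (q ^ i)).
Definition jet_poly M (j : 'I_n.+1) := \sum_(i < M) jet_term i j.

Lemma jet_partial_sum (B : comAlgType R) (x : {ffun 'I_n.+1 -> B}) M :
  \big[wadd pi Q (n := n)/[ffun=> 0]]_(i < M)
     wscale pi Q phi (b i) (wexp pi Q x (q ^ i)) =
  [ffun j => peval x (jet_poly M j)].
Proof.
have termE i j : peval x (jet_term i j) = wscale pi Q phi (b i) (wexp pi Q x (q ^ i)) j.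
  have -> : peval x (jet_term i j) = wpeval x (jet_term i) j by rewrite [RHS]ffunE.
  rewrite wpeval_scale wpeval_exp ?expq_gt0 //; congr (wscale _ _ _ _ (wexp _ _ _ _) _).
  by apply/ffunP => l; rewrite !ffunE pevalXU.
apply/ffunP => j; rewrite ffunE peval_sum.
under [RHS]eq_bigr do rewrite termE.
apply: (big_ind2 (fun (y : {ffun 'I_n.+1 -> B}) z => y j = z)) => //; first by rewrite ffunE.
by move=> y1 z1 y2 z2 <- <-; rewrite waddE ffunE.
Qed.

Lemma jet_term_pdvd (k : nat) i j :
  divides (pi ^+ (k + n)) (b i) -> pdvd k (jet_term i j).
Proof.
move=> /(wscale_poly_pdvd j (leq_addl k n)) /(@pdvdW _ _ k); rewrite /jet_term ffunE.
case; first by have := ltn_ord j; lia.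
by move=> g ->; rewrite pevalZ; eexists.
Qed.

(** A scalar divisible by pi^(k+n) has component j divisible by pi^(k+n-j), and j is at most n. *)
Lemma jet_poly_stable k : null_seq pi b ->
  exists M0, forall M j, (M0 <= M)%N -> pdvd k (jet_poly M j - jet_poly M0 j).
Proof.
move=> /(_ (k + n)%N)[M0 b_k]; exists M0 => M j /subnK <-.
elim: (M - M0)%N => [|d IHd]; first by rewrite subrr; apply: pdvd0.
rewrite addSn /jet_poly big_ord_recr /= addrAC; apply: pdvdD => //.
by apply/jet_term_pdvd/b_k; rewrite leq_addl.
Qed.

Let ghost_jet M l : (l <= n)%N -> ghost pi Q (jet_poly M) l =
  \sum_(i < M) iter l phi (b i) *: ghost pi Q (@wvar R n) l ^+ (p ^ (h * i)).
Proof.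
move=> le_ln; rewrite (ghost_sum M (fun i j => jet_term i j)); apply: eq_bigr => i _.
have gvarE : ghost pi Q [ffun j => @wvar R n j] l = ghost pi Q (@wvar R n) l.
  by apply: eq_ghost => j; rewrite ffunE.
have := ghost_wscale (b i) (wexp pi Q [ffun j => @wvar R n j] (q ^ i)) le_ln.
rewrite (ghost_wexp _ (expq_gt0 i) le_ln) gvarE -/(jet_term i) => wE.
by rewrite -expq -wE.
Qed.

Lemma jet_add_poly M j : add_poly (jet_poly M j).
Proof.
apply: ghost_add_poly j => l le_ln; rewrite ghost_jet //.
apply: add_poly_sum => i _; apply: add_polyZ; apply: add_poly_exp.
exact: ghost_vars_add_poly.
Qed.

(** Ghost coordinates diagonalize the action: on W_n(B) the scalar b_i acts on the component l as
    phi^l(b_i), and the q^i-th power acts componentwise. *)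
Lemma jet_mxP M (l k : 'I_n.+1) :
  (ghost_mx X n *m row_mx (jet_poly M)) l k =
  iter l phiS (tps_trunc M) * ghost_mx X n l k.
Proof.
rewrite ghost_mxP ghost_jet -1?ltnS // row_sum.
have -> : iter l phiS (tps_trunc M) = \sum_(i < M) C (tofrac (iter l phi (b i))) * tau (h * i).
  elim: (l : nat) => //= l' ->; rewrite rmorph_sum; apply: eq_bigr => i _ /=.
  by rewrite [LHS]rmorphM /= tps_mapC tps_map_tau; congr (C _ * _); apply: phiK_tofrac.
rewrite mulr_suml; apply: eq_bigr => i _.
by rewrite rowZ row_exp row_ghost_vars mulrA.
Qed.

Lemma mul_jet_mx M (g : 'rV[S]_n.+1) :
  g *m ghost_mx X n *m row_mx (jet_poly M) =
  scale_row g (fun l => iter l phiS (tps_trunc M)) *m ghost_mx X n.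
Proof.
rewrite -mulmxA; apply/rowP => k; rewrite [RHS]scale_row_mul [LHS]mxE.
by apply: eq_bigr => l _; rewrite jet_mxP mulrA.
Qed.

(** Coefficient s of a product sees only terms of degree at most s, so a partial sum of more than s
    terms already gives the exact value. *)
Lemma coef_mul_trunc (u w : S) l M s : (s < M)%N ->
  (u * iter l phiS (tps_trunc M) * w) s = (u * iter l phiS tps_of_seq * w) s.
Proof.
move=> lt_sM; rewrite !tpsM; apply: eq_bigr => i _; congr (_ * _).
rewrite !tpsM; apply: eq_bigr => j _; congr (_ * frobn _ _ _).
rewrite !iter_phiS tps_truncE //; apply: leq_ltn_trans lt_sM.
by rewrite (leq_trans (leq_subr _ _)) // -ltnS.
Qed.

Lemma coef_mul_jet_mx M (g : 'rV[S]_n.+1) k s : (s < M)%N ->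
  (g *m ghost_mx X n *m row_mx (jet_poly M)) 0 k s =
  (scale_row g (fun l => iter l phiS tps_of_seq) *m ghost_mx X n) 0 k s.
Proof.
move=> lt_sM; rewrite mul_jet_mx.
apply: etrans (scale_row_coef g (fun l => iter l phiS (tps_trunc M)) k s) _.
apply: etrans (esym (scale_row_coef g (fun l => iter l phiS tps_of_seq) k s)).
by apply: eq_bigr => l _; apply: coef_mul_trunc.
Qed.

End Jets.

(** * Characters and logarithms *)

Section TestAlgebra.

Variables (X : frob_dvr) (N k : nat).
Local Notation R := (fd_ring X).
Local Notation P := {mpoly R[N]}.

(** The generic point of the quotient turns identities between values into congruences between
    polynomials. The exponent k + 1 keeps the quotient nonzero. *)
Definition pi_ideal : {pred P} := fun f => `[< pdvd k.+1 f >].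

Lemma pi_idealP f : reflect (pdvd k.+1 f) (f \in pi_ideal).
Proof. exact: asboolP. Qed.

Fact pi_ideal_closed : idealr_closed pi_ideal.
Proof.
split; first by apply/pi_idealP/pdvd0.
  apply/negP => /pi_idealP/(pdvd_coef 0%MM); rewrite mcoeff1 eqxx => -[y].
  rewrite exprS -mulrA => y1; have [_ /negP pi_nunit _ _] := fd_dvr X.
  by apply/pi_nunit/unitrPr; exists (fd_pi X ^+ k * y).
move=> a u v /pi_idealP uk /pi_idealP vk; apply/pi_idealP; apply: pdvdD => //.
by rewrite mulrC; apply: pdvdM.
Qed.

HB.instance Definition _ := isIdealr.Build P pi_ideal pi_ideal_closed.

Definition test_alg := {ideal_quot pi_ideal}.
HB.instance Definition _ := GRing.ComNzRing.on test_alg.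

Definition test_proj : P -> test_alg := \pi_test_alg%qT.

Fact test_proj_zmod_morphism : zmod_morphism test_proj.
Proof. exact: rmorphB. Qed.
Fact test_proj_monoid_morphism : monoid_morphism test_proj.
Proof. by split=> [|x y]; [apply: rmorph1 | apply: rmorphM]. Qed.
HB.instance Definition _ :=
  GRing.isZmodMorphism.Build P test_alg test_proj test_proj_zmod_morphism.
HB.instance Definition _ :=
  GRing.isMonoidMorphism.Build P test_alg test_proj test_proj_monoid_morphism.

Definition test_scale (c : R) (x : test_alg) : test_alg := test_proj c%:MP * x.

Fact test_scaleA a b x : test_scale a (test_scale b x) = test_scale (a * b) x.
Proof. by rewrite /test_scale mpolyCM rmorphM mulrA. Qed.
Fact test_scale1 : left_id 1 test_scale.
Proof. by move=> x; rewrite /test_scale mpolyC1 rmorph1 mul1r. Qed.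
Fact test_scaleDr : right_distributive test_scale +%R.
Proof. by move=> c x y; rewrite /test_scale mulrDr. Qed.
Fact test_scaleDl x : {morph test_scale^~ x : a b / a + b}.
Proof. by move=> a b; rewrite /test_scale mpolyCD rmorphD mulrDl. Qed.

HB.instance Definition _ := GRing.Zmodule_isLmodule.Build R test_alg
  test_scaleA test_scale1 test_scaleDr test_scaleDl.

Fact test_scaleAl (a : R) (x y : test_alg) : a *: (x * y) = a *: x * y.
Proof. exact: mulrA. Qed.

HB.instance Definition _ := GRing.Lmodule_isLalgebra.Build R test_alg test_scaleAl.
HB.instance Definition _ := GRing.Lalgebra_isComAlgebra.Build R test_alg.

Lemma test_projZ c f : test_proj (c *: f) = c *: test_proj f.
Proof. by rewrite -mul_mpolyC rmorphM. Qed.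

Lemma test_proj0P f : test_proj f = 0 <-> pdvd k.+1 f.
Proof.
rewrite -(rmorph0 test_proj); split=> [/eqP|fk]; last apply/eqP.
  by rewrite /test_proj -Quotient.idealrBE subr0 => /pi_idealP.
by rewrite /test_proj -Quotient.idealrBE subr0; apply/pi_idealP.
Qed.

Lemma test_alg_nilpotent : pi_nilpotent (fd_pi X) test_alg.
Proof.
exists k.+1; rewrite -(rmorph1 test_proj) -test_projZ; apply/test_proj0P.
by exists 1.
Qed.

Lemma peval_test_proj M (y : 'I_M -> P) (f : {mpoly R[M]}) :
  peval (fun i => test_proj (y i)) f = test_proj (peval y f).
Proof.
elim/mpolyind: f => [|c m f _ _ IHf]; first by rewrite !peval0 rmorph0.
rewrite !pevalD !pevalZ IHf !pevalXm rmorphD /= test_projZ rmorph_prod.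
congr (_ *: _ + _); apply: eq_bigr => i _.
by rewrite rmorphXn.
Qed.

End TestAlgebra.

Lemma eventual_valueE T (u : nat -> T) v N :
  (forall M, (N <= M)%N -> u M = v) -> eventual_value u = v.
Proof.
move=> uv; have [N' uN'] : exists N, forall M, (N <= M)%N -> u M = eventual_value u.
  by rewrite /eventual_value; apply: (ClassicalEpsilon.epsilon_spec (inhabits (u 0%N))
    (fun v => exists N, forall M, (N <= M)%N -> u M = v)); exists v, N.
by rewrite -(uN' (maxn N N')) ?leq_maxr // uv ?leq_maxl.
Qed.

(** * Evaluation of restricted series by truncation *)

Section SeriesEvaluation.

Variables (X : frob_dvr) (n : nat).
Local Notation R := (fd_ring X).
Local Notation p := (fd_p X).
Local Notation pi := (fd_pi X).
Local Notation S := (tps (pchar_K X)).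
Local Notation fr := (frobn (pchar_K X)).
Implicit Types Th : pseries R n.

Definition trunc Th d : {mpoly R[n.+1]} := \sum_(m : 'X_{1..n.+1 < d}) Th m *: 'X_[m].

Lemma trunc_coef Th d m : (mdeg m < d)%N -> (trunc Th d)@_m = Th m.
Proof. exact: mcoeff_mpoly. Qed.

(** The coefficients in degree at least d0 are divisible by pi^k, hence act as 0. The bound depends
    on k alone, uniformly in the algebra and the point. *)
Lemma series_evalE Th (k : nat) : restricted pi Th -> exists d0, forall d, (d0 <= d)%N ->
  forall (B : comAlgType R) (x : {ffun 'I_n.+1 -> B}), pi ^+ k *: (1 : B) = 0 ->
  series_eval Th x = peval x (trunc Th d).
Proof.
move=> /(_ k)[d0 Th_k]; exists d0 => d le_d B x Bk.
have evalE d' : \sum_(m : 'X_{1..n.+1 < d'}) Th m *: mmap1 x m = peval x (trunc Th d').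
  by rewrite peval_sum; apply: eq_bigr => m _; rewrite pevalZ /peval mmapX.
apply: (@eventual_valueE _ _ _ d0) => d' le_d'; rewrite evalE; apply/eqP.
rewrite -subr_eq0 -scaleN1r -pevalZ -pevalD scaleN1r; apply/eqP.
apply: (pdvd_peval _ Bk); apply: pdvd_mcoeff => m; rewrite mcoeffB.
have coefE d1 : (trunc Th d1)@_m = if (mdeg m < d1)%N then Th m else 0.
  case: ifP => [/trunc_coef //|lt_m]; rewrite raddf_sum big1 // => m' _ /=.
  rewrite mcoeffZ mcoeffX; case: eqP => [m'm|_]; last by rewrite mulr0.
  by rewrite -m'm bmdeg in lt_m.
have Th_m d1 : (d0 <= d1)%N -> ~~ (mdeg m < d1)%N -> divides (pi ^+ k) (Th m).
  by move=> le1; rewrite -leqNgt => le2; apply: Th_k; apply: leq_trans le1 le2.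
have d0' : divides (pi ^+ k) 0 by exists 0; rewrite mulr0.
rewrite !coefE; case: (ltnP _ d') => lt1; case: (ltnP _ d) => lt2; rewrite ?subrr ?subr0 ?sub0r //.
  by apply: (Th_m d) => //; rewrite -leqNgt.
have [y ->] : divides (pi ^+ k) (Th m) by apply: (Th_m d') => //; rewrite -leqNgt.
by exists (- y); rewrite mulrN.
Qed.

Definition add_series Th := forall m, Th m <> 0 -> exists k s, m = mono X k s.
Definition row_series Th : 'rV[S]_n.+1 := \row_k (fun s => tofrac (Th (mono X k s))).

Lemma truncE Th d : add_series Th ->
  trunc Th d = \sum_k \sum_(s < d | (p ^ s < d)%N) Th (mono X k s) *: 'X_k ^+ (p ^ s).
Proof.
move=> ThA; apply/mpolyP => m; rewrite !raddf_sum /=.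
have monoXE k s : 'X_k ^+ (p ^ s) = 'X_[mono X k s] :> {mpoly R[n.+1]} by rewrite mpolyXn.
have rhsE : \sum_(k < n.+1) (\sum_(s < d | (p ^ s < d)%N) Th (mono X k s) *: 'X_k ^+ (p ^ s))@_m =
    \sum_(k < n.+1) \sum_(s < d | (p ^ s < d)%N) Th (mono X k s) * (mono X k s == m)%:R.
  apply: eq_bigr => k _; rewrite raddf_sum; apply: eq_bigr => s _ /=.
  by rewrite monoXE mcoeffZ mcoeffX.
rewrite {}rhsE; have -> : \sum_(m' : 'X_{1..n.+1 < d}) (Th m' *: 'X_[m'])@_m =
    if (mdeg m < d)%N then Th m else 0.
  rewrite -(raddf_sum (mcoeff m)) /=; case: ifP => [/mcoeff_mpoly //|lt_m].
  rewrite raddf_sum big1 // => m' _ /=.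
  rewrite mcoeffZ mcoeffX; case: eqP => [m'm|_]; last by rewrite mulr0.
  by rewrite -m'm bmdeg in lt_m.
have [[k [s ->]]|m_n] := pselect (exists k s, m = mono X k s); last first.
  rewrite (_ : Th m = 0) ?if_same; last by apply: contrapT => /ThA.
  rewrite big1 // => k _; rewrite big1 // => s _; case: eqP => [mE|_]; last by rewrite mulr0.
  by case: m_n; exists k, s.
rewrite mdeg_mono (bigD1 k) //= [X in _ + X]big1 ?addr0 => [|l ne_lk]; last first.
  rewrite big1 // => t _; case: eqP => [/mono_inj[lk]|_]; last by rewrite mulr0.
  by rewrite lk eqxx in ne_lk.
case: ifP => [lt_sd|ge_sd].
  have lt_sd' : (s < d)%N by apply: leq_trans lt_sd; rewrite ltnS ltnW // ltn_expl ?p_gt1.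
  rewrite (bigD1 (Ordinal lt_sd')) //= eqxx mulr1 big1 ?addr0 // => t.
  rewrite -val_eqE /= => /andP[_ ne_ts]; case: eqP => [/mono_inj[_ ts]|_]; last by rewrite mulr0.
  by rewrite ts eqxx in ne_ts.
rewrite big1 // => t lt_t; case: eqP => [/mono_inj[_ ts]|_]; last by rewrite mulr0.
by rewrite ts ge_sd in lt_t.
Qed.

Lemma trunc_add_poly Th d N (F : 'I_n.+1 -> {mpoly R[N]}) : add_series Th ->
  (forall j, add_poly (F j)) -> add_poly (peval F (trunc Th d)).
Proof.
move=> ThA FA; rewrite truncE // peval_sum; apply: add_poly_sum => k _.
rewrite peval_sum; apply: add_poly_sum => s _; rewrite pevalZ pevalX pevalXU.
by apply: add_polyZ; apply: add_poly_exp.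
Qed.

Lemma peval_truncD Th d (B : comAlgType R) (x y : 'I_n.+1 -> B) : add_series Th ->
  peval (fun j => x j + y j) (trunc Th d) = peval x (trunc Th d) + peval y (trunc Th d).
Proof.
move=> ThA; rewrite truncE // !peval_sum -big_split; apply: eq_bigr => k _.
rewrite !peval_sum -big_split; apply: eq_bigr => s _.
rewrite !pevalZ !pevalX !pevalXU -!(frobnE (pchar_alg B)) rmorphD.
by rewrite scalerDr.
Qed.

Lemma row_series_null Th k : restricted pi Th -> exists d0, forall j s,
  (d0 <= p ^ s)%N -> vge k (row_series Th 0 j s).
Proof.
move=> ThR; case: k => k; last first.
  exists 0%N => j s _; apply: (@vgeW _ 0) => //; rewrite mxE; exact: vge_tofrac.
have [d0 Th_k] := ThR k; exists d0 => j s le_d.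
by rewrite mxE; apply/vge_divides/Th_k; rewrite mdeg_mono.
Qed.

Lemma row_trunc_coef Th d N (F : 'I_n.+1 -> {mpoly R[N]}) l s : add_series Th ->
  row (peval F (trunc Th d)) l s =
  \sum_j \sum_(t < s.+1 | (p ^ t < d)%N) row_series Th 0 j t * fr t (row (F j) l (s - t)%N).
Proof.
move=> ThA; rewrite truncE // peval_sum row_sum tps_sum; apply: eq_bigr => j _.
rewrite peval_sum row_sum tps_sum.
have termE t : row (peval F (Th (mono X j t) *: 'X_j ^+ (p ^ t))) l s =
    if (t <= s)%N then row_series Th 0 j t * fr t (row (F j) l (s - t)%N) else 0.
  rewrite pevalZ pevalX pevalXU rowZ row_exp tpsCM tau_mul_tps [row_series _ _ _]mxE.
  by case: ifP => _; rewrite ?mulr0.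
under eq_bigr do rewrite termE; rewrite -big_mkcondr /=.
have lt_expd t : (p ^ t < d)%N -> (t < d)%N.
  by move=> lt_t; apply: leq_ltn_trans lt_t; rewrite ltnW // ltn_expl ?p_gt1.
pose G t := row_series Th 0 j t * fr t (row (F j) l (s - t)%N).
rewrite (big_ord_widen_cond (maxn d s.+1) (fun t => (p ^ t < d)%N && (t <= s)%N) G) ?leq_maxl //.
rewrite (big_ord_widen_cond (maxn d s.+1) (fun t => (p ^ t < d)%N) G) ?leq_maxr //.
apply: eq_bigl => t; rewrite ltnS.
by case: (ltnP (p ^ t) d) => [/lt_expd->|]; rewrite ?andbT.
Qed.

Lemma row_trunc_exact Th d N (F : 'I_n.+1 -> {mpoly R[N]}) l s : add_series Th ->
  (p ^ s < d)%N -> row (peval F (trunc Th d)) l s = (row_series Th *m row_mx F) 0 l s.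
Proof.
move=> ThA lt_sd; apply: etrans (row_trunc_coef d F l s ThA) _.
apply: etrans (esym (mul_row_mx_coef _ _ _ _)); apply: eq_bigr => j _; rewrite tpsM.
apply: eq_bigl => t; apply: leq_ltn_trans lt_sd.
by rewrite leq_exp2l ?p_gt1 // -ltnS.
Qed.

(** Truncation drops only the coefficients at x_j^(p^t) with p^t >= d, and these are divisible by
    pi^k. *)
Lemma row_trunc Th (k : nat) : restricted pi Th -> add_series Th ->
  exists d0, forall d, (d0 <= d)%N -> forall N (F : 'I_n.+1 -> {mpoly R[N]}) l s,
  vge k (row (peval F (trunc Th d)) l s - (row_series Th *m row_mx F) 0 l s).
Proof.
move=> ThR ThA; have [d0 d0P] := row_series_null k ThR; exists d0 => d le_d N F l s.
pose w := (row_series Th *m row_mx F) 0 l s; rewrite -/w.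
have -> : w = \sum_j (row_series Th 0 j * row (F j) l) s := mul_row_mx_coef _ _ _ _.
rewrite row_trunc_coef // -sumrB; apply: vge_sum => j _.
have F_int t : vge 0 (row (F j) l t) by apply: vge_tofrac.
rewrite tpsM [X in _ - X](bigID (fun t : 'I_s.+1 => (p ^ t < d)%N)) /=.
rewrite opprD addrA subrr sub0r; apply: vgeN; apply: vge_sum => t; rewrite -leqNgt => le_dt.
rewrite -[k%:Z]addr0; apply: vgeM; last exact: (@vge_frob _ 0%N).
by apply: d0P; apply: leq_trans le_d le_dt.
Qed.

End SeriesEvaluation.

(** * Additive series only involve monomials x_k^(p^s) *)

Section CharacterLog.

Variables (X : frob_dvr) (n : nat).
Local Notation R := (fd_ring X).
Local Notation p := (fd_p X).
Local Notation e := (fd_e X).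
Local Notation pi := (fd_pi X).
Local Notation Q := (p ^ e)%N.
Implicit Types Th : pseries R n.

Lemma divides_all (x : R) : (forall k : nat, divides (pi ^+ k.+1) x) -> x = 0.
Proof.
move=> xk; apply/eqP; rewrite -tofrac_eq0; apply/eqP; apply: (@vge_all X) => k.
by apply: (@vgeW _ k.+1); [rewrite lez_nat | apply/vge_divides].
Qed.

Lemma peval_keep N (J : pred 'I_N) (f : {mpoly R[N]}) m :
  (peval (fun j => if J j then 'X_j else 0 : {mpoly R[N]}) f)@_m =
  if [forall j, J j || (m j == 0%N)] then f@_m else 0.
Proof.
elim/mpolyind: f => [|c m' f _ _ IHf]; first by rewrite peval0 mcoeff0 if_same.
rewrite pevalD pevalZ !mcoeffD IHf mcoeffZ pevalXm.
have -> : \prod_i (if J i then 'X_i else 0) ^+ m' i =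
    if [forall j, J j || (m' j == 0%N)] then 'X_[m'] else 0 :> {mpoly R[N]}.
  case: ifPn => [/forallP m'J|].
    rewrite mpolyXE_id; apply: eq_bigr => i _; have := m'J i.
    by case: (J i) => //= /eqP->; rewrite !expr0.
  rewrite negb_forall => /existsP[i]; rewrite negb_or => /andP[/negPf Ji m'i].
  by rewrite (bigD1 i) //= Ji expr0n (negPf m'i) mul0r.
rewrite mcoeffZ mcoeffX.
have [->|ne_m] := eqVneq m' m; first by case: ifP; rewrite ?mcoeffX ?eqxx ?mcoeff0 ?mulr0 ?addr0.
rewrite mulr0 add0r; case: [forall j, J j || (m' j == 0%N)]; last by rewrite mcoeff0 mulr0 add0r.
by rewrite mcoeffX (negPf ne_m) mulr0 add0r.
Qed.

Lemma peval_axis N M (i : 'I_M) (c : {mpoly R[N]}) m t (v : R) :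
    (forall u, (c ^+ u)@_m = if u == t then v else 0) ->
  forall f : {mpoly R[M]},
  (peval (fun j => if j == i then c else 0) f)@_m = f@_(U_(i) *+ t)%MM * v.
Proof.
move=> cP; elim/mpolyind => [|c' m' f _ _ IHf]; first by rewrite peval0 !mcoeff0 mul0r.
rewrite pevalD pevalZ !mcoeffD IHf mulrDl !mcoeffZ pevalXm -mulrA; congr (_ * _ + _).
rewrite mcoeffX; have [m'E|m'N] := eqVneq m' (U_(i) *+ m' i)%MM.
  rewrite (bigD1 i) //= eqxx big1 => [|j /negPf ne_ji]; last first.
    by rewrite ne_ji m'E mulmnE mnm1E eq_sym ne_ji mul0n expr0.
  rewrite mulr1 cP; have [m't|ne_t] := eqVneq (m' i) t.
    by rewrite -m't -m'E eqxx mul1r.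
  case: eqP => [m't|_]; last by rewrite mul0r.
  by rewrite m't mulmnE mnm1E eqxx mul1n eqxx in ne_t.
case: eqP => [m't|_]; first by rewrite m't mulmnE mnm1E eqxx mul1n eqxx in m'N.
have [j ne_ji m'j] : exists2 j, j != i & m' j != 0%N.
  apply: contrapT => no_j; case/eqP: m'N; apply/mnmP => j; rewrite mulmnE mnm1E.
  have [<-|ne_ij] := eqVneq i j; first by rewrite mul1n.
  by apply/eqP/contraT => m'j; case: no_j; exists j; rewrite // eq_sym.
by rewrite (bigD1 j) //= (negPf ne_ji) expr0n (negPf m'j) mul0r mcoeff0 mul0r.
Qed.

Section AdditiveSeries.

Variable Th : pseries R n.
Hypothesis ThR : restricted pi Th.
Hypothesis Th_add : forall B : comAlgType R, pi_nilpotent pi B ->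
  forall x y : {ffun 'I_n.+1 -> B},
    series_eval Th (wadd pi Q x y) = series_eval Th x + series_eval Th y.

(** Additivity on points, applied to the classes of y and z modulo pi^(k+1). *)
Lemma trunc_additive N (y z : 'I_n.+1 -> {mpoly R[N]}) (k : nat) :
  exists d0, forall d, (d0 <= d)%N -> pdvd k.+1
    (peval (fun j => y j + z j) (trunc Th d) -
      (peval y (trunc Th d) + peval z (trunc Th d))).
Proof.
have [d0 d0P] := series_evalE k.+1 ThR; exists d0 => d /d0P evalE.
pose proj (u : 'I_n.+1 -> {mpoly R[N]}) : {ffun 'I_n.+1 -> test_alg X N k} :=
  [ffun j => test_proj k (u j)].
have nilp : pi ^+ k.+1 *: (1 : test_alg X N k) = 0.
  by rewrite -(rmorph1 (test_proj k)) -test_projZ; apply/test_proj0P; exists 1.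
have projE u : series_eval Th (proj u) = test_proj k (peval u (trunc Th d)).
  rewrite evalE // -peval_test_proj; apply: eq_peval => j; exact: ffunE.
have := Th_add (@test_alg_nilpotent X N k) (proj y) (proj z).
rewrite waddE (_ : [ffun j => _] = proj (fun j => y j + z j)) => [|]; last first.
  by apply/ffunP => j; rewrite !ffunE rmorphD.
rewrite !projE => yzE; apply/test_proj0P.
by rewrite rmorphB rmorphD /= yzE subrr.
Qed.

(** A point is the sum of its part in J and its part off J. So a monomial involving both kinds of
    variables has coefficient 0. *)
Let coef_keep (J : pred 'I_n.+1) m :
  Th m = (if [forall j, J j || (m j == 0%N)] then Th m else 0) +
         (if [forall j, ~~ J j || (m j == 0%N)] then Th m else 0).
Proof.
apply/eqP; rewrite -subr_eq0; apply/eqP/divides_all => k.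
have [d0 /(_ (maxn d0 (mdeg m).+1))] := trunc_additive
  (fun j => if J j then 'X_j else 0) (fun j => if ~~ J j then 'X_j else 0) k.
rewrite leq_maxl => /(_ isT)/(pdvd_coef m); rewrite mcoeffB mcoeffD !peval_keep.
rewrite trunc_coef ?leq_maxr //; congr (divides _ (_ - _)).
rewrite -(trunc_coef Th (leq_maxr d0 (mdeg m).+1)); congr (_@_m).
rewrite -[RHS]peval_id; apply: eq_peval => j.
by case: (J j); rewrite ?addr0 ?add0r.
Qed.

(** Put x_i = X + Y and all other variables to 0. As (X + Y)^(N p^s) = (X^(p^s) + Y^(p^s))^N, the
    mixed monomial [m2], X^((N-1) p^s) Y^(p^s), occurs with coefficient N, nonzero in R, whereas
    additivity allows no mixed monomial. *)
Let coef_axis i N s : (0 < N)%N -> ~~ (p %| N)%N -> N != 1%N ->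
  Th (U_(i) *+ (N * p ^ s)%N)%MM = 0.
Proof.
move=> N0 pN N1; pose ps := (p ^ s)%N; have ps0 : (0 < ps)%N by rewrite expn_gt0 p_gt0.
pose i0 : 'I_2 := ord0; pose i1 : 'I_2 := ord_max.
pose m2 : 'X_{1..2} := (U_(i0) *+ (N.-1 * ps)%N + U_(i1) *+ ps)%MM.
have m2_0 : m2 i0 = (N.-1 * ps)%N by rewrite mnmDE !mulmnE !mnm1E mul1n addn0.
have m2_1 : m2 i1 = ps by rewrite mnmDE !mulmnE !mnm1E mul1n.
have m2_deg : mdeg m2 = (N * ps)%N.
  by rewrite mdegD !mdegMn !mdeg1 !mul1n -{2}(prednK N0) mulSnr.
have XXE a b : 'X_i0 ^+ a * 'X_i1 ^+ b = 'X_[U_(i0) *+ a + U_(i1) *+ b] :> {mpoly R[2]}.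
  by rewrite mpolyXD !mpolyXn.
have addP u : (('X_i0 + 'X_i1 : {mpoly R[2]}) ^+ u)@_m2 = if u == (N * ps)%N then N%:R else 0.
  case: eqP => [->|ne_u].
    rewrite mulnC exprM -[_ ^+ ps](frobnE (pchar_mpoly X 2) s) rmorphD /= !frobnE -/ps.
    rewrite exprDn raddf_sum /=.
    have lt1 : (1 < N.+1)%N by [].
    rewrite (bigD1 (Ordinal lt1)) //= big1 ?addr0 => [|j].
      rewrite bin1 expr1 -exprM subn1 XXE mcoeffMn mcoeffX mulnC eqxx //.
    rewrite -val_eqE /= => /eqP ne_j; rewrite -!exprM XXE mcoeffMn mcoeffX.
    case: eqP => [/mnmP/(_ i1)|_]; last by rewrite mul0rn.
    rewrite m2_1 mnmDE !mulmnE !mnm1E mul1n add0n => /eqP.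
    by rewrite -{2}[ps]muln1 eqn_pmul2l // => /eqP.
  rewrite exprDn raddf_sum big1 // => j _ /=; rewrite XXE mcoeffMn mcoeffX.
  case: eqP => [/(congr1 mdeg)|_]; last by rewrite mul0rn.
  rewrite m2_deg mdegD !mdegMn !mdeg1 !mul1n subnK -1?ltnS //.
have axisP (l : 'I_2) u : ('X_l ^+ u : {mpoly R[2]})@_m2 = if u == (N * ps)%N then 0 else 0.
  rewrite if_same mpolyXn mcoeffX; case: eqP => // /mnmP mE.
  have := mE i0; have := mE i1; rewrite m2_0 m2_1 !mulmnE !mnm1E.
  have : (0 < N.-1 * ps)%N by rewrite muln_gt0 ps0 andbT; case: (N) N0 N1 => [|[]].
  have [->|->] : l = i0 \/ l = i1.
  - by case: l {mE} => [[|[|//]] lt_l]; [left | right]; apply: val_inj.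
  - by rewrite !eqxx /= mul0n => _ ps_0; rewrite -ps_0 in ps0.
  - by rewrite !eqxx /= mul0n => + _ N_0; rewrite -N_0.
suff /eqP : Th (U_(i) *+ (N * ps)%N)%MM * N%:R = 0.
  rewrite mulf_eq0 => /orP[/eqP//|/eqP N_0]; case/negP: pN.
  by rewrite (dvdn_pcharf (fd_pchar X)) N_0.
apply: divides_all => k.
have [d0 /(_ (maxn d0 (N * ps).+1))] := trunc_additive
  (fun j => if j == i then 'X_i0 else 0) (fun j => if j == i then 'X_i1 else 0) k.
rewrite leq_maxl => /(_ isT)/(pdvd_coef m2); rewrite mcoeffB mcoeffD.
rewrite !(peval_axis _ (axisP _)) !mulr0 addr0 subr0.
rewrite (eq_peval (y := fun j => if j == i then 'X_i0 + 'X_i1 else 0)) => [|j]; last first.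
  by case: eqP; rewrite ?addr0.
by rewrite (peval_axis _ addP) trunc_coef // mdegMn mdeg1 mul1n leq_maxr.
Qed.

Lemma additive_add_series : add_series Th.
Proof.
move=> m Thm; have [m0|m_neq0] := eqVneq m 0%MM.
  (* For the constant term c, [coef_keep] reads c = c + c. *)
  case: Thm; have := coef_keep predT m.
  do 2![rewrite ifT; last by apply/forallP => j; rewrite m0 mnm0E orbT].
  by move/eqP; rewrite -subr_eq0 opprD addrA subrr sub0r oppr_eq0 => /eqP.
have [i mi] : exists i, m i != 0%N.
  apply: contrapT => no_i; case/eqP: m_neq0; apply/mnmP => i; rewrite mnm0E.
  by apply/eqP/contraT => mi; case: no_i; exists i.
have mE : m = (U_(i) *+ m i)%MM.
  apply/mnmP => j; rewrite mulmnE mnm1E; have [<-|ne_ij] := eqVneq i j; first by rewrite mul1n.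
  apply/eqP/contraT => mj; case: Thm; rewrite (coef_keep (pred1 i) m).
  rewrite !ifF ?addr0 //; apply/negbTE; rewrite negb_forall; apply/existsP.
    by exists i; rewrite /= eqxx.
  by exists j; rewrite /= eq_sym (negPf ne_ij).
have p_pr : prime p := pcharf_prime (fd_pchar X).
have [N pN miE] : exists2 N, coprime p N & m i = (N * p ^ logn p (m i))%N.
  by have [|N] := @pfactor_coprime p (m i) p_pr; [rewrite lt0n | exists N].
exists i, (logn p (m i)); rewrite {1}mE /mono; congr (_ *+ _)%MM.
have [N1|N1] := eqVneq N 1%N; first by rewrite {1}miE N1 mul1n.
case: Thm; rewrite mE miE; apply: coef_axis => //.
  by rewrite lt0n; apply: contraNneq mi => N0; rewrite miE N0.
by rewrite -prime_coprime.
Qed.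

End AdditiveSeries.
End CharacterLog.

(** * From characters to logarithms and back *)

Section LogRepresentation.

Variables (X : frob_dvr) (n h : nat).
Hypothesis h_gt0 : (0 < h)%N.
Variables (A : comNzRingType) (theta : A -> fd_ring X) (E : A -> nat -> fd_ring X).
Hypothesis E_null : forall a, null_seq (fd_pi X) (E a).
Local Notation R := (fd_ring X).
Local Notation K := {fraction R}.
Local Notation p := (fd_p X).
Local Notation e := (fd_e X).
Local Notation pi := (fd_pi X).
Local Notation phi := (fd_phi X).
Local Notation Q := (p ^ e)%N.
Local Notation q := (p ^ h)%N.
Local Notation S := (tps (pchar_K X)).
Local Notation C := (@tpsC _ _ (pchar_K X)).
Local Notation phiS := (@tps_map K p (pchar_K X) (@phiK X)).
Local Notation piK := (piK X).
Local Notation jet := (@jet_poly X n h).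
Implicit Types Th : pseries R n.

Lemma jet_actE (k : nat) a : exists M0, forall M, (M0 <= M)%N ->
  forall (B : comAlgType R) (x : {ffun 'I_n.+1 -> B}), pi ^+ k *: (1 : B) = 0 ->
  jet_act pi q Q phi E a x = [ffun j => peval x (jet (E a) M j)].
Proof.
have [M0 M0P] := jet_poly_stable n h_gt0 k (@E_null a); exists M0 => M le_M B x Bk.
apply: (@eventual_valueE _ _ _ M0) => M' le_M'; rewrite jet_partial_sum //.
apply/ffunP => j; rewrite !ffunE.
have stableE M1 : (M0 <= M1)%N -> peval x (jet (E a) M1 j) = peval x (jet (E a) M0 j).
  move=> /(M0P M1 j)/(pdvd_peval x Bk) /eqP.
  by rewrite -scaleN1r pevalD pevalZ scaleN1r subr_eq0 => /eqP.
by rewrite !stableE.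
Qed.

Lemma row_series_vars Th l s :
  (row_series Th *m row_mx (@wvar R n)) 0 l s = row_series Th 0 l s.
Proof. by rewrite row_mx_vars mulmx1. Qed.

(** Equivariance at the generic point (x_0, ..., x_n) modulo pi^(k+1). *)
Lemma trunc_equivariant Th a (k : nat) : restricted pi Th ->
    (forall B : comAlgType R, pi_nilpotent pi B -> forall x : {ffun 'I_n.+1 -> B},
      series_eval Th (jet_act pi q Q phi E a x) = theta a *: series_eval Th x) ->
  exists M0, forall M d, (M0 <= M)%N -> (M0 <= d)%N ->
    pdvd k.+1 (peval (jet (E a) M) (trunc Th d) - theta a *: trunc Th d).
Proof.
move=> ThR Th_act; have [d0 d0P] := series_evalE k.+1 ThR.
have [M0 M0P] := jet_actE k.+1 a; exists (maxn M0 d0) => M d.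
rewrite !geq_max => /andP[/M0P jetE _] /andP[_ /d0P evalE].
have nilp : pi ^+ k.+1 *: (1 : test_alg X n.+1 k) = 0.
  by rewrite -(rmorph1 (test_proj k)) -test_projZ; apply/test_proj0P; exists 1.
pose x : {ffun 'I_n.+1 -> test_alg X n.+1 k} := [ffun j => test_proj k 'X_j].
have xE f : peval x f = test_proj k f.
  rewrite -[in RHS](peval_id f) -peval_test_proj; apply: eq_peval => j.
  by rewrite ffunE.
apply/test_proj0P; rewrite rmorphB /= test_projZ; apply/eqP; rewrite subr_eq0; apply/eqP.
have := Th_act _ (@test_alg_nilpotent X n.+1 k) x.
rewrite jetE // !evalE // xE => <-; rewrite -peval_test_proj.
by apply: eq_peval => j; rewrite ffunE xE.
Qed.

Definition log_row (L : S) (a : {poly K}) : 'rV[S]_n.+1 :=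
  \row_i (C a`_i * log_twist L i).

Lemma log_rowE L (a : {poly K}) k : (size a <= n.+1)%N ->
  (log_row L a *m ghost_mx X n) 0 k = char_series L k a.
Proof.
move=> le_an; rewrite (char_series_widen _ _ le_an) mxE [RHS]big_mkcond.
apply: eq_bigr => i _; rewrite !mxE; case: ifP => _; last by rewrite mulr0.
by rewrite !mulrA.
Qed.

(** Let g be the row in ghost coordinates. As t acts diagonally there, linearity says that g_l
    Phi^(phi^l) = pi g_l, and uniqueness of the logarithm of the twisted equation gives g_l up to
    its constant coefficient a_l. *)
Lemma row_series_log Th t (L : S) : restricted pi Th -> add_series Th ->
    (forall B : comAlgType R, pi_nilpotent pi B -> forall x : {ffun 'I_n.+1 -> B},
      series_eval Th (jet_act pi q Q phi E t x) = theta t *: series_eval Th x) ->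
    theta t = pi -> tps_of_seq h (E t) 0%N = piK ->
    L 0%N = 1 -> L * tps_of_seq h (E t) = C piK * L ->
  exists2 a : {poly K}, (size a <= n.+1)%N & row_series Th = log_row L a *m ghost_mx X n.
Proof.
move=> ThR ThA Th_act theta_t Phi0 L0 LP; set Phi := tps_of_seq h (E t) in Phi0 LP *.
have [g gE] := ghost_mx_solve (row_series Th).
pose g' := scale_row g (fun l => iter l phiS Phi).
have g'E : g' *m ghost_mx X n = C piK *: (g *m ghost_mx X n).
  apply/rowP => l; rewrite [RHS]mxE -gE; apply/tpsP => s; rewrite tpsCM.
  apply/eqP; rewrite -subr_eq0; apply/eqP; apply: (@vge_all X) => k.
  have [M0 M0P] := trunc_equivariant k ThR Th_act.
  have [d0 d0P] := row_trunc k ThR ThA.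
  (* [d] makes truncation harmless modulo pi^k, and M > s makes the coefficient s of the jet product
     exact. *)
  pose d := maxn M0 d0; pose M := maxn M0 s.+1.
  have /(pdvd_coef (mono X l s)) := M0P M d (leq_maxl _ _) (leq_maxl _ _).
  move/vge_divides; rewrite mcoeffB mcoeffZ tofracB tofracM theta_t.
  pose w := (g' *m ghost_mx X n) 0 l s; pose y := row_series Th 0 l s.
  have JE : (row_series Th *m row_mx (jet (E t) M)) 0 l s = w.
    by rewrite gE; apply: coef_mul_jet_mx => //; apply: leq_maxr.
  have vk : vge k (row (peval (jet (E t) M) (trunc Th d)) l s - w).
    by case: _ / JE; apply: d0P (leq_maxr _ _) _ _ _ _.
  have uk : vge k (row (trunc Th d) l s - y).
    have XE : (row_series Th *m row_mx (@wvar R n)) 0 l s = y.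
      by rewrite /y; apply: row_series_vars.
    rewrite -{1}(peval_id (trunc Th d)); case: _ / XE.
    exact: d0P (leq_maxr _ _) _ _ _ _.
  rewrite /row in uk vk; move: uk vk; set u := tofrac _; set v := tofrac _ => uk vk uvk.
  rewrite -/w -/y.
  have -> : w - piK * y = (v - piK * u) - (v - w) + piK * (u - y) by ring.
  apply: vgeD; first by apply: vgeB vk; apply: vgeW uvk; rewrite lez_nat.
  by rewrite -[k%:Z]add0r; apply: vgeM uk; apply: vge_tofrac.
have g'g : g' = C piK *: g.
  apply/eqP; rewrite -subr_eq0; apply/eqP/ghost_mx_inj.
  by rewrite mulmxBl g'E scalemxAl subrr.
have iterPhi0 l : iter l phiS Phi 0%N = piK.
  by rewrite iter_phiS Phi0; elim: l => //= l ->; apply: phiK_pi.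
exists (\poly_(l < n.+1) g 0 (inord l) 0%N); first exact: size_poly.
rewrite gE; congr (_ *m _); apply/rowP => l; rewrite mxE coef_poly ltn_ord inord_val.
apply: (log_unique (iterPhi0 l)).
- exact: log_twist0.
- exact: log_twistP.
by have /rowP/(_ l) := g'g; rewrite [LHS]mxE [RHS]mxE.
Qed.

(** The same computation backwards, now for every c in A: as phi fixes theta(c), every twist of the
    logarithm turns the twist of phi_E(c) into theta(c). *)
Lemma log_character Th (L : S) (a : {poly K}) : restricted pi Th -> add_series Th ->
    row_series Th = log_row L a *m ghost_mx X n ->
    (forall c, L * tps_of_seq h (E c) = C (tofrac (theta c)) * L) ->
    (forall c, phi (theta c) = theta c) ->
  character pi q Q phi theta E Th.
Proof.
move=> ThR ThA ThE LP phi_theta; split=> // B [k Bk]; split=> [x y|c x].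
  have [d0 /(_ d0 (leqnn _)) evalE] := series_evalE k ThR.
  rewrite !evalE // waddE -peval_truncD //; apply: eq_peval => j.
  by rewrite ffunE.
have [d0 d0P] := series_evalE k ThR; have [d1 d1P] := row_trunc k ThR ThA.
pose d := maxn d0 d1; have evalE := d0P d (leq_maxl _ _).
have [M0 M0P] := jet_actE k c; have [M1 M1P] := jet_poly_stable n h_gt0 k (@E_null c).
pose M2 := maxn M0 M1; rewrite (M0P M2) ?leq_maxl // !evalE //.
pose J := jet (E c) M2.
suff /(pdvd_peval x Bk) : pdvd k (peval J (trunc Th d) - theta c *: trunc Th d).
  rewrite -scaleN1r pevalD !pevalZ scaleN1r => /eqP; rewrite subr_eq0 => /eqP <-.
  by rewrite peval_peval; apply: eq_peval => j; rewrite ffunE.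
have truncA : add_poly (trunc Th d).
  by rewrite -(peval_id (trunc Th d)); apply: trunc_add_poly => //; apply: add_poly_X.
apply: pdvd_add_poly => [|l s].
  apply: add_polyB; last exact: add_polyZ.
  by apply: trunc_add_poly => //; apply: jet_add_poly.
have -> : row (peval J (trunc Th d) - theta c *: trunc Th d) l s =
    row (peval J (trunc Th d)) l s - tofrac (theta c) * row (trunc Th d) l s.
  by rewrite /row mcoeffB mcoeffZ tofracB tofracM.
have rowJ := d1P d (leq_maxr _ _) _ J l s.
pose y := row_series Th 0 l s.
have rowX : vge k (row (trunc Th d) l s - y).
  have XE : (row_series Th *m row_mx (@wvar R n)) 0 l s = y.
    by rewrite /y; apply: row_series_vars.
  rewrite -{1}(peval_id (trunc Th d)); case: _ / XE.
  exact: d1P (leq_maxr _ _) _ _ _ _.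
(* [M2] computes the action modulo pi^k but may be at most s; a longer jet has the exact coefficient
   s, and the two agree modulo pi^k. *)
pose M := maxn M2 s.+1; pose J' := jet (E c) M.
pose w := (row_series Th *m row_mx J) 0 l s.
pose w' := (row_series Th *m row_mx J') 0 l s.
have wE : w = \sum_j (row_series Th 0 j * row (J j) l) s := mul_row_mx_coef _ _ _ _.
have w'E : w' = \sum_j (row_series Th 0 j * row (J' j) l) s := mul_row_mx_coef _ _ _ _.
have JJ' : vge k (w - w').
  rewrite wE w'E -sumrB; apply: vge_sum => j _; rewrite !tpsM -sumrB.
  apply: vge_sum => i _; rewrite -mulrBr -[k%:Z]add0r; apply: vgeM.
    by rewrite mxE; apply: vge_tofrac.
  rewrite -rmorphB /=; apply: vge_frob; rewrite /row -tofracB -mcoeffB.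
  apply/vge_divides/pdvd_coef.
  have -> : J j - J' j = (J j - jet (E c) M1 j) - (J' j - jet (E c) M1 j).
    by rewrite opprB addrA subrK.
  by apply: pdvdB; apply: M1P; rewrite ?leq_max ?leqnn ?orbT.
have scaleE : scale_row (log_row L a) (fun i => iter i phiS (tps_of_seq h (E c))) =
    C (tofrac (theta c)) *: log_row L a.
  apply/rowP => i; rewrite [LHS]mxE [RHS]mxE [log_row _ _ _ _]mxE.
  have tw : log_twist L i * iter i phiS (tps_of_seq h (E c)) = C (tofrac (theta c)) * log_twist L i.
    rewrite /log_twist; elim: (i : nat) => //= i' IHi.
    rewrite -rmorphM IHi rmorphM /= tps_mapC; congr (C _ * _).
    by rewrite -[in RHS]phi_theta; apply: phiK_tofrac.
  by rewrite -mulrA tw !mulrA -!rmorphM mulrC.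
have J'E : w' = tofrac (theta c) * y.
  have w'E1 : w' = (log_row L a *m ghost_mx X n *m row_mx J') 0 l s by rewrite /w' ThE.
  apply: etrans w'E1 (etrans (coef_mul_jet_mx h_gt0 (E c) _ l (leq_maxr M2 s.+1)) _).
  rewrite scaleE -scalemxAl -ThE -tpsCM.
  by rewrite [X in X s = _]mxE.
move: rowJ rowX; rewrite -/w; set u := row _ _ _; set v := row _ _ _.
move=> rowJ rowX; have -> : u - tofrac (theta c) * v =
    (u - w) + (w - w') - tofrac (theta c) * (v - y) by rewrite J'E; ring.
apply: vgeB; first exact: vgeD.
by rewrite -[k%:Z]add0r; apply: vgeM rowX; apply: vge_tofrac.
Qed.

End LogRepresentation.

(** * The dictionary between characters and polynomials *)

Section CharacterRep.

Variable X : frob_dvr.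
Variable L : tps (pchar_K X).
Hypothesis L0 : L 0%N = 1.
Local Notation R := (fd_ring X).
Local Notation K := {fraction R}.
Local Notation p := (fd_p X).
Local Notation e := (fd_e X).
Local Notation pi := (fd_pi X).
Local Notation phi := (fd_phi X).
Local Notation Q := (p ^ e)%N.
Local Notation S := (tps (pchar_K X)).
Local Notation C := (@tpsC _ _ (pchar_K X)).
Local Notation phiK := (@phiK X).
Local Notation phiS := (@tps_map K p (pchar_K X) phiK).
Implicit Types (a b : {poly K}).

(* The series Th is \sum_i a_i log^(phi^i)(w_i). *)
Definition rep n (Th : pseries R n) a :=
  [/\ (size a <= n.+1)%N, add_series Th &
      forall (k : 'I_n.+1) s, row_series Th 0 k s = char_series L k a s].

Lemma rep_row n (Th : pseries R n) a :
  rep Th a -> row_series Th = log_row n L a *m ghost_mx X n.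
Proof.
move=> [a_size _ ThE]; apply/rowP => k; rewrite log_rowE //.
by apply/tpsP => s; apply: ThE.
Qed.

Lemma row_rep n (Th : pseries R n) a : (size a <= n.+1)%N -> add_series Th ->
  row_series Th = log_row n L a *m ghost_mx X n -> rep Th a.
Proof. by move=> a_size ThA ThE; split=> // k s; rewrite ThE log_rowE. Qed.

Lemma rep_coef n (Th : pseries R n) a k s :
  rep Th a -> tofrac (Th (mono X k s)) = char_series L k a s.
Proof. by move=> [_ _ <-]; rewrite mxE. Qed.

Lemma rep_inj n (Th Th' : pseries R n) a : rep Th a -> rep Th' a -> Th =1 Th'.
Proof.
move=> Tha Th'a m; have [[k [s ->]]|m_n] := pselect (exists k s, m = mono X k s).
  by apply/eqP; rewrite -tofrac_eq (rep_coef _ _ Tha) (rep_coef _ _ Th'a).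
have zero (Th1 : pseries R n) : rep Th1 a -> Th1 m = 0.
  by case=> _ Th1A _; apply: contrapT => /Th1A.
by rewrite !zero.
Qed.

Lemma repZ n (Th : pseries R n) a c :
  rep Th a -> rep (fun mu => c * Th mu) (tofrac c *: a).
Proof.
move=> [a_size ThA ThE]; split=> [|m|k s].
- by rewrite (leq_trans (size_scale_leq _ _)).
- by have [->|Thm _] := eqVneq (Th m) 0; [rewrite mulr0 | apply/ThA/eqP].
by rewrite char_seriesZ tpsCM -ThE !mxE tofracM.
Qed.

Lemma rep_in_chars n (Th : pseries R n) a :
  restricted pi Th -> rep Th a -> in_chars L a.
Proof.
move=> ThR Tha k; have [lt_kn|le_nk] := ltnP k n.+1; last first.
  rewrite char_series_ge; first exact: restr0.
  by case: Tha => a_size _ _; apply: leq_trans a_size le_nk.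
split=> [s|j]; first by rewrite -(rep_coef (Ordinal lt_kn) s Tha); apply: vge_tofrac.
have [d dP] := ThR j; exists d => s le_ds.
rewrite -(rep_coef (Ordinal lt_kn) s Tha); apply/vge_divides/dP.
by rewrite mdeg_mono (leq_trans le_ds) // ltnW // ltn_expl ?p_gt1.
Qed.

Lemma in_chars_restricted n (Th : pseries R n) a :
  in_chars L a -> rep Th a -> restricted pi Th.
Proof.
move=> aV Tha j; have /choice[N NP] : forall k : 'I_n.+1, exists N, forall s,
    (N <= s)%N -> vge j (char_series L k a s).
  by move=> k; case: (aV k) => _ /(_ j).
exists (p ^ \max_k N k)%N => m le_m.
have [Thm|] := eqVneq (Th m) 0; first by rewrite Thm; exists 0; rewrite mulr0.
case: (Tha) => _ ThA _ /eqP/ThA[k [s mE]]; subst m.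
apply/vge_divides; rewrite (rep_coef _ _ Tha); apply: NP.
by move: le_m; rewrite mdeg_mono leq_exp2l ?p_gt1 //; apply: leq_trans; apply: leq_bigmax.
Qed.

Lemma in_chars_rep n a : in_chars L a -> (size a <= n.+1)%N ->
  exists Th : pseries R n, rep Th a.
Proof.
move=> aV a_size; have /choice[Th ThP] : forall m : 'X_{1..n.+1}, exists y : R,
    (forall k s, m = mono X k s -> tofrac y = char_series L k a s) /\
    (y <> 0 -> exists k s, m = mono X k s).
  move=> m; have [[k [s mE]]|m_n] := pselect (exists k s, m = mono X k s); last first.
    exists 0; split=> // k s mE; by case: m_n; exists k, s.
  have /vge0P[y yE] : vge 0 (char_series L k a s) by case: (aV k).
  exists y; split=> [k' s'|_]; last by exists k, s.
  by rewrite mE => /mono_inj[<- <-].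
exists Th; split=> [//|m|k s]; first by case: (ThP m).
by rewrite mxE; case: (ThP (mono X k s)) => /(_ k s erefl).
Qed.

Lemma char_series_inj a : (forall k, char_series L k a = 0) -> a = 0.
Proof.
move=> a0; have a_size : (size a <= (size a).-1.+1)%N by case: (size a).
have : log_row (size a).-1 L a = 0.
  by apply: ghost_mx_inj; apply/rowP => k; rewrite log_rowE // a0 mxE.
move=> /rowP rowE; apply/polyP => i; rewrite coef0.
have [le_ai|lt_ia] := leqP (size a) i; first by rewrite nth_default.
have lt_i : (i < (size a).-1.+1)%N by apply: leq_trans a_size.
have /tpsP/(_ 0%N) := rowE (Ordinal lt_i).
by rewrite !mxE tpsCM tps0 (log_twist0 L0) mulr1.
Qed.

(** Applying phi to the coefficients turns a_i log^(phi^i) into phi(a_i) log^(phi^(i+1)), and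
    substituting F turns w_i into w_(i+1). Both indices move up by one, hence the shift. *)
Lemma phi_star_rep n (Th : pseries R n) a :
  rep Th a -> rep (phi_star pi Q phi Th) (phi_poly a).
Proof.
move=> Tha; case: (Tha) => a_size ThA _.
pose Thp : pseries R n := fun mu => phi (Th mu).
have ThpA : add_series Thp.
  by move=> m Thpm; apply: ThA => Thm; apply: Thpm; rewrite /Thp Thm rmorph0.
pose F := frob_poly pi Q n.
have starE mu : phi_star pi Q phi Th mu = (peval F (trunc Thp (mdeg mu).+1))@_mu.
  rewrite peval_sum raddf_sum; apply: eq_bigr => nu _.
  by rewrite /= pevalZ mcoeffZ pevalXm.
apply: row_rep.
- exact: size_phi_poly.
- move=> m; rewrite starE => /eqP.
  by apply: trunc_add_poly => // j; apply: frob_add_poly.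
pose V : 'rV[S]_n.+1 := \row_i (C (phiK a`_i) * log_twist L i.+1).
have ThpE : row_series Thp = V *m ghost_mx X n.
  apply/rowP => k; transitivity (phiS (row_series Th 0 k)).
    by apply/tpsP => s; rewrite /tps_map !mxE phiK_tofrac.
  have termE i : phiS (log_row n L a 0 i * ghost_mx X n i k) = V 0 i * ghost_mx X n i k.
    have lE : log_row n L a 0 i = C a`_i * log_twist L i by rewrite mxE.
    have vE : V 0 i = C (phiK a`_i) * phiS (log_twist L i) by rewrite mxE.
    have gE : phiS (ghost_mx X n i k) = ghost_mx X n i k.
      rewrite [ghost_mx _ _ _ _]mxE; case: ifP => _; last exact: rmorph0.
      rewrite rmorphM /= tps_map_tau tps_mapC; congr (C _ * _).
      by apply: etrans (rmorphXn _ _ _) _; congr (_ ^+ _); apply: phiK_pi.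
    rewrite lE vE -{2}gE rmorphM; congr (_ * _); rewrite rmorphM /=; congr (_ * _).
    exact: tps_mapC.
  have rowE : row_series Th 0 k = \sum_i log_row n L a 0 i * ghost_mx X n i k.
    by rewrite (rep_row Tha) [LHS]mxE.
  rewrite rowE rmorph_sum [RHS]mxE; apply: eq_bigr => i _; exact: termE.
apply/rowP => l; transitivity ((row_series Thp *m row_mx F) 0 l).
  apply/tpsP => s; apply: etrans (row_trunc_exact F l ThpA (ltnSn (p ^ s))).
  by rewrite mxE starE mdeg_mono.
rewrite ThpE -mulmxA [LHS]mxE [RHS]mxE [RHS]big_ord_recl.
have -> : log_row n.+1 L (phi_poly a) 0 ord0 = 0.
  by rewrite mxE coef_phi_poly rmorph0 mul0r.
rewrite mul0r add0r; apply: eq_bigr => i _; rewrite frob_mxP; congr (_ * _).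
by rewrite !mxE coef_phi_poly.
Qed.

Lemma phi_star_iter_rep n (Th : pseries R n) a i :
  rep Th a -> rep (@phi_star_iter _ pi Q phi n i Th) (iter i (@phi_poly X) a).
Proof. by move=> Tha; elim: i => //= i; apply: phi_star_rep. Qed.

(* The coefficients of \sum_i a_i log^(phi^i)(w_i) as a series in x_0, x_1, ... *)
Definition coef_oo a (mu : {fsfun nat -> nat with 0%N}) : K :=
  let k := head 0%N (finsupp mu) in let s := trunc_log p (mu k) in
  if (finsupp mu == [fset k]%fset) && (mu k == p ^ s)%N then char_series L k a s else 0.

Lemma coef_ooD a b mu : coef_oo (a + b) mu = coef_oo a mu + coef_oo b mu.
Proof. by rewrite /coef_oo; case: ifP => _; rewrite ?addr0 // char_seriesD tpsD. Qed.
Lemma coef_ooZ c a mu : coef_oo (c *: a) mu = c * coef_oo a mu.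
Proof. by rewrite /coef_oo; case: ifP => _; rewrite ?mulr0 // char_seriesZ tpsCM. Qed.
Lemma coef_oo0 mu : coef_oo 0 mu = 0.
Proof. by rewrite -(scale0r (0 : {poly K})) coef_ooZ mul0r. Qed.
Lemma coef_oo_sum I (r : seq I) (P : pred I) (F : I -> {poly K}) mu :
  coef_oo (\sum_(i <- r | P i) F i) mu = \sum_(i <- r | P i) coef_oo (F i) mu.
Proof. by elim/big_rec2: _ => [|i x y _ <-]; rewrite ?coef_oo0 ?coef_ooD. Qed.

Definition mono_oo k s : {fsfun nat -> nat with 0%N} := [fsfun [fsfun] with k |-> (p ^ s)%N].

Lemma mono_ooE k s i : mono_oo k s i = if i == k then (p ^ s)%N else 0%N.
Proof. by rewrite fsfun_withE fsfunE. Qed.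

Lemma finsupp_mono_oo k s : finsupp (mono_oo k s) = [fset k]%fset.
Proof.
apply/fsetP => i; rewrite mem_finsupp mono_ooE inE; case: (i =P k) => // _.
by rewrite -lt0n expn_gt0 p_gt0.
Qed.

Lemma head_fset1 (k : nat) : head 0%N (enum_fset [fset k]%fset) = k.
Proof.
have kP : k \in enum_fset [fset k]%fset by apply: fset11.
case E: (enum_fset _) kP => [|x l] //= _.
have : x \in enum_fset [fset k]%fset by rewrite E mem_head.
by move=> x_in; have /fset1P : x \in [fset k]%fset := x_in.
Qed.

Lemma coef_mono_oo a k s : coef_oo a (mono_oo k s) = char_series L k a s.
Proof.
rewrite /coef_oo finsupp_mono_oo head_fset1 /= eqxx mono_ooE eqxx.
by rewrite trunc_expnK ?p_gt1 // eqxx.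
Qed.

Lemma coef_oo_nmono a mu : ~ (exists k s, mu = mono_oo k s) -> coef_oo a mu = 0.
Proof.
move=> mu_n; rewrite /coef_oo; case: ifP => // /andP[/eqP mu_k /eqP mu_s].
case: mu_n; exists (head 0%N (finsupp mu)), (trunc_log p (mu (head 0%N (finsupp mu)))).
apply/fsfunP => i; rewrite mono_ooE; case: (i =P _) => [->|ne_i] //.
apply/eqP; rewrite -memNfinsupp // mu_k inE; exact/eqP.
Qed.

Lemma coef_oo_inj a b : coef_oo a =1 coef_oo b -> a = b.
Proof.
move=> ab; apply/eqP; rewrite -subr_eq0; apply/eqP/char_series_inj => k.
apply/tpsP => s; rewrite tps0 -coef_mono_oo -scaleN1r coef_ooD coef_ooZ ab.
by rewrite mulN1r subrr.
Qed.

Lemma pull_back_rep n (Th : pseries R n) a mu :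
  rep Th a -> tofrac (pull_back Th mu) = coef_oo a mu.
Proof.
move=> Tha; rewrite /pull_back; case: allP => [mu_n|mu_n].
  have [[k [s muE]]|mu_nm] := pselect (exists k s, mu = mono_oo k s).
    have lt_k : (k < n.+1)%N.
      by apply: mu_n; rewrite muE finsupp_mono_oo; apply: fset11.
    rewrite muE coef_mono_oo -(rep_coef (Ordinal lt_k) s Tha); congr (tofrac (Th _)).
    by apply/mnmP => i; rewrite mnmE monoE mono_ooE -val_eqE /= eq_sym.
  rewrite coef_oo_nmono //; apply/eqP; rewrite tofrac_eq0; apply/eqP.
  apply: contrapT => Thm; case: Tha => _ ThA _; have [k [s muE]] := ThA _ Thm.
  apply: mu_nm; exists (k : nat), s.
  apply/fsfunP => i; rewrite mono_ooE.
  have [le_in|lt_ni] := leqP i n.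
    have := congr1 (fun m : 'X_{1..n.+1} => m (Ordinal (le_in : (i < n.+1)%N))) muE.
    by rewrite mnmE monoE -val_eqE /= eq_sym.
  rewrite gtn_eqF ?(leq_trans (ltn_ord k)) //; apply/eqP; rewrite -memNfinsupp //.
  by apply/negP => /mu_n; rewrite leqNgt lt_ni.
rewrite tofrac0; have [[k [s muE]]|] := pselect (exists k s, mu = mono_oo k s); last first.
  by move/coef_oo_nmono->.
rewrite muE coef_mono_oo char_series_ge ?tps0 //.
case: Tha => a_size _ _; apply: leq_trans a_size _; rewrite ltnNge.
apply/negP => le_kn; apply: mu_n => i.
by rewrite muE finsupp_mono_oo => /fset1P->.
Qed.

Lemma twisted_act_rep n (P : {poly R}) (Th : pseries R n) a mu : rep Th a ->
  tofrac (twisted_act pi Q phi P Th mu) = coef_oo (twisted_comb P a) mu.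
Proof.
move=> Tha; rewrite /twisted_act rmorph_sum coef_oo_sum; apply: eq_bigr => i _.
rewrite [LHS]rmorphM coef_ooZ; congr (_ * _); apply: pull_back_rep.
exact: phi_star_iter_rep.
Qed.

End CharacterRep.

(** * The tensor product *)

Section TwistedTensors.

Variables (R : idomainType) (pi : R) (q Q : nat) (phi : {rmorphism R -> R}).
Variables (A : comNzRingType) (theta : A -> R) (E : A -> nat -> R) (n : nat).
Local Notation act := (twisted_act pi Q phi).
Local Notation cmap := (canonical_map pi Q phi).
Implicit Types (P : {poly R}) (Th : pseries R n).

Lemma twisted_act_widen N P Th mu : (size P <= N)%N -> act P Th mu =
  \sum_(i < N) P`_i * pull_back (@phi_star_iter _ pi Q phi n i Th) mu.
Proof.
move=> le_PN; rewrite /twisted_act.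
rewrite -(big_mkord predT (fun i => P`_i * pull_back (@phi_star_iter _ pi Q phi n i Th) mu)).
rewrite -(big_mkord predT (fun i => P`_i * pull_back (@phi_star_iter _ pi Q phi n i Th) mu)).
rewrite [RHS](big_cat_nat (n := size P)) //= [X in _ = _ + X]big_nat_cond.
rewrite [X in _ = _ + X]big1 ?addr0 // => i; rewrite andbT => /andP[le_Pi _].
by rewrite nth_default // mul0r.
Qed.

Lemma twisted_actD P P' Th mu : act (P + P') Th mu = act P Th mu + act P' Th mu.
Proof.
rewrite (twisted_act_widen _ _ (size_polyD P P')).
rewrite (twisted_act_widen _ _ (leq_maxl (size P) (size P'))).
rewrite (twisted_act_widen _ _ (leq_maxr (size P) (size P'))).
by rewrite -big_split; apply: eq_bigr => i _; rewrite coefD mulrDl.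
Qed.

Lemma twisted_actZ r P Th mu : act (r *: P) Th mu = r * act P Th mu.
Proof.
rewrite (twisted_act_widen _ _ (size_scale_leq r P)) mulr_sumr.
by apply: eq_bigr => i _; rewrite coefZ mulrA.
Qed.

Lemma twisted_act0 Th mu : act 0 Th mu = 0.
Proof. by rewrite /twisted_act size_poly0 big_ord0. Qed.

Lemma phi_star_iterD i Th Th' :
  @phi_star_iter _ pi Q phi n i (fun mu => Th mu + Th' mu) =
  fun mu => phi_star_iter pi Q phi Th mu + phi_star_iter pi Q phi Th' mu.
Proof.
elim: i => //= i ->; apply/funext => mu; rewrite /phi_star -big_split.
by apply: eq_bigr => nu _; rewrite rmorphD mulrDl.
Qed.

Lemma phi_star_iterZ i r Th :
  @phi_star_iter _ pi Q phi n i (fun mu => r * Th mu) =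
  fun mu => iter i phi r * phi_star_iter pi Q phi Th mu.
Proof.
elim: i => //= i ->; apply/funext => mu; rewrite /phi_star mulr_sumr.
by apply: eq_bigr => nu _; rewrite rmorphM mulrA.
Qed.

Lemma twisted_actDr P Th Th' mu :
  act P (fun mu => Th mu + Th' mu) mu = act P Th mu + act P Th' mu.
Proof.
rewrite /twisted_act -big_split; apply: eq_bigr => i _ /=; rewrite phi_star_iterD -mulrDr.
by congr (_ * _); rewrite /pull_back; case: ifP => _; rewrite ?addr0.
Qed.

Lemma twisted_act_balanced P r Th mu :
  act (twisted_rscale phi P r) Th mu = act P (fun mu => r * Th mu) mu.
Proof.
rewrite (twisted_act_widen _ _ (size_poly _ _)); apply: eq_bigr => i _.
rewrite coef_poly ltn_ord -mulrA phi_star_iterZ; congr (_ * _).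
by rewrite /pull_back; case: ifP => _; rewrite ?mulr0.
Qed.

Lemma tensor_eq_cmap s s' : tensor_eq pi q Q phi theta E (n := n) s s' -> cmap s =1 cmap s'.
Proof.
elim=> {s s'} //.
- by move=> s s' _ IH mu; rewrite IH.
- by move=> s s' s'' _ IH _ IH' mu; rewrite IH IH'.
- by move=> s s' mu; rewrite /canonical_map !big_cat /= addrC.
- move=> s1 s2 s1' s2' _ IH1 _ IH2 mu.
  by move: (IH1 mu) (IH2 mu); rewrite /canonical_map !big_cat /= => -> ->.
- by move=> Th _ mu; rewrite /canonical_map big_cons big_nil twisted_act0 addr0.
- by move=> P P' Th _ mu; rewrite /canonical_map !big_cons !big_nil twisted_actD !addr0.
- by move=> P Th Th' _ _ mu; rewrite /canonical_map !big_cons !big_nil twisted_actDr !addr0.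
- by move=> P r Th _ mu; rewrite /canonical_map !big_cons !big_nil twisted_act_balanced.
Qed.

Lemma tensor_wf_cons x (s : tensor R n) :
  tensor_wf pi q Q phi theta E (x :: s) <->
  character pi q Q phi theta E x.2 /\ tensor_wf pi q Q phi theta E s.
Proof.
split=> [wf|[x_char wf] [|j] //]; last by rewrite ltnS => /wf.
by split=> [|j lt_j]; [apply: (wf 0%N) | apply: (wf j.+1)].
Qed.

(** Each factor is c times Th0; balancing moves c to the left, and additivity on the left merges the
    summands. *)
Lemma tensor_pure Th0 : character pi q Q phi theta E Th0 ->
    (forall Th, character pi q Q phi theta E Th -> exists c, forall mu, Th mu = c * Th0 mu) ->
  forall s, tensor_wf pi q Q phi theta E s ->
  exists P, tensor_eq pi q Q phi theta E s [:: (P, Th0)].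
Proof.
move=> Th0C gen; elim=> [|[P Th] s IHs] wf.
  by exists 0; apply/tensor_sym/tensor_0l.
have [ThC /IHs[P' sP']] := (tensor_wf_cons _ _).1 wf.
have [c /= ThE] := gen _ ThC; exists (twisted_rscale phi P c + P').
apply: tensor_trans (tensor_sym (tensor_Dl _ _ Th0C)).
have -> : (P, Th) :: s = [:: (P, fun mu => c * Th0 mu)] ++ s.
  by congr ((_, _) :: _); apply/funext.
apply: (@tensor_cat _ _ _ _ _ _ _ _ _ _ _ [:: _] [:: _]) => //.
exact/tensor_sym/tensor_balanced.
Qed.

End TwistedTensors.

(** * Finite kernels and reduction modulo pi *)

Section FiniteKernel.

Variable X : frob_dvr.
Local Notation R := (fd_ring X).
Local Notation K := {fraction R}.
Local Notation pi := (fd_pi X).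

(* R<x>/(f) modulo pi would be (R/pi)[x]. *)
Lemma finite_zeros_nonzero f d :
  finite_zeros_of_degree pi f d -> ~ (forall N, divides pi (f N)).
Proof.
move=> [b _ bP] f_pi.
have mono_null l : null_seq pi (fun N => (N == l)%:R : R).
  move=> k; exists l.+1 => N lt_lN; rewrite gtn_eqF //.
  by exists 0; rewrite mulr0.
have /choice[c cP] : forall l : 'I_d.+1, exists c : {ffun 'I_d -> R}, exists h, forall N : nat,
    (N == l :> nat)%:R = \sum_j c j * b j N + cauchy_mul f h N.
  by move=> l; have [c [[h _ hP] _]] := bP _ (mono_null l); exists c; exists h => N; exact: hP.
have /choice[g gP] := cP.
have gE (l : 'I_d.+1) (N : nat) : (N == l :> nat)%:R = \sum_j c l j * b j N + cauchy_mul f (g l) N := gP l N.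
pose M : 'M[K]_(d.+1, d) := \matrix_(l, j) tofrac (c l j).
(* The d + 1 monomials 1, ..., x^d are combinations of d elements modulo f, so a nontrivial
   combination of them is a multiple of f. *)
have : kermx M != 0.
  by rewrite -mxrank_eq0 mxrank_ker subn_eq0 -ltnNge ltnS rank_leq_col.
case/rowV0Pn => v /sub_kermxP vM v_neq0.
have [i0 vi0] : exists i, v 0 i != 0.
  apply: contrapT => no_i; case/eqP: v_neq0; apply/rowP => i; rewrite mxE.
  by apply/eqP/contraT => vi; case: no_i; exists i.
(* Scaled to be integral with coefficient 1 at x^I, the combination contradicts f being 0 modulo
   pi. *)
have [|I [lt_I vI v_int _]] := @last_min_valuation X d.+1 (fun i => v 0 (inord i)).
  by exists i0 => //; rewrite inord_val.
pose u l := v 0 l / v 0 (inord I).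
have u_int l : vge 0 (u l) by have := v_int l (ltn_ord l); rewrite inord_val.
pose delta (l : 'I_d.+1) : R := (I == l :> nat)%:R.
have deltaE l : delta l = \sum_j c l j * b j I + cauchy_mul f (g l) I := gE l I.
have : \sum_l u l * tofrac (delta l) = \sum_l u l * tofrac (cauchy_mul f (g l) I).
  apply/eqP; rewrite -subr_eq0 -sumrB; apply/eqP.
  transitivity (\sum_l \sum_j u l * (tofrac (c l j) * tofrac (b j I))).
    apply: eq_bigr => l _; rewrite deltaE tofracD mulrDr addrK rmorph_sum mulr_sumr.
    by apply: eq_bigr => j _; rewrite /= tofracM.
  rewrite exchange_big big1 // => j _ /=.
  have /rowP/(_ j) := vM; rewrite !mxE => vMj.
  transitivity ((v 0 (inord I))^-1 * tofrac (b j I) * \sum_l v 0 l * M l j); last first.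
    by rewrite vMj mulr0.
  by rewrite mulr_sumr; apply: eq_bigr => l _; rewrite mxE /u; ring.
rewrite (bigD1 (inord I)) //= /delta inordK // eqxx tofrac1 mulr1 /u divff // big1 => [|l]; last first.
  rewrite -val_eqE /= inordK // => ne_l; rewrite eq_sym (negPf ne_l).
  by rewrite tofrac0 mulr0.
rewrite addr0 => E1; apply: (@nvge_1 X); rewrite [X in vge _ X]E1.
apply: vge_sum => l _; rewrite -[1]add0r; apply: vgeM (u_int l) _.
rewrite rmorph_sum; apply: vge_sum => i _; rewrite /= tofracM -[1]addr0.
apply: vgeM (vge_tofrac _); apply/(vge_divides 1).
by rewrite expr1.
Qed.

End FiniteKernel.

Lemma sum_multiples (V : nmodType) h M (f : nat -> V) : (0 < h)%N ->
  (forall i, ~~ (h %| i)%N -> f i = 0) ->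
  \sum_(i < (h * M).+1) f i = \sum_(j < M.+1) f (h * j)%N.
Proof.
move=> h0 f0; elim: M => [|M IHM]; first by rewrite muln0 !big_ord1 muln0.
rewrite [RHS]big_ord_recr /= -IHM -(big_mkord predT) (big_cat_nat (n := (h * M).+1)) //=; last first.
  by rewrite ltnS leq_pmul2l.
rewrite big_mkord big_nat_recr /=; last by rewrite ltn_pmul2l.
congr (_ + _); rewrite big_nat_cond big1 ?add0r // => i; rewrite andbT => /andP[lt_i gt_i].
apply: f0; apply/negP => /dvdnP[j iE]; move: lt_i gt_i.
by rewrite iE [(j * h)%N]mulnC !ltn_pmul2l // => lt_j; rewrite ltnS leqNgt lt_j.
Qed.

Lemma tps_of_tau_mul (X : frob_dvr) h (b c : nat -> fd_ring X) : (0 < h)%N ->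
  tps_of_seq h (tau_mul (fd_p X ^ h) b c) = tps_of_seq h b * tps_of_seq h c.
Proof.
move=> h0; apply/tpsP => s; rewrite tpsM {1}/tps_of_seq; case: ifP => [/dvdnP[M ->]|s_nh].
  rewrite mulnK // [(M * h)%N]mulnC /tau_mul rmorph_sum.
  rewrite (sum_multiples M (f := fun i => tps_of_seq h b i * frobn (pchar_K X) i (tps_of_seq h c (h * M - i)%N))) //.
    apply: eq_bigr => j _; rewrite -mulnBr /tps_of_seq !dvdn_mulr // !mulKn //.
    by rewrite /= tofracM tofracXn frobnE expnM.
  by move=> i /negPf i_nh; rewrite /tps_of_seq i_nh mul0r.
rewrite big1 // => i _; rewrite /tps_of_seq; case: ifP => hi; last by rewrite mul0r.
by rewrite dvdn_subl ?s_nh ?rmorph0 ?mulr0 // -ltnS.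
Qed.

(** * Transport to characters and tensors *)

Section Splitting.

Variables (X : frob_dvr) (h : nat).
Hypothesis h_gt0 : (0 < h)%N.
Variables (A : comNzRingType) (theta : A -> fd_ring X) (E : A -> nat -> fd_ring X).
Variables (t : A) (m : nat).
Local Notation R := (fd_ring X).
Local Notation K := {fraction R}.
Local Notation p := (fd_p X).
Local Notation pi := (fd_pi X).
Local Notation phi := (fd_phi X).
Local Notation Q := (p ^ fd_e X)%N.
Local Notation q := (p ^ h)%N.
Local Notation C := (@tpsC _ _ (pchar_K X)).
Local Notation piK := (piK X).
Local Notation emb := (tps_of_seq (X := X) h).
Hypothesis E_adm : admissible pi q theta E.
Hypothesis theta_t : theta t = pi.
Hypothesis phi_theta : forall a, phi (theta a) = theta a.
Hypothesis E_t_unit : exists i, ~ divides pi (E t i).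
Hypothesis E_split : splits_at pi q Q phi theta E m.

Let E_null a : null_seq pi (E a). Proof. by case: E_adm. Qed.

Let emb0 a : emb (E a) 0%N = tofrac (theta a).
Proof. by rewrite /tps_of_seq dvdn0 div0n; case: E_adm => _ _ _ _ ->. Qed.

Let embM a b : emb (E (a * b)) = emb (E a) * emb (E b).
Proof.
case: E_adm => _ _ _ EM _; rewrite -tps_of_tau_mul //.
by congr (tps_of_seq _ _); apply/funext => i; apply: EM.
Qed.

Let Phi := emb (E t).

Let Phi0 : Phi 0%N = piK. Proof. by rewrite /Phi emb0 theta_t. Qed.

Let Phi_restr : restr Phi.
Proof.
split=> [s|k]; first by rewrite /Phi /tps_of_seq; case: ifP => _; [apply: vge_tofrac | apply: vge_0].
have [N NP] := E_null t k; exists (h * N)%N => s le_s; rewrite /Phi /tps_of_seq.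
case: ifP => [hs|_]; last exact: vge_0.
by apply/vge_divides/NP; rewrite leq_divRL // mulnC.
Qed.

Let Phi_unit : exists d, ~ @vge X 1 (Phi d).
Proof.
have [i Ei] := E_t_unit; exists (h * i)%N; rewrite /Phi /tps_of_seq dvdn_mulr // mulKn //.
by move=> /(vge_divides 1); rewrite expr1.
Qed.

Lemma splitting : free_rank_one pi q Q phi theta E m /\
  canonical_map_iso pi q Q phi theta E m.
Proof.
have [L L0 LP] := log_exists Phi0.
(* Since A is commutative, L phi_E(c) satisfies the equation defining L, so it is a multiple of
   L. *)
have LPc c : L * emb (E c) = C (tofrac (theta c)) * L.
  have gP : L * emb (E c) * Phi = C piK * (L * emb (E c)).
    by rewrite -mulrA -embM mulrC embM mulrA LP mulrA.
  rewrite (log_unique Phi0 L0 LP gP); congr (C _ * _).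
  by rewrite tpsM big_ord1 L0 mul1r frobn0 subn0 emb0.
have charP n (Th : pseries R n) : character pi q Q phi theta E Th ->
    exists2 a, in_chars L a & rep L Th a.
  move=> [ThR ThC]; have ThA : add_series Th.
    by apply: additive_add_series => // B Bn; case: (ThC B Bn).
  have Th_act (B : comAlgType R) : pi_nilpotent pi B -> forall x : {ffun 'I_n.+1 -> B},
      series_eval Th (jet_act pi q Q phi E t x) = theta t *: series_eval Th x.
    by move=> Bn; case: (ThC B Bn) => _; apply.
  have [a a_size ThE] := row_series_log h_gt0 E_null ThR ThA Th_act theta_t Phi0 L0 LP.
  by have Tha := row_rep a_size ThA ThE; exists a => //; apply: rep_in_chars Tha.
have repC n (Th : pseries R n) a : in_chars L a -> rep L Th a ->
    character pi q Q phi theta E Th.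
  move=> aV Tha; have [_ ThA _] := Tha.
  apply: (log_character h_gt0 E_null _ ThA (rep_row Tha) LPc phi_theta).
  exact: in_chars_restricted Tha.
have rep0 n (Th : pseries R n) : rep L Th 0 -> forall mu, Th mu = 0.
  move=> Th0 mu; have := repZ 0 Th0; rewrite tofrac0 scale0r => Th0'.
  by rewrite (rep_inj Th0 Th0') mul0r.
have m_ex : exists a, [/\ in_chars L a, (size a <= m.+1)%N & a != 0].
  have [[Th ThC [mu Thmu]] _] := E_split; have [a aV Tha] := charP _ _ ThC.
  exists a; split=> //; first by case: Tha.
  by apply/eqP => a0; apply: Thmu; apply: rep0; rewrite a0 in Tha.
(* Size at most m means a character in X_(m-1)(E), which vanishes; for m = 0 the polynomial itself
   is 0. *)
have m_min a : in_chars L a -> (size a <= m)%N -> a = 0.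
  have [_ E_min] := E_split; case: m E_min => [|i] E_min aV.
    by rewrite leqn0 size_poly_eq0 => /eqP.
  move=> a_size; have [Th Tha] := in_chars_rep aV a_size.
  have Th0 := E_min i (ltnSn i) Th (repC _ _ _ aV Tha).
  apply: (char_series_inj L0) => k; have [lt_ki|le_ik] := ltnP k i.+1; last first.
    by apply: char_series_ge; apply: leq_trans a_size le_ik.
  apply/tpsP => s; rewrite -(rep_coef (Ordinal lt_ki) s Tha) Th0 tofrac0.
  by rewrite tps0.
have [a0 [a0V a0_size a0m gen]] := char_generator Phi0 Phi_restr Phi_unit L0 LP m_ex m_min.
have a0m_neq0 : a0`_m != 0 by rewrite a0m invr_eq0 piK_neq0.
have comb_inj := twisted_comb_inj a0_size a0m_neq0.
have [Th0 Th0a] := in_chars_rep a0V a0_size.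
have Th0C := repC _ _ _ a0V Th0a.
have gen_m (Th : pseries R m) : character pi q Q phi theta E Th ->
    exists c, forall mu, Th mu = c * Th0 mu.
  move=> /charP[a aV Tha]; have [P aE] := gen a aV.
  (* A leading term of P in degree d > 0 would give a nonzero coefficient of a in degree m + d,
     beyond its size. *)
  have sP : (size P <= 1)%N.
    rewrite leqNgt; apply/negP => P1.
    have aP : a`_(m + (size P).-1) = 0.
      rewrite nth_default //; case: Tha => + _ _ => /leq_trans; apply.
      by case: (size P) P1 => [|[|s]] // _; rewrite addnS ltnS leq_addr.
    have P_size : size P = (size P).-1.+1 by rewrite prednK // ltnW.
    move/eqP: aP; rewrite aE (twisted_comb_widen _ (eq_leq P_size)) big_ord_recr /= coefD coefZ.
    rewrite coef_sum big1 => [|i _]; last first.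
      rewrite coefZ [X in _ * X]nth_default ?mulr0 //.
      by apply: leq_trans (size_iter_phi_poly _ a0_size) _; rewrite addSn -addnS leq_add2l.
    rewrite add0r coef_iter_phi_poly mulf_eq0 tofrac_eq0 -lead_coefE lead_coef_eq0.
    rewrite -size_poly_eq0 P_size /=; apply/negP.
    by elim: (_.-1) => // i IHi; rewrite /= fmorph_eq0.
  exists P`_0; have {}aE : a = tofrac P`_0 *: a0.
    by rewrite aE (twisted_comb_widen _ sP) big_ord1.
  by rewrite aE in Tha; apply: rep_inj Tha (repZ _ Th0a).
(* Both identities are proved together, so that one polynomial b describes s and its shift describes
   [tensor_phi_star] of s. *)
have cmapP (s : tensor R m) : tensor_wf pi q Q phi theta E s -> exists2 b, in_chars L b &
    (forall mu, tofrac (canonical_map pi Q phi s mu) = coef_oo L b mu) /\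
    (forall mu, tofrac (canonical_map pi Q phi (tensor_phi_star phi s) mu) =
                coef_oo L (phi_poly b) mu).
  elim: s => [|[P Th] s IHs] wf.
    exists 0; first exact: in_chars0.
    have -> : phi_poly (0 : {poly K}) = 0 by rewrite /phi_poly map_poly0 mul0r.
    by split=> mu; rewrite /canonical_map big_nil tofrac0 coef_oo0.
  have [/charP[a aV Tha] /IHs[b bV [bE bE']]] := (tensor_wf_cons _ _ _ _ _ _ _ _).1 wf.
  exists (twisted_comb P a + b).
    apply: in_charsD bV; apply: in_chars_sum => i _; apply: in_charsZ (vge_tofrac _) _.
    exact: (in_chars_iter_phi Phi0 Phi_restr L0 LP).
  split=> mu; rewrite /canonical_map /= big_cons /= tofracD.
    by rewrite coef_ooD -bE (twisted_act_rep _ _ Tha).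
  have -> : phi_poly (twisted_comb P a + b) = twisted_comb (phi_star_lmul phi P) a + phi_poly b.
    have phiD (u v : {poly K}) : phi_poly (u + v) = phi_poly u + phi_poly v.
      by rewrite /phi_poly rmorphD mulrDl.
    rewrite phiD; congr (_ + _).
    have sP : (size (phi_star_lmul phi P) <= (size P).+1)%N.
      by rewrite (leq_trans (size_polyMleq _ _)) // size_polyX addn2 /= ltnS size_poly.
    rewrite (twisted_comb_widen _ sP) big_ord_recl coefMX /= tofrac0 scale0r add0r.
    rewrite /twisted_comb; apply: (big_ind2 (fun u v => phi_poly u = v)).
    - by rewrite /phi_poly map_poly0 mul0r.
    - by move=> u1 v1 u2 v2 <- <-; apply: phiD.
    move=> i _; rewrite coefMX /= coef_map -phiK_tofrac /phi_poly map_polyZ.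
    by rewrite -scalerAl.
  by rewrite coef_ooD -bE' (twisted_act_rep _ _ Tha).
split.
  exists Th0 => // Th /gen_m[c ThE]; exists c; split=> // c' Th'E.
  have [mu Th0mu] : exists mu, Th0 mu != 0.
    apply: contrapT => no_mu; case/eqP: a0m_neq0.
    suff -> : a0 = 0 by rewrite coef0.
    apply: (char_series_inj L0) => k; apply/tpsP => s; rewrite tps0.
    have [lt_km|le_mk] := ltnP k m.+1; last first.
      by rewrite char_series_ge ?tps0 //; apply: leq_trans a0_size le_mk.
    rewrite -(rep_coef (Ordinal lt_km) s Th0a); apply/eqP; rewrite tofrac_eq0.
    by apply/contraT => Thmu; case: no_mu; exists (mono X (Ordinal lt_km) s).
  by apply: (mulIf Th0mu); rewrite -ThE.
have cmap1 P mu : tofrac (canonical_map pi Q phi [:: (P, Th0)] mu) =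
    coef_oo L (twisted_comb P a0) mu.
  by rewrite /canonical_map big_cons big_nil addr0; apply: twisted_act_rep.
split=> [s /cmapP[b bV [bE _]]|s s' s_wf s'_wf|Psi [n [Th [/charP[a aV Tha] PsiE]]]|s s_wf].
- have b_size : (size b <= (size b).+1)%N by [].
  have [Th Thb] := in_chars_rep bV b_size; exists (size b), Th.
  split; first exact: repC Thb.
  by move=> mu; apply/eqP; rewrite -tofrac_eq bE (pull_back_rep _ Thb).
- split=> [ss'|]; last exact: tensor_eq_cmap.
  have [P sP] := tensor_pure Th0C gen_m s_wf; have [P' sP'] := tensor_pure Th0C gen_m s'_wf.
  suff PP' : P = P' by rewrite PP' in sP; apply: tensor_trans sP (tensor_sym sP').
  apply: comb_inj; apply: (coef_oo_inj L0) => mu.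
  by rewrite -!cmap1 -(tensor_eq_cmap sP) -(tensor_eq_cmap sP') ss'.
- have [P aE] := gen a aV; exists [:: (P, Th0)]; first by case=> [|j].
  move=> mu; apply/eqP; rewrite -tofrac_eq PsiE (pull_back_rep _ Tha) aE.
  by rewrite cmap1.
have [b bV [bE bE']] := cmapP s s_wf; split=> [r mu|l Th ThC sTh mu].
  rewrite /canonical_map big_map mulr_sumr; apply: eq_bigr => x _ /=.
  exact: twisted_actZ.
have [a aV Tha] := charP _ _ ThC; apply/eqP; rewrite -tofrac_eq bE'.
rewrite (pull_back_rep _ (phi_star_rep Tha)) (_ : b = a) //.
by apply: (coef_oo_inj L0) => nu; rewrite -bE sTh (pull_back_rep _ Tha).
Qed.

End Splitting.

Lemma card_pchar (F : finFieldType) p : p \in [pchar F] ->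
  exists2 h, (0 < h)%N & #|F| = (p ^ h)%N.
Proof.
move=> pF; have cardF : #|F| = (p ^ logn p #|F|)%N := card_pprimeChar pF.
exists (logn p #|F|) => //; rewrite lt0n; apply/negP => /eqP h0.
by have := finNzRing_gt1 F; rewrite cardF h0.
Qed.

Theorem theorem1p1
  (Fq : finFieldType) (K : fieldType) (iK : {rmorphism Fq -> K})
  (ord_infty : K -> int)
  (A : comNzRingType) (iA : {rmorphism A -> K})
  (p : A -> Prop) (k : finFieldType) (res : {rmorphism A -> k}) (t : A)
  (Ahat : comNzRingType) (jA : {rmorphism A -> Ahat})
  (R : idomainType) (iR : {rmorphism Ahat -> R}) (phi : {rmorphism R -> R})
  (E : A -> nat -> R) (r m : nat) :
  let q := #|Fq| in
  let qhat := #|k| in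
  let theta := fun a : A => iR (jA a) in
  let pi := theta t in
  curve_function_field iK ->
  rational_point iK ord_infty ->
  ring_of_affine_curve iK ord_infty iA ->
  maximal_ideal p ->
  residue_field p res ->
  p t -> ~ ideal_pow p 2 t ->
  adic_completion jA p ->
  complete_dvr pi ->
  (forall x : Ahat, phi (iR x) = iR x) ->
  frobenius_lift pi qhat phi ->
  drinfeld_module pi q theta (fun a => ord_infty (iA a)) E r ->
  splits_at pi q qhat phi theta E m ->
  free_rank_one pi q qhat phi theta E m /\
  canonical_map_iso pi q qhat phi theta E m.
Proof.
move=> q qhat theta pi _ _ [iA_inj _] _ _ _ _ _ dvr phi_iR lift [adm ker] E_split.
(* The characteristic of Fq passes to A through the function field, and from A to R and to the
   residue field, so q and qhat are powers of the same prime. *)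
have [p0 p0_pr p0_Fq] := finPcharP Fq.
have p0_A : p0%:R = 0 :> A.
  apply: iA_inj; rewrite rmorph0 rmorph_nat -(rmorph_nat iK).
  by rewrite (pcharf0 p0_Fq) rmorph0.
have p0_R : p0 \in [pchar R].
  by rewrite inE p0_pr /= -(rmorph_nat iR) -(rmorph_nat jA) p0_A !rmorph0 eqxx.
have p0_k : p0 \in [pchar k] by rewrite inE p0_pr /= -(rmorph_nat res) p0_A rmorph0 eqxx.
have [h h_gt0 qE] := card_pchar p0_Fq; have [e e_gt0 qhatE] := card_pchar p0_k.
have qE' : q = (p0 ^ h)%N := qE; have qhatE' : qhat = (p0 ^ e)%N := qhatE.
clearbody q qhat; subst q qhat.
have t_neq0 : t != 0.
  have [pi_neq0 _ _ _] := dvr; apply: contraNneq pi_neq0 => t0.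
  by rewrite /pi /theta t0 !rmorph0.
pose X := FrobDvr dvr p0_R e_gt0 (phi_iR _) lift.
(* Finiteness of the kernel is applied to a = t. *)
have [d _ /(finite_zeros_nonzero (X := X)) Et_nonzero] := ker t t_neq0.
have E_t_unit : exists i, ~ divides pi (E t i).
  apply: contrapT => no_i; apply: Et_nonzero => N.
  rewrite /tau_series; elim/big_rec: _ => [|i x _ [y ->]]; first by exists 0; rewrite mulr0.
  have [z ->] : divides pi (E t i) by apply: contrapT => Ei; apply: no_i; exists i.
  by exists (z + y); rewrite mulrDr.
exact: (splitting (X := X) h_gt0 adm (erefl _) (fun a => phi_iR (jA a)) E_t_unit E_split).
Qed.
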